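(* Let $f \colon (\mathbb{C}^2, 0) \to (\mathbb{C}, 0)$ be an analytic function germ which is mini-regular in $x$ of order $m := \mathrm{ord}\, f$, and let $\xi_1,\ldots,\xi_r$ be its distinct Newton--Puiseux roots. Then $$\mathscr{L}(f) = \begin{cases} \frac{m-1}{m} & \textrm{ if } \ r = 1, \\ \max\left\{1 - \frac{1}{\mathrm{ord}\, f(\xi_{i,j}(y),y)} \mid 1\leq i<j\leq r\right\} & \textrm{ otherwise,}\end{cases}$$ where $\mathscr{L}(f)$ is the {\L}ojasiewicz gradient exponent of $f$ and $\xi_{i,j}$ denotes the approximation of $\xi_i$ and $\xi_j$.
   Context: Germs are not assumed reduced. Write the Taylor expansion $f = f_m + f_{m+1} + \cdots$ with $f_k$ homogeneous of degree $k$ and $f_m \not\equiv 0$; then $\mathrm{ord}\, f = m$, and $f$ is mini-regular in $x$ of order $m$ if $f_m(1,0) \neq 0$. The {\L}ojasiewicz gradient exponent $\mathscr{L}(f)$ is the minimum of the exponents $\ell \ge 0$ for which there are constants $c, \epsilon > 0$ with $\|\nabla f(z)\| \ge c\,|f(z)|^{\ell}$ for all $\|z\| < \epsilon$ (this minimum exists and is a rational number in $[0,1)$). A Newton--Puiseux root of $f$ is a convergent Puiseux series $\xi(y) \in \mathbb{C}\{y^{1/N}\}$ (some integer $N \ge 1$) with only positive exponents (the zero series is allowed) such that $f(\xi(y), y) \equiv 0$; roots are counted as distinct when they are distinct as series. For a Puiseux series, $\mathrm{ord}$ denotes the smallest exponent occurring with nonzero coefficient. For a Puiseux series $\gamma(y)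 = \sum_i a_i y^{\alpha_i}$ and a positive real number $\rho$, the $\rho$-approximation of $\gamma$ is the series $\sum_{\alpha_i < \rho} a_i y^{\alpha_i} + g y^{\rho}$, where $g$ is a generic constant in $\mathbb{C}$ (i.e. outside a finite set of exceptional values, so that the orders considered do not depend on $g$). For two distinct Puiseux series $\gamma_1, \gamma_2$, the approximation of $\gamma_1$ and $\gamma_2$ is the $\rho$-approximation of $\gamma_1$ (equivalently of $\gamma_2$) with $\rho := \mathrm{ord}(\gamma_1(y) - \gamma_2(y))$. *)

(* Defs.v *)
From HB Require Import structures.
From mathcomp Require Import all_boot all_order all_algebra.
From mathcomp Require Import all_classical all_reals all_analysis.
From mathcomp Require Import complex.
Set Implicit Arguments.
Unset Strict Implicit.
Unset Printing Implicit Defensive.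
Import Order.TTheory GRing.Theory Num.Theory.
Import numFieldNormedType.Exports.
Local Open Scope classical_set_scope.
Local Open Scope ring_scope.

(* The complex numbers over R. Going through numClosedFieldType gives them
   MathComp-Analysis's normed-module topology, which R[i] itself lacks. *)
Definition Cx (R : realType) : numClosedFieldType := R[i].

(* The norm of the numFieldType Cx R is Cx R-valued; this one is R-valued. *)
Definition cmod (R : realType) (z : Cx R) : R := ComplexField.Normc.normc z.

Definition norm2 (R : realType) (u v : Cx R) : R :=
  Num.sqrt (cmod u ^+ 2 + cmod v ^+ 2).

Definition is_minimum (R : realType) (A : set R) (x : R) : Prop :=
  A x /\ lbound A x.

Definition is_maximum (R : realType) (A : set R) (x : R) : Prop :=
  A x /\ ubound A x.

(** Germs of analytic functions of two variables *)

(* [a i j] is the coefficient of x^i y^j. *)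
Definition homog_part (R : realType) (a : nat -> nat -> Cx R) (k : nat)
    (x y : Cx R) : Cx R :=
  \sum_(i < k.+1) a i (k - i)%N * x ^+ i * y ^+ (k - i).

(* Only the values of f near the origin matter: f stands for its germ. *)
Definition taylor_at0 (R : realType) (f : Cx R -> Cx R -> Cx R)
    (a : nat -> nat -> Cx R) : Prop :=
  exists2 d : R, 0 < d & forall x y : Cx R, cmod x < d -> cmod y < d ->
    (\esum_(p in [set: nat * nat])
        (cmod (a p.1 p.2 * x ^+ p.1 * y ^+ p.2))%:E < +oo)%E /\
    (fun n => \sum_(k < n) homog_part a k x y) @ \oo --> f x y.

Definition is_germ_ord (R : realType) (a : nat -> nat -> Cx R) (m : nat) : Prop :=
  (forall k, (k < m)%N -> forall x y, homog_part a k x y = 0) /\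
  (exists x y, homog_part a m x y != 0).

Definition mini_regular (R : realType) (a : nat -> nat -> Cx R) (m : nat) : Prop :=
  is_germ_ord a m /\ homog_part a m 1 0 != 0.

(** Lojasiewicz gradient exponent *)

Definition grad_norm (R : realType) (f : Cx R -> Cx R -> Cx R) (x y : Cx R) : R :=
  norm2 (derive1 (fun t : Cx R => f t y) x) (derive1 (fun t : Cx R => f x t) y).

(* Here 0 `^ 0 = 1 and 0 `^ l = 0 for l > 0. *)
Definition gradient_exponents (R : realType) (f : Cx R -> Cx R -> Cx R) : set R :=
  [set l | 0 <= l /\ exists c eps : R, [/\ 0 < c, 0 < eps &
    forall x y, norm2 x y < eps -> c * cmod (f x y) `^ l <= grad_norm f x y]].

(** Puiseux series *)

(* A series \sum_q c_q y^q with real exponents, given by its coefficients. *)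
Definition gseries (R : realType) : Type := R -> Cx R.

Definition is_ord (R : realType) (s : gseries R) (q : R) : Prop :=
  s q != 0 /\ forall p, p < q -> s p = 0.

(* The smallest exponent occurring in s; the default 0 is only returned for
   series without one, such as 0. *)
Definition ord (R : realType) (s : gseries R) : R := xget 0 (is_ord s).

(* Convergence is that of the power series in t = y^{1/N}. *)
Definition is_puiseux (R : realType) (s : gseries R) : Prop :=
  exists N : nat, [/\ (0 < N)%N,
    forall q, s q != 0 -> exists2 k : nat, (0 < k)%N & q = k%:R / N%:R &
    exists2 d : R, 0 < d &
      cvgn (series (fun k => cmod (s (k%:R / N%:R)) * d ^+ k))].

Definition gone (R : realType) : gseries R := fun q => (q == 0)%:R.

(* The sums over infinite index sets below are finitely supported sums; the
   support is finite for series with nonnegative exponents such that only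
   finitely many exponents are below any given bound. *)
Definition gmul (R : realType) (s t : gseries R) : gseries R :=
  fun q => \sum_(p \in [set: R]) s p * t (q - p).

Definition gexp (R : realType) (s : gseries R) (n : nat) : gseries R :=
  iter n (gmul s) (@gone R).

(* The series f(s(y), y), for s with positive exponents only. *)
Definition gsubst (R : realType) (a : nat -> nat -> Cx R) (s : gseries R) :
    gseries R :=
  fun q => \sum_(p \in [set: nat * nat]) a p.1 p.2 * gexp s p.1 (q - p.2%:R).

Definition is_NP_root (R : realType) (a : nat -> nat -> Cx R) (s : gseries R) : Prop :=
  is_puiseux s /\ forall q, gsubst a s q = 0.

Definition approx (R : realType) (s : gseries R) (rho : R) (g : Cx R) : gseries R :=
  fun q => if q < rho then s q else if q == rho then g else 0.

Definition approx2 (R : realType) (s t : gseries R) (g : Cx R) : gseries R :=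
  approx s (ord (fun q => s q - t q)) g.

(* The order of f(z(y), y), z the approximation of s and t: the common value
   for all constants g outside some finite set. *)
Definition approx2_ord (R : realType) (a : nat -> nat -> Cx R) (s t : gseries R) : R :=
  xget 0 [set o | exists2 E : set (Cx R), finite_set E &
    forall g, ~ E g -> is_ord (gsubst a (approx2 s t g)) o].

(* Main.v *)
From HB Require Import structures.
Require Import Defs.
From mathcomp Require Import all_boot all_order all_algebra.
From mathcomp Require Import all_classical all_reals all_analysis.
From mathcomp Require Import finmap complex.
From mathcomp Require Import ring lra zify.
Set Implicit Arguments.
Unset Strict Implicit.
Unset Printing Implicit Defensive.
Import Order.TTheory GRing.Theory Num.Theory.
Import numFieldNormedType.Exports.
Local Open Scope classical_set_scope.
Local Open Scope ring_scope.

(** Newton-Puiseux with convergent series gives f(x, t^N) = u(x, t) prod_k (x - z_k(t)) with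
    u a unit and z_k analytic, z_k = O(t^N).  For distinct factors z_i, z_j with
    rho = ord(z_i - z_j), the order of f along the approximation of z_i and z_j is H / N,
    where H = sum_k min(rho, ord(z_i - z_k)).  When all z_k agree, H = m N plays the same
    role below.

    Upper bound: let H be the largest of these numbers.  It is enough to find, at each point,
    some r > 0 with |grad f| >= c |f| / r and |f| >= c r^(H/N).  Outside a cone
    |x| <= K |y|, and at points much closer to the nearest root z_0 than the other roots are,
    f_x alone does this, with r = |x| and r = |x - z_0|.  Otherwise differentiate f along
    t d/dt + (t z_0' + kappa (x - z_0)) d/dx, where kappa is an order ord(z_0 - z_k) for which
    |z_0 - z_k| is comparable to |x - z_0|: the logarithmic derivatives of all factors then
    have real part bounded below, and r = |t|^N works.

    Lower bound: let w_k be the coefficient of t^rho in z_k, for those k such that z_k agrees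
    with z_i below order rho.  At least two of the w_k differ, so prod_k (X - w_k) has a
    critical point g_0 that is none of them.  It lifts to a curve x = z_i + g(t) t^rho on which
    the x-derivative of prod_k (x - z_k) vanishes, and there |f| ~ |t|^H and
    |grad f| = O(|t|^(H - N)). *)

(** * Absolutely convergent sums of complex numbers *)

(** With r as in the overview, |f| >= c r^(H/N) bounds 1 / r below by a multiple of |f|^(-N/H), so
    |grad f| >= c |f| / r is the gradient inequality with exponent 1 - N/H. The obstacle is
    cancellation: between the scales at which roots cluster, the terms 1 / (x - z_k) of f_x / f can
    sum to zero, as they do on the polar curve. The vector field replaces them by (t (z_0' - z_k') +
    kappa (x - z_0)) / (x - z_k), each close to a positive integer: kappa when |x - z_0| dominates
    |z_0 - z_k|, the contact order when it is dominated, and both when the two are comparable,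
    because for small t only one contact order can be comparable to |x - z_0|. Multiplicities are
    absorbed by running over all m factors, repeated ones included. Mini-regularity keeps the zeros
    in a cone |x| <= K |y|; this is why z_k = O(t^N), every contact order is at least N, and H >= m
    N. Analytic functions are handled through weighted l1 norms of their coefficients, which make
    products, composition and fixed points matters of absolutely convergent sums. *)

#[global] Arguments cmod : simpl never.

Section Cmod.
Context {R : realType}.
Implicit Types (z w : Cx R) (x : R).

Lemma cmod_norm z : `|z| = (cmod z)%:C%C.
Proof. by rewrite normc_def /cmod; case: z. Qed.

Lemma cmodE z : cmod z = complex.Re `|z|.
Proof. by rewrite cmod_norm. Qed.

Lemma cmod_ge0 z : 0 <= cmod z.
Proof. by rewrite /cmod; case: z => a b; rewrite sqrtr_ge0. Qed.
Hint Resolve cmod_ge0 : core.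

Lemma cmod0 : cmod (0 : Cx R) = 0.
Proof. exact: ComplexField.Normc.normc0. Qed.
Lemma cmod1 : cmod (1 : Cx R) = 1.
Proof. exact: ComplexField.Normc.normc1. Qed.
Lemma cmodM z w : cmod (z * w) = cmod z * cmod w.
Proof. exact: ComplexField.Normc.normcM. Qed.
Lemma cmodV z : cmod z^-1 = (cmod z)^-1.
Proof. exact: ComplexField.Normc.normcV. Qed.
Lemma cmodN z : cmod (- z) = cmod z.
Proof. exact: (@normcN R z). Qed.
Lemma cmodD z w : cmod (z + w) <= cmod z + cmod w.
Proof. exact: (@le_normcD R z w). Qed.
Lemma cmod_eq0 z : (cmod z == 0) = (z == 0).
Proof.
by apply/eqP/eqP => [/ComplexField.Normc.eq0_normc|->]; rewrite ?cmod0.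
Qed.
Lemma cmod_gt0 z : (0 < cmod z) = (z != 0).
Proof. by rewrite lt_def cmod_eq0 cmod_ge0 andbT. Qed.
Lemma cmodX z n : cmod (z ^+ n) = cmod z ^+ n.
Proof. by elim: n => [|n IH]; rewrite ?cmod1 // !exprS cmodM IH. Qed.
Lemma cmod_nat n : cmod (n%:R : Cx R) = n%:R.
Proof. by rewrite cmodE normr_nat -(rmorph_nat (real_complex R)). Qed.
Lemma cmodMn z n : cmod (z *+ n) = cmod z * n%:R.
Proof. by rewrite -[z *+ n]mulr_natr cmodM cmod_nat. Qed.
Lemma cmod_real x : cmod (x%:C%C : Cx R) = `|x|.
Proof. by rewrite /cmod /= expr0n addr0 sqrtr_sqr. Qed.
Lemma cmodC z w : cmod (z - w) = cmod (w - z).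
Proof. by rewrite -cmodN opprB. Qed.
Lemma cmodB z w : cmod (z - w) <= cmod z + cmod w.
Proof. by rewrite -[cmod w]cmodN cmodD. Qed.
Lemma cmod_lb z w : cmod z - cmod w <= cmod (z + w).
Proof. have := cmodD (z + w) (- w); rewrite addrK cmodN; lra. Qed.
Lemma cmod_lbB z w : cmod z - cmod w <= cmod (z - w).
Proof. by have := cmod_lb z (- w); rewrite cmodN. Qed.
Lemma cmod_Re z : `|complex.Re z| <= cmod z.
Proof.
by rewrite -sqrtr_sqr /cmod; case: z => a b /=; rewrite ler_sqrt ?lerDl ?sqr_ge0 ?addr_ge0 ?sqr_ge0.
Qed.
Lemma cmod_Im z : `|complex.Im z| <= cmod z.
Proof.
by rewrite -sqrtr_sqr /cmod; case: z => a b /=; rewrite ler_sqrt ?lerDr ?sqr_ge0 ?addr_ge0 ?sqr_ge0.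
Qed.
Lemma cmod_sum (I : Type) (s : seq I) (P : pred I) (F : I -> Cx R) :
  cmod (\sum_(i <- s | P i) F i) <= \sum_(i <- s | P i) cmod (F i).
Proof.
elim/big_rec2: _ => [|i y x _ IH]; first by rewrite cmod0.
by apply: le_trans (cmodD _ _) _; rewrite lerD2l.
Qed.
Lemma cmod_prod (I : Type) (s : seq I) (P : pred I) (F : I -> Cx R) :
  cmod (\prod_(i <- s | P i) F i) = \prod_(i <- s | P i) cmod (F i).
Proof. by elim/big_rec2: _ => [|i y x _ <-]; rewrite ?cmod1 ?cmodM. Qed.
End Cmod.
#[export] Hint Extern 0 (is_true (@Order.le _ _ _ (cmod _))) => exact: cmod_ge0 : core.

Section Nsum.
Context {R : realType}.
Implicit Types (I J : choiceType).

(** The bound [M] is carried instead of bare summability: it becomes the norm bound of the analytic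
    functions below. *)
Definition sumle I (g : I -> R) (M : R) :=
  (forall i, 0 <= g i) /\ (\esum_(i in [set: I]) (g i)%:E <= M%:E)%E.

Definition nsum I (g : I -> R) : R := fine (\esum_(i in [set: I]) (g i)%:E)%E.

Lemma nsumE I (g : I -> R) M : sumle g M ->
  (\esum_(i in [set: I]) (g i)%:E)%E = (nsum g)%:E.
Proof.
move=> [g0 gM]; rewrite /nsum fineK// ge0_fin_numE; last first.
  by apply: esum_ge0 => i _; rewrite lee_fin.
by rewrite (le_lt_trans gM) ?ltry.
Qed.

Lemma sumle_nsum I (g : I -> R) M : sumle g M -> sumle g (nsum g).
Proof. by move=> gM; split; [case: gM|rewrite (nsumE gM)]. Qed.

Lemma nsum_le I (g : I -> R) M : sumle g M -> nsum g <= M.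
Proof. by move=> gM; have [_] := gM; rewrite (nsumE gM) lee_fin. Qed.

Lemma nsum_ge0 I (g : I -> R) : (forall i, 0 <= g i) -> 0 <= nsum g.
Proof. by move=> g0; rewrite fine_ge0// esum_ge0// => i _; rewrite lee_fin. Qed.

Lemma sumle_ge0 I (g : I -> R) M : sumle g M -> 0 <= M.
Proof. by move=> gM; rewrite (le_trans _ (nsum_le gM))// nsum_ge0//; case: gM. Qed.

Lemma sumle_weak I (g : I -> R) M M' : sumle g M -> M <= M' -> sumle g M'.
Proof. by move=> [g0 gM] MM'; split=> //; apply: le_trans gM _; rewrite lee_fin. Qed.

Lemma sumle_dom I (g h : I -> R) M : sumle g M ->
  (forall i, 0 <= h i <= g i) -> sumle h M.
Proof.
move=> [g0 gM] hg; split; first by move=> i; have /andP[] := hg i.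
apply: le_trans gM; apply: le_esum => i _; rewrite lee_fin.
by have /andP[] := hg i.
Qed.

Lemma eq_nsum I (g h : I -> R) : g =1 h -> nsum g = nsum h.
Proof. by move=> gh; congr nsum; exact/funext. Qed.

Lemma nsumD I (g h : I -> R) M M' : sumle g M -> sumle h M' ->
  sumle (fun i => g i + h i) (M + M') /\
  nsum (fun i => g i + h i) = nsum g + nsum h.
Proof.
move=> gM hM.
have E : (\esum_(i in [set: I]) (g i + h i)%:E)%E = (nsum g + nsum h)%:E.
  under eq_esum do rewrite EFinD.
  rewrite esumD; first by rewrite (nsumE gM) (nsumE hM).
    by case: gM => g0 _ i _; rewrite lee_fin.
  by case: hM => g0 _ i _; rewrite lee_fin.
split; last by rewrite /nsum E.
split; first by case: gM => g0 _; case: hM => h0 _ i; rewrite addr_ge0.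
by rewrite E lee_fin lerD// nsum_le.
Qed.

Lemma sumle_ub I (g : I -> R) M : (forall i, 0 <= g i) ->
  (forall s : seq I, uniq s -> \sum_(i <- s) g i <= M) -> sumle g M.
Proof.
move=> g0 H; split=> //; apply: ge_ereal_sup => _ [X [finX _] <-].
rewrite fsbig_finite//= sumEFin lee_fin; exact/H/fset_uniq.
Qed.

Lemma sumle_fin I (g : I -> R) M (s : seq I) : sumle g M -> uniq s ->
  \sum_(i <- s) g i <= M.
Proof.
move=> [g0 gM] us; rewrite -lee_fin; apply: le_trans gM.
apply: esum_ge; exists [set` s] => //.
by rewrite -fsbig_seq// -sumEFin.
Qed.

Lemma sumleZ I (g : I -> R) M (c : R) : 0 <= c -> sumle g M ->
  sumle (fun i => c * g i) (c * M).
Proof.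
move=> c0 gM; apply: sumle_ub => [i|s us].
  by rewrite mulr_ge0//; case: gM.
by rewrite -mulr_sumr ler_wpM2l// (sumle_fin gM).
Qed.

Lemma nsumZ I (g : I -> R) M (c : R) : 0 <= c -> sumle g M ->
  nsum (fun i => c * g i) = c * nsum g.
Proof.
rewrite le_eqVlt => /predU1P[<- gM|c0 gM].
  rewrite mul0r /nsum esum1// => i _; by rewrite mul0r.
have cM := sumleZ (ltW c0) gM.
apply/eqP; rewrite eq_le; apply/andP; split.
  by apply: nsum_le; apply: sumleZ (sumle_nsum gM); exact: ltW.
rewrite -ler_pdivlMl//; apply: nsum_le.
have /(sumleZ (_ : 0 <= c^-1)) := sumle_nsum cM.
rewrite invr_ge0 => /(_ (ltW c0)).
by congr sumle; apply/funext => i; rewrite mulrA mulVf ?mul1r// gt_eqF.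
Qed.

Lemma sumle_pair I J (g : I * J -> R) (m : I -> R) M :
  (forall i, sumle (fun j => g (i, j)) (m i)) -> sumle m M -> sumle g M.
Proof.
move=> gm [m0 mM]; split; first by move=> [i j]; case: (gm i).
have := @esum_esum R I J [set: I] (fun=> [set: J]) (fun i j => (g (i, j))%:E).
rewrite (_ : _ `*`` _ = [set: I * J]); last by apply/seteqP; split.
move=> E; rewrite (eq_esum (b := fun k => (g (k.1, k.2))%:E)); last by case.
rewrite -E; last by move=> i j _ _; rewrite lee_fin; case: (gm i).
apply: le_trans mM; apply: le_esum => i _; by case: (gm i).
Qed.

Lemma nsum_pair I J (g : I * J -> R) M : sumle g M ->
  [/\ forall i, sumle (fun j => g (i, j)) M,
     sumle (fun i => nsum (fun j => g (i, j))) M &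
     nsum g = nsum (fun i => nsum (fun j => g (i, j)))].
Proof.
move=> gM; have g0 : forall k, 0 <= g k by case: gM.
have gi i : sumle (fun j => g (i, j)) M.
  apply: sumle_ub => // s us.
  have := @sumle_fin _ _ _ [seq (i, j) | j <- s] gM.
  rewrite big_map map_inj_uniq//; first by apply.
  by move=> ? ? [].
have := @esum_esum R I J [set: I] (fun=> [set: J]) (fun i j => (g (i, j))%:E).
rewrite (_ : _ `*`` _ = [set: I * J]); last by apply/seteqP; split.
move=> /(_ (fun i j _ _ => _)) E.
have {}E : (\esum_(i in [set: I]) (nsum (fun j => g (i, j)))%:E =
  \esum_(k in [set: I * J]) (g k)%:E)%E.
  rewrite [RHS](eq_esum (b := fun k => (g (k.1, k.2))%:E)); last by case.
  rewrite -E; last by move=> i j; rewrite lee_fin.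
  by apply: eq_esum => i _; rewrite (nsumE (gi i)).
split=> //; last by rewrite /nsum E.
split; first by move=> i; apply: nsum_ge0.
by rewrite E; case: gM.
Qed.

Lemma nsum_bij I J (e : I -> J) (g : J -> R) M : bijective e -> sumle g M ->
  sumle (g \o e) M /\ nsum (g \o e) = nsum g.
Proof.
move=> be [g0 gM].
have E : (\esum_(j in [set: J]) (g j)%:E = \esum_(i in [set: I]) (g (e i))%:E)%E.
  by apply: reindex_esum; rewrite setTT_bijective.
split; last by rewrite /nsum E.
by split=> /=; [move=> i; exact: g0 | rewrite -E].
Qed.

End Nsum.

Section Rsum.
Context {R : realType}.
Implicit Types (I J : choiceType).

Definition rsum I (h : I -> R) : R :=
  nsum (fun i => Num.max (h i) 0) - nsum (fun i => Num.max (- h i) 0).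

Lemma maxr0_diff (x : R) : x = Num.max x 0 - Num.max (- x) 0.
Proof. by rewrite /Num.max; case: ifP; case: ifP; lra. Qed.

Lemma maxr0_bound (x : R) : 0 <= Num.max x 0 <= `|x|.
Proof. by rewrite le_max lexx orbT ge_max ler_norm normr_ge0. Qed.

Lemma sumle_max I (h : I -> R) M : sumle (fun i => `|h i|) M ->
  sumle (fun i => Num.max (h i) 0) M /\ sumle (fun i => Num.max (- h i) 0) M.
Proof.
move=> hM; split; apply: sumle_dom hM _ => i; first exact: maxr0_bound.
by have := maxr0_bound (- h i); rewrite normrN.
Qed.

(** Cross-adding two splittings of [h] into summable nonnegative families gives equal sums, so the
    value does not depend on the splitting. Linearity of [rsum] then reduces to choosing a
    convenient one. *)
Lemma rsumE I (h p q : I -> R) M M' : sumle p M -> sumle q M' ->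
  (forall i, h i = p i - q i) -> rsum h = nsum p - nsum q.
Proof.
move=> pM qM hpq.
have hp : sumle (fun i => Num.max (h i) 0) M.
  apply: (sumle_dom pM) => i; rewrite hpq le_max lexx orbT ge_max.
  by have [q0 _] := qM; have [p0 _] := pM; rewrite p0 lerBlDr lerDl q0.
have hn : sumle (fun i => Num.max (- h i) 0) M'.
  apply: (sumle_dom qM) => i; rewrite hpq le_max lexx orbT ge_max.
  by have [q0 _] := qM; have [p0 _] := pM; rewrite q0 opprB lerBlDr lerDl p0.
have [_ E1] := nsumD hp qM; have [_ E2] := nsumD hn pM.
have E : nsum (fun i => Num.max (h i) 0 + q i) =
         nsum (fun i => Num.max (- h i) 0 + p i).
  by apply: eq_nsum => i; have := maxr0_diff (h i); rewrite {1}hpq; lra.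
rewrite /rsum; lra.
Qed.

Lemma eq_rsum I (g h : I -> R) : g =1 h -> rsum g = rsum h.
Proof. by move=> gh; congr rsum; exact/funext. Qed.

Lemma rsumD I (g h : I -> R) M M' :
  sumle (fun i => `|g i|) M -> sumle (fun i => `|h i|) M' ->
  rsum (fun i => g i + h i) = rsum g + rsum h.
Proof.
move=> /sumle_max[gp gn] /sumle_max[hp hn].
have [ppM pp] := nsumD gp hp; have [nnM nn] := nsumD gn hn.
rewrite (rsumE ppM nnM) ?pp ?nn /rsum; first lra.
move=> i; have := maxr0_diff (h i); have := maxr0_diff (g i); lra.
Qed.

Lemma rsumN I (h : I -> R) : rsum (fun i => - h i) = - rsum h.
Proof.
rewrite /rsum opprB; congr (_ - _); apply: eq_nsum => i; by rewrite opprK.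
Qed.

Lemma rsumZ I (h : I -> R) M c : sumle (fun i => `|h i|) M ->
  rsum (fun i => c * h i) = c * rsum h.
Proof.
move=> hM; wlog c0 : c / 0 <= c => [H|].
  have [|c0] := leP 0 c; first exact: H.
  rewrite -[c]opprK mulNr -H ?oppr_ge0 ?ltW// -rsumN.
  by apply: eq_rsum => i; rewrite !mulNr.
have [pM nM] := sumle_max hM.
rewrite (rsumE (sumleZ c0 pM) (sumleZ c0 nM)).
  by rewrite (nsumZ c0 pM) (nsumZ c0 nM) mulrBr.
by move=> i; rewrite -mulrBr -maxr0_diff.
Qed.

Lemma rsum_le I (h : I -> R) M : sumle (fun i => `|h i|) M ->
  `|rsum h| <= nsum (fun i => `|h i|).
Proof.
move=> hM; have [pM nM] := sumle_max hM.
have [_ E] := nsumD pM nM.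
have -> : nsum (fun i => `|h i|) =
   nsum (fun i => Num.max (h i) 0) + nsum (fun i => Num.max (- h i) 0).
  rewrite -E; apply: eq_nsum => i.
  have := maxr0_diff (h i).
  rewrite /Num.max; case: ifP; case: ifP; case: (ger0P (h i)); lra.
rewrite /rsum ler_norml.
have := nsum_ge0 (proj1 pM); have := nsum_ge0 (proj1 nM).
by move=> ? ?; apply/andP; split; lra.
Qed.

Lemma rsum_pair I J (h : I * J -> R) M : sumle (fun k => `|h k|) M ->
  rsum h = rsum (fun i => rsum (fun j => h (i, j))).
Proof.
move=> hM; have [pM nM] := sumle_max hM.
have [p1 p2 p3] := nsum_pair pM; have [n1 n2 n3] := nsum_pair nM.
by rewrite (rsumE p2 n2) ?[LHS]/rsum ?p3 ?n3.
Qed.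

Lemma rsum_bij I J (e : I -> J) (h : J -> R) M : bijective e ->
  sumle (fun k => `|h k|) M -> rsum (h \o e) = rsum h.
Proof.
move=> be hM; have [pM nM] := sumle_max hM.
have [_ p] := nsum_bij be pM; have [_ n] := nsum_bij be nM.
by rewrite /rsum -p -n.
Qed.

Lemma nsum1 I (g : I -> R) M i0 : sumle g M -> (forall i, i != i0 -> g i = 0) ->
  nsum g = g i0.
Proof.
move=> [g0 gM] gi; rewrite /nsum esum_mkcond (esumID [set i0])// ?setTI; last first.
  by move=> i _; rewrite mem_set// lee_fin.
rewrite [X in (_ + X)%E]esum1 ?adde0.
  by rewrite esum_set1 mem_set// lee_fin.
by move=> i /= /eqP ii0; rewrite mem_set// gi.
Qed.

Lemma rsum1 I (h : I -> R) i0 : (forall i, i != i0 -> h i = 0) -> rsum h = h i0.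
Proof.
move=> hi; have hM : sumle (fun i => `|h i|) `|h i0|.
  apply: sumle_ub => // s us.
  have [i0s|i0s] := boolP (i0 \in s).
    by rewrite (bigD1_seq i0)//= big1 ?addr0// => i /hi ->; rewrite normr0.
  rewrite big_seq big1// => i si; rewrite hi ?normr0//.
  by apply: contraNneq i0s => <-.
have [pM nM] := sumle_max hM.
rewrite /rsum (nsum1 (i0 := i0) pM) ?(nsum1 (i0 := i0) nM) -?maxr0_diff//.
  by move=> i /hi ->; rewrite oppr0 maxxx.
by move=> i /hi ->; rewrite maxxx.
Qed.

End Rsum.

Section Csum.
Context {R : realType}.
Local Notation C := (Cx R).
Implicit Types (I J : choiceType).

Definition csum I (h : I -> C) : C :=
  Complex (rsum (fun i => complex.Re (h i))) (rsum (fun i => complex.Im (h i))).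

Definition asum I (h : I -> C) M := sumle (fun i => cmod (h i)) M.

Lemma asum_Re I (h : I -> C) M : asum h M -> sumle (fun i => `|complex.Re (h i)|) M.
Proof. by move=> hM; apply: sumle_dom hM _ => i; rewrite normr_ge0 cmod_Re. Qed.

Lemma asum_Im I (h : I -> C) M : asum h M -> sumle (fun i => `|complex.Im (h i)|) M.
Proof. by move=> hM; apply: sumle_dom hM _ => i; rewrite normr_ge0 cmod_Im. Qed.

Lemma asum_dom I (h : I -> C) (g : I -> R) M : sumle g M ->
  (forall i, cmod (h i) <= g i) -> asum h M.
Proof. by move=> gM hg; apply: sumle_dom gM _ => i; rewrite cmod_ge0 hg. Qed.

Lemma eq_csum I (g h : I -> C) : g =1 h -> csum g = csum h.
Proof. by move=> gh; congr csum; exact/funext. Qed.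

Lemma csumD I (g h : I -> C) M M' : asum g M -> asum h M' ->
  csum (fun i => g i + h i) = csum g + csum h.
Proof.
move=> gM hM; rewrite {2 3}/csum -[RHS]/(Complex (_ + _) (_ + _)).
rewrite -(rsumD (asum_Re gM) (asum_Re hM)) -(rsumD (asum_Im gM) (asum_Im hM)).
by congr Complex; apply: eq_rsum => i; case: (g i) (h i) => ? ? [].
Qed.

Lemma csumZ I (h : I -> C) M c : asum h M ->
  csum (fun i => c * h i) = c * csum h.
Proof.
move=> hM; have reM := asum_Re hM; have imM := asum_Im hM.
case: c => a b; rewrite {2}/csum.
rewrite -[RHS]/(Complex (_ - _) (_ + _)).
rewrite -!(rsumZ _ reM) -!(rsumZ _ imM) -!rsumN.
have Z k g : sumle (fun i : I => `|g i|) M -> sumle (fun i => `|k * g i|) (`|k| * M).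
  move=> gM; apply: sumle_dom (sumleZ (normr_ge0 k) gM) _ => i.
  by rewrite normr_ge0 normrM lexx.
have bim : sumle (fun i => `|- (b * complex.Im (h i))|) (`|b| * M).
  by apply: sumle_dom (Z b _ imM) _ => i; rewrite normr_ge0 normrN lexx.
rewrite -(rsumD (Z a _ reM) bim) -(rsumD (Z a _ imM) (Z b _ reM)).
by congr Complex; apply: eq_rsum => i; case: (h i).
Qed.

Lemma csumZr I (h : I -> C) M c : asum h M ->
  csum (fun i => h i * c) = csum h * c.
Proof. by move=> hM; rewrite mulrC -(csumZ c hM); apply: eq_csum => i; rewrite mulrC. Qed.

Lemma csumN I (h : I -> C) : csum (fun i => - h i) = - csum h.
Proof.
rewrite /csum -[RHS]/(Complex (- _) (- _)) -!rsumN.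
by congr Complex; apply: eq_rsum => i; case: (h i).
Qed.

Lemma asumN I (h : I -> C) M : asum h M -> asum (fun i => - h i) M.
Proof. by move=> hM; apply: sumle_dom hM _ => i; rewrite cmodN cmod_ge0 lexx. Qed.

Lemma csumB I (g h : I -> C) M M' : asum g M -> asum h M' ->
  csum (fun i => g i - h i) = csum g - csum h.
Proof. by move=> gM hM; rewrite (csumD gM (asumN hM)) csumN. Qed.

Lemma asumD I (g h : I -> C) M M' : asum g M -> asum h M' ->
  asum (fun i => g i + h i) (M + M').
Proof.
move=> gM hM; have [H _] := nsumD gM hM.
by apply: asum_dom H _ => i; rewrite cmodD.
Qed.

Lemma asumZ I (h : I -> C) M c : asum h M -> asum (fun i => c * h i) (cmod c * M).
Proof.
by move=> hM; apply: asum_dom (sumleZ (cmod_ge0 c) hM) _ => i; rewrite cmodM.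
Qed.

(** Multiplying by the unit number [c] makes the sum real and nonnegative, so only real parts count.
    Bounding real and imaginary parts separately would cost a constant factor. *)
Lemma csum_le I (h : I -> C) M : asum h M -> cmod (csum h) <= M.
Proof.
move=> hM; set s := csum h.
have [s0|s0] := eqVneq s 0; first by rewrite s0 cmod0 (sumle_ge0 hM).
pose c : C := (cmod s)%:C%C / s.
have c1 : cmod c = 1.
  by rewrite /c cmodM cmodV cmod_real ger0_norm ?cmod_ge0 ?mulfV ?cmod_eq0.
have E : complex.Re (csum (fun i => c * h i)) = cmod s.
  by rewrite (csumZ c hM) -/s /c divfK.
rewrite -E /=; apply: le_trans (ler_norm _) _.
have := asumZ c hM; rewrite c1 mul1r => chM.
by apply: le_trans (rsum_le (asum_Re chM)) _; apply: nsum_le; exact: asum_Re.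
Qed.

Lemma csum_pair I J (h : I * J -> C) M : asum h M ->
  [/\ forall i, asum (fun j => h (i, j)) M,
    asum (fun i => csum (fun j => h (i, j))) M &
    csum h = csum (fun i => csum (fun j => h (i, j)))].
Proof.
move=> hM; have [n1 n2 n3] := nsum_pair hM; split=> //.
  apply: asum_dom n2 _ => i; apply: csum_le; exact: sumle_nsum (n1 i).
by rewrite {1}/csum (rsum_pair (asum_Re hM)) (rsum_pair (asum_Im hM)).
Qed.

Lemma csum_bij I J (e : I -> J) (h : J -> C) M : bijective e ->
  asum h M -> csum (h \o e) = csum h.
Proof.
move=> be hM; rewrite /csum.
by rewrite -(rsum_bij be (asum_Re hM)) -(rsum_bij be (asum_Im hM)).
Qed.

Lemma swap_bij I J : bijective (fun k : I * J => (k.2, k.1)).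
Proof. by exists (fun k => (k.2, k.1)); case. Qed.

Lemma csum_exch I J (h : I * J -> C) M : asum h M ->
  [/\ forall j, asum (fun i => h (i, j)) M,
    asum (fun j => csum (fun i => h (i, j))) M &
    csum h = csum (fun j => csum (fun i => h (i, j)))].
Proof.
move=> hM; have be := swap_bij J I.
have [hM' _] := nsum_bij be hM.
have [h1 h2 h3] := @csum_pair J I (h \o (fun k => (k.2, k.1))) M hM'.
by split=> //; rewrite -(csum_bij be hM) h3.
Qed.

Lemma csum1 I (h : I -> C) i0 : (forall i, i != i0 -> h i = 0) -> csum h = h i0.
Proof.
move=> hi; rewrite /csum (rsum1 (i0 := i0)) ?(rsum1 (i0 := i0)).
- by case: (h i0).
- by move=> i /hi ->.
- by move=> i /hi ->.
Qed.

Lemma asum1 I (h : I -> C) i0 : (forall i, i != i0 -> h i = 0) ->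
  asum h (cmod (h i0)).
Proof.
move=> hi; apply: sumle_ub => // s us.
have [i0s|i0s] := boolP (i0 \in s).
  by rewrite (bigD1_seq i0)//= big1 ?addr0// => i /hi ->; rewrite cmod0.
rewrite big_seq big1// => i si; rewrite hi ?cmod0//.
by apply: contraNneq i0s => <-.
Qed.

Lemma asum0 I : asum (fun _ : I => 0) 0.
Proof. by apply: sumle_ub => // s us; rewrite big1// => i _; rewrite cmod0. Qed.

Lemma csum0 I : csum (fun _ : I => 0) = 0.
Proof.
rewrite -[RHS](subrr (csum (fun _ : I => 0))) -(csumB (asum0 I) (asum0 I)).
by apply: eq_csum => i; rewrite subrr.
Qed.

Lemma csum_sum I (K : Type) (s : seq K) (h : K -> I -> C) (M : K -> R) :
  (forall k, asum (h k) (M k)) ->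
  asum (fun i => \sum_(k <- s) h k i) (\sum_(k <- s) M k) /\
  csum (fun i => \sum_(k <- s) h k i) = \sum_(k <- s) csum (h k).
Proof.
move=> hM; elim: s => [|k s [IH1 IH2]].
  rewrite (_ : (fun i => _) = fun=> 0); last by apply/funext => i; rewrite big_nil.
  by rewrite !big_nil csum0; split=> //; exact: asum0.
rewrite (_ : (fun i => _) = fun i => h k i + \sum_(k <- s) h k i); last first.
  by apply/funext => i; rewrite big_cons.
by rewrite !big_cons (csumD (hM k) IH1) IH2; split=> //; exact: asumD.
Qed.

Lemma csum_fin I (h : I -> C) (s : seq I) : uniq s ->
  (forall i, i \notin s -> h i = 0) ->
  asum h (\sum_(i <- s) cmod (h i)) /\ csum h = \sum_(i <- s) h i.
Proof.
move=> us hs.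
pose g k i := if i == k then h k else 0.
have gM k : asum (g k) (cmod (h k)).
  have -> : h k = g k k by rewrite /g eqxx.
  by apply: asum1 => i /negPf; rewrite /g => ->.
have [H1 H2] := csum_sum s gM.
have E : (fun i => \sum_(k <- s) g k i) = h.
  apply/funext => i; have [si|si] := boolP (i \in s).
    rewrite (bigD1_seq i)//= big1 ?addr0 /g ?eqxx// => k /negPf.
    by rewrite eq_sym => ->.
  rewrite hs// big_seq big1// => k sk; rewrite /g; case: eqP => // ik.
  by move: si; rewrite ik sk.
rewrite E in H1 H2; split=> //; rewrite H2; apply: eq_bigr => k _.
by rewrite (csum1 (i0 := k)) /g ?eqxx// => i /negPf ->.
Qed.

Lemma csum_mul I J (g : I -> C) (h : J -> C) M M' : asum g M -> asum h M' ->
  asum (fun k : I * J => g k.1 * h k.2) (M * M') /\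
  csum (fun k : I * J => g k.1 * h k.2) = csum g * csum h.
Proof.
move=> gM hM.
have ghM : asum (fun k : I * J => g k.1 * h k.2) (M * M').
  apply: (@sumle_pair _ _ _ _ (fun i => M' * cmod (g i))).
    by move=> i /=; rewrite mulrC; exact: asumZ.
  by rewrite mulrC; apply: sumleZ gM; exact: sumle_ge0 hM.
split=> //; have [_ _ ->] := csum_pair ghM.
rewrite -(csumZr _ gM); apply: eq_csum => i /=; exact: csumZ hM.
Qed.

(** An interchange of sums for the family on [I * J] supported on the graph of [e]. It serves for
    Cauchy products, for grouping by total degree and for substitution of series. *)
Lemma csum_fiber I J (e : I -> J) (h : I -> C) M : asum h M ->
  [/\ forall j, asum (fun i => if e i == j then h i else 0) M,
   asum (fun j => csum (fun i => if e i == j then h i else 0)) M &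
   csum h = csum (fun j => csum (fun i => if e i == j then h i else 0))].
Proof.
move=> hM; pose g (k : I * J) := if e k.1 == k.2 then h k.1 else 0.
have gi i j : j != e i -> g (i, j) = 0.
  by move=> /negPf; rewrite /g /= eq_sym => ->.
have gM : asum g M.
  apply: (@sumle_pair _ _ _ _ (fun i => cmod (h i))) => //= i.
  have -> : cmod (h i) = cmod (g (i, e i)) by rewrite /g /= eqxx.
  exact: asum1 (gi i).
have [h1 h2 h3] := csum_exch gM; split=> //.
rewrite -h3; have [_ _ ->] := csum_pair gM.
by apply: eq_csum => i; rewrite (csum1 (gi i)) /g /= eqxx.
Qed.

End Csum.
#[global] Arguments csum : simpl never.

(** * Germs of analytic functions *)

Section Inj.
Context {R : realType}.
Local Notation C := (Cx R).
Implicit Types (I J : choiceType).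

Lemma asum_inj I J (e : I -> J) (h : J -> C) M : injective e ->
  asum h M -> asum (h \o e) M.
Proof.
move=> ie hM; apply: sumle_ub => [i|s us] //=.
have := @sumle_fin _ _ _ _ (map e s) hM; rewrite map_inj_uniq// big_map.
exact.
Qed.

Lemma csum_inj I J (e : I -> J) (h : J -> C) M : injective e ->
  asum h M -> (forall j, (forall i, e i != j) -> h j = 0) ->
  csum (h \o e) = csum h.
Proof.
move=> ie hM h0; have [_ _ ->] := csum_fiber e (asum_inj ie hM).
apply: eq_csum => j; have [[i ij]|nij] := pselect (exists i, e i = j).
  rewrite (csum1 (i0 := i)) /= ?ij ?eqxx// => i' i'i.
  by rewrite -ij (inj_eq ie) (negPf i'i).
rewrite h0; last by move=> i; apply/eqP => ij; apply: nij; exists i.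
rewrite -[RHS](@csum0 R I); apply: eq_csum => i; case: eqP => // ij.
by case: nij; exists i.
Qed.

Lemma asum_inj_rev I J (e : I -> J) (h : J -> C) M : injective e ->
  asum (h \o e) M -> (forall j, (forall i, e i != j) -> h j = 0) -> asum h M.
Proof.
move=> ie hM h0; have [_ H _] := csum_fiber e hM.
apply: asum_dom H _ => j; have [[i ij]|nij] := pselect (exists i, e i = j).
  rewrite (csum1 (i0 := i)) /= ?ij ?eqxx// => i' i'i.
  by rewrite -ij (inj_eq ie) (negPf i'i).
rewrite (_ : h j = 0) ?cmod0 ?cmod_ge0//.
by apply: h0 => i; apply/eqP => ij; apply: nij; exists i.
Qed.

End Inj.

(** * Power series in two variables and their weighted norm *)

Section An.
Context {R : realType}.
Local Notation C := (Cx R).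
Implicit Types (d r M : R) (F G : C -> C -> C).

Definition mon (x t : C) (k : nat * nat) : C := x ^+ k.1 * t ^+ k.2.

(** A bound on the weighted l1 norm of the coefficients at radius [d]. This norm is
    submultiplicative, so products and compositions are controlled by norms alone. *)
Definition pn d (c : nat * nat -> C) M :=
  sumle (fun k => cmod (c k) * d ^+ (k.1 + k.2)) M.

Definition pev (c : nat * nat -> C) (x t : C) : C := csum (fun k => c k * mon x t k).

Definition an d M F := exists2 c, pn d c M &
  forall x t, cmod x <= d -> cmod t <= d -> F x t = pev c x t.

Lemma cmod_mon x t k d : cmod x <= d -> cmod t <= d ->
  cmod (mon x t k) <= d ^+ (k.1 + k.2).
Proof.
move=> xd td; have d0 : 0 <= d := le_trans (cmod_ge0 x) xd.
rewrite cmodM !cmodX exprD; apply: ler_pM; rewrite ?exprn_ge0 ?cmod_ge0//.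
  by rewrite lerXn2r ?nnegrE ?cmod_ge0.
by rewrite lerXn2r ?nnegrE ?cmod_ge0.
Qed.

Lemma pn_asum d c M x t : pn d c M -> cmod x <= d -> cmod t <= d ->
  asum (fun k => c k * mon x t k) M.
Proof.
move=> cM xd td; apply: asum_dom cM _ => k.
by rewrite cmodM ler_wpM2l// cmod_mon.
Qed.

Lemma cmod_monR d k : 0 <= d ->
  cmod (mon (d%:C%C : C) (d%:C%C : C) k) = d ^+ (k.1 + k.2).
Proof. by move=> d0; rewrite cmodM !cmodX !cmod_real ger0_norm// exprD. Qed.

(** At the point x = t = d the monomials have modulus exactly equal to the weights, so the [csum]
    lemmas applied at this single point yield norm bounds. *)
Lemma pnP d c M : 0 <= d ->
  asum (fun k => c k * mon (d%:C%C : C) (d%:C%C : C) k) M <-> pn d c M.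
Proof.
move=> d0; rewrite /asum /pn.
by rewrite (_ : (fun i => cmod _) = fun k => cmod (c k) * d ^+ (k.1 + k.2))//;
  apply/funext => k; rewrite cmodM cmod_monR.
Qed.

Lemma an_bound d M F x t : an d M F -> cmod x <= d -> cmod t <= d ->
  cmod (F x t) <= M.
Proof. by move=> [c cM cE] xd td; rewrite cE//; apply: csum_le; exact: pn_asum cM xd td. Qed.

Lemma an_ge0 d M F : an d M F -> 0 <= M.
Proof. by move=> [c cM _]; exact: sumle_ge0 cM. Qed.

Lemma an_eq d M F G : (forall x t, cmod x <= d -> cmod t <= d -> F x t = G x t) ->
  an d M F -> an d M G.
Proof. by move=> FG [c cM cE]; exists c => // x t xd td; rewrite -FG// cE. Qed.

Lemma an_weak d M M' F : M <= M' -> an d M F -> an d M' F.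
Proof. by move=> MM' [c cM cE]; exists c => //; exact: sumle_weak cM MM'. Qed.

Lemma an_mono d d' M F : 0 <= d' <= d -> an d M F -> an d' M F.
Proof.
move=> /andP[d'0 d'd] [c cM cE]; exists c.
  apply: sumle_dom cM _ => k; rewrite mulr_ge0 ?exprn_ge0//=.
  by rewrite ler_wpM2l// lerXn2r// nnegrE (le_trans d'0).
by move=> x t xd td; apply: cE; exact: le_trans d'd.
Qed.

Lemma an_mon d i j : 0 <= d -> an d (d ^+ (i + j)) (fun x t => x ^+ i * t ^+ j).
Proof.
move=> d0; pose c k : C := (k == (i, j))%:R.
have c0 k : k != (i, j) -> c k = 0 by rewrite /c => /negPf ->.
have cij : c (i, j) = 1 by rewrite /c eqxx.
exists c.
  apply/pnP => //; have /asum1 : forall k, k != (i, j) ->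
    c k * mon (d%:C%C : C) (d%:C%C : C) k = 0 by move=> k /c0 ->; rewrite mul0r.
  by rewrite cij mul1r cmod_monR.
move=> x t xd td; rewrite /pev (csum1 (i0 := (i, j))) ?cij ?mul1r//.
by move=> k /c0 ->; rewrite mul0r.
Qed.

Lemma an_X d : 0 <= d -> an d d (fun x _ => x).
Proof. by move=> /(an_mon 1 0); apply: an_eq => x t _ _; rewrite mulr1. Qed.

Lemma an_T d : 0 <= d -> an d d (fun _ t => t).
Proof. by move=> /(an_mon 0 1); apply: an_eq => x t _ _; rewrite mul1r. Qed.

Lemma an_scale d M F (z : C) : an d M F -> an d (cmod z * M) (fun x t => z * F x t).
Proof.
move=> [c cM cE]; exists (fun k => z * c k).
  apply: sumle_dom (sumleZ (cmod_ge0 z) cM) _ => k.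
  have c0 : 0 <= cmod (c k) * d ^+ (k.1 + k.2) by case: cM.
  by rewrite cmodM -!mulrA mulr_ge0//=.
move=> x t xd td; rewrite cE// /pev -(csumZ z (pn_asum cM xd td)).
by apply: eq_csum => k; rewrite mulrA.
Qed.

Lemma an_const d (z : C) : 0 <= d -> an d (cmod z) (fun _ _ => z).
Proof.
move=> d0; have := an_scale z (an_mon 0 0 d0); rewrite expr0 mulr1.
by apply: an_eq => x t _ _; rewrite !mulr1.
Qed.

(** The coefficients of the sum are the sums of the coefficients; these converge because their
    products with the nonzero number [mon D D k] do. *)
Lemma an_sum (I : choiceType) d (F : I -> C -> C -> C) (M : I -> R) M' : 0 < d ->
  (forall i, an d (M i) (F i)) -> sumle M M' ->
  an d M' (fun x t => csum (fun i => F i x t)).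
Proof.
move=> d0 FM MM'.
have /choice[c cP] : forall i, exists c, pn d c (M i) /\
    forall x t, cmod x <= d -> cmod t <= d -> F i x t = pev c x t.
  by move=> i; have [c cM cE] := FM i; exists c.
have H x t : cmod x <= d -> cmod t <= d ->
    asum (fun k : I * (nat * nat) => c k.1 k.2 * mon x t k.2) M'.
  move=> xd td; apply: (@sumle_pair _ _ _ _ M) => // i /=.
  by apply: pn_asum xd td; case: (cP i).
pose D : C := d%:C%C.
have Dd : cmod D <= d by rewrite cmod_real ger0_norm// ltW.
have mD k : mon D D k != 0.
  by rewrite -cmod_eq0 cmod_monR ?expf_eq0 ?(gt_eqF d0) ?andbF// ltW.
have ck k : asum (fun i => c i k) (cmod (mon D D k)^-1 * M').
  have [/(_ k)/= h _ _] := csum_exch (H D D Dd Dd).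
  have := asumZ (mon D D k)^-1 h.
  by congr asum; apply/funext => i; rewrite mulrC mulfK.
have E x t k : csum (fun i => c i k) * mon x t k = csum (fun i => c i k * mon x t k).
  by rewrite -(csumZr _ (ck k)).
exists (fun k => csum (fun i => c i k)).
  apply/pnP; first exact: ltW.
  have [_ h _] := csum_exch (H D D Dd Dd).
  by move: h; congr asum; apply/funext => k; rewrite E.
move=> x t xd td; have [_ _] := csum_exch (H x t xd td).
have [_ _ ->] := csum_pair (H x t xd td).
rewrite /pev => h.
rewrite (eq_csum (h := fun i => csum (fun k => c i k * mon x t k))); last first.
  by move=> i; have [_ ->] := cP i.
by rewrite h; apply: eq_csum => k /=; rewrite E.
Qed.

Lemma an_mul d M M' F G : 0 < d -> an d M F -> an d M' G ->
  an d (M * M') (fun x t => F x t * G x t).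
Proof.
move=> d0 [a aM aE] [b bM bE].
pose e (k : (nat * nat) * (nat * nat)) := (k.1.1 + k.2.1, k.1.2 + k.2.2)%N.
pose h x t (k : (nat * nat) * (nat * nat)) := a k.1 * mon x t k.1 * (b k.2 * mon x t k.2).
have H x t : cmod x <= d -> cmod t <= d ->
    asum (h x t) (M * M') /\ csum (h x t) = pev a x t * pev b x t.
  by move=> xd td; exact: csum_mul (pn_asum aM xd td) (pn_asum bM xd td).
have hE x t k : h x t k = a k.1 * b k.2 * mon x t (e k).
  by rewrite /h /mon /= !exprD; ring.
pose D : C := d%:C%C.
have Dd : cmod D <= d by rewrite cmod_real ger0_norm// ltW.
have mD k : mon D D k != 0.
  by rewrite -cmod_eq0 cmod_monR ?expf_eq0 ?(gt_eqF d0) ?andbF// ltW.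
pose g j k := if e k == j then a k.1 * b k.2 else 0.
have gE x t j k : (if e k == j then h x t k else 0) = g j k * mon x t j.
  by rewrite /g hE; case: eqP => [->|]; rewrite ?mul0r.
have gk j : asum (g j) (cmod (mon D D j)^-1 * (M * M')).
  have [/(_ j) H1 _ _] := csum_fiber e (proj1 (H D D Dd Dd)).
  have := asumZ (mon D D j)^-1 H1.
  by congr asum; apply/funext => k; rewrite gE mulrC mulfK.
have E x t j : csum (fun k => if e k == j then h x t k else 0) = csum (g j) * mon x t j.
  by rewrite -(csumZr _ (gk j)); apply: eq_csum => k; rewrite gE.
exists (fun j => csum (g j)).
  apply/pnP; first exact: ltW.
  have [_ H1 _] := csum_fiber e (proj1 (H D D Dd Dd)).
  by move: H1; congr asum; apply/funext => j; rewrite E.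
move=> x t xd td; have [H1 H2] := H x t xd td.
have [_ _ H3] := csum_fiber e H1.
by rewrite aE// bE// -H2 H3; apply: eq_csum => j; rewrite E.
Qed.

Lemma an_exp d M F n : 0 < d -> an d M F -> an d (M ^+ n) (fun x t => F x t ^+ n).
Proof.
move=> d0 FM; elim: n => [|n IH].
  by rewrite expr0 -(@cmod1 R); apply: an_const; exact: ltW.
rewrite exprS; have := an_mul d0 FM IH.
by apply: an_eq => x t _ _; rewrite exprS.
Qed.

Lemma an_add d M M' F G : 0 <= d -> an d M F -> an d M' G ->
  an d (M + M') (fun x t => F x t + G x t).
Proof.
move=> d0 [a aM aE] [b bM bE]; exists (fun k => a k + b k).
  apply/pnP => //; have := asumD (proj2 (pnP _ _ d0) aM) (proj2 (pnP _ _ d0) bM).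
  by congr asum; apply/funext => k; rewrite mulrDl.
move=> x t xd td; rewrite aE// bE// -(csumD (pn_asum aM xd td) (pn_asum bM xd td)).
by apply: eq_csum => k; rewrite mulrDl.
Qed.

(** Functions of norm at most [r] can be substituted into a series of radius [r], since by
    submultiplicativity each monomial then has norm at most its weight. *)
Lemma an_comp d M r a F G : 0 < d -> pn r a M -> an d r F -> an d r G ->
  an d M (fun x t => pev a (F x t) (G x t)).
Proof.
move=> d0 aM Fr Gr.
apply: (@an_sum _ d (fun k x t => a k * mon (F x t) (G x t) k)
  (fun k => cmod (a k) * r ^+ (k.1 + k.2))) => // k.
apply: an_scale; rewrite exprD; apply: an_mul => //; exact: an_exp.
Qed.

Lemma pev00 c : pev c 0 0 = c (0%N, 0%N).
Proof.
rewrite /pev (csum1 (i0 := (0%N, 0%N))); first by rewrite /mon /= mulr1 mulr1.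
move=> [[|i] [|j]] //= _; rewrite /mon /= ?expr0n ?mulr0 ?mul0r ?mulr0//.
Qed.

(** Without constant coefficient every weight contains a factor of the radius, so shrinking the
    radius shrinks the norm at least in proportion. This is the source of smallness in compositions
    and in the fixed point argument. *)
Lemma an_small d d' M F : 0 < d' <= d -> an d M F -> F 0 0 = 0 ->
  an d' (d' / d * M) F.
Proof.
move=> /andP[d'0 d'd] [c cM cE]; have d0 : 0 < d by exact: lt_le_trans d'd.
rewrite cE ?cmod0 ?ltW// pev00 => c0; exists c; last first.
  by move=> x t xd td; apply: cE; exact: le_trans d'd.
have dd : 0 <= d' / d by rewrite divr_ge0// ltW.
apply: sumle_dom (sumleZ dd cM) _ => k; rewrite mulr_ge0 ?exprn_ge0 ?(ltW d'0)//=.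
rewrite mulrCA; have [->|k0] := eqVneq k (0%N, 0%N); first by rewrite c0 cmod0 !mul0r.
rewrite ler_wpM2l//; have : (0 < k.1 + k.2)%N.
  by rewrite lt0n addn_eq0; case: k k0 => [[|?] [|?]].
case: (k.1 + k.2)%N => // n _; rewrite !exprS mulrA divfK ?gt_eqF//.
by rewrite ler_wpM2l ?(ltW d'0)// lerXn2r// nnegrE ltW.
Qed.

End An.

Lemma addn_inj k : injective (fun n => (n + k)%N).
Proof. by move=> a b /addIn. Qed.

(** * Power series in one variable *)

Section Ser.
Context {R : realType}.
Local Notation C := (Cx R).
Implicit Types (d r M : R) (h : C -> C) (c : nat -> C).

Definition cv1 d c M := sumle (fun n => cmod (c n) * d ^+ n) M.
Definition ser c (t : C) : C := csum (fun n => c n * t ^+ n).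

Lemma cv1_asum d c M t : cv1 d c M -> cmod t <= d -> asum (fun n => c n * t ^+ n) M.
Proof.
move=> cM td; apply: asum_dom cM _ => n.
by rewrite cmodM cmodX ler_wpM2l// lerXn2r ?nnegrE// (le_trans _ td).
Qed.

Lemma cv1_pn d c M : 0 <= d -> cv1 d c M ->
  pn d (fun k => if k.1 == 0%N then c k.2 else 0) M /\
  forall x t, cmod t <= d ->
    pev (fun k => if k.1 == 0%N then c k.2 else 0) x t = ser c t.
Proof.
move=> d0 cM; pose e (n : nat) : nat * nat := (0%N, n).
have ie : injective e by move=> ? ? [].
have e0 (k : nat * nat) : (forall i, e i != k) -> k.1 != 0%N.
  by case: k => [[|i] j] // /(_ j); rewrite eqxx.
have H x t : cmod t <= d -> asum (fun k => (if k.1 == 0%N then c k.2 else 0) * mon x t k) M.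
  move=> td; apply: (@asum_inj_rev _ _ _ e) => //.
    have := cv1_asum cM td; congr asum; apply/funext => n /=.
    by rewrite /mon /= expr0 mul1r.
  by move=> k /e0 /negPf ->; rewrite mul0r.
split.
  by apply/pnP => //; apply: H; rewrite cmod_real ger0_norm.
move=> x t td; rewrite /pev -(csum_inj ie (H x t td)).
  by apply: eq_csum => n /=; rewrite /mon /= expr0 mul1r.
by move=> k /e0 /negPf ->; rewrite mul0r.
Qed.

Lemma pn_row d (c : nat * nat -> C) M i : 0 < d -> pn d c M ->
  cv1 d (fun j => c (i, j)) (M / d ^+ i).
Proof.
move=> d0 cM; have [/(_ i)/= H _ _] := nsum_pair cM.
have := sumleZ (_ : 0 <= (d ^+ i)^-1) H.
rewrite invr_ge0 exprn_ge0 ?(ltW d0)// => /(_ isT); rewrite mulrC.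
congr sumle; apply/funext => j; rewrite exprD mulrCA mulKf//.
by rewrite gt_eqF// exprn_gt0.
Qed.

Lemma pev_rows d (c : nat * nat -> C) M x t : 0 < d -> pn d c M ->
  cmod x <= d -> cmod t <= d ->
  cv1 d (fun i => ser (fun j => c (i, j)) t) M /\
  pev c x t = ser (fun i => ser (fun j => c (i, j)) t) x.
Proof.
move=> d0 cM xd td.
have E y : cmod y <= d -> forall i,
    ser (fun j => c (i, j)) t * y ^+ i = csum (fun j => c (i, j) * mon y t (i, j)).
  move=> yd i; rewrite -(csumZr _ (cv1_asum (pn_row i d0 cM) td)).
  by apply: eq_csum => j; rewrite /mon /= -mulrA [t ^+ j * _]mulrC.
split; last first.
  have [_ _] := csum_pair (pn_asum cM xd td).
  rewrite /pev => ->; rewrite /ser; apply: eq_csum => i; exact/esym/E.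
have Dd : cmod (d%:C%C : C) <= d by rewrite cmod_real ger0_norm// ltW.
have [_ H _] := csum_pair (pn_asum cM Dd td).
move: H; congr sumle; apply/funext => i.
by rewrite -E// cmodM cmodX cmod_real ger0_norm// ltW.
Qed.

Lemma ser0 c : ser c 0 = c 0%N.
Proof.
rewrite /ser (csum1 (i0 := 0%N)) ?mulr1// => -[|n]// _.
by rewrite expr0n mulr0.
Qed.

Lemma pev_x0 d (c : nat * nat -> C) M x : 0 < d -> pn d c M -> cmod x <= d ->
  pev c x 0 = ser (fun i => c (i, 0%N)) x.
Proof.
move=> d0 cM xd; have [|_ ->] := pev_rows d0 cM xd (_ : cmod 0 <= d).
  by rewrite cmod0 ltW.
by apply: eq_csum => i; rewrite ser0.
Qed.

Lemma pev_0t d (c : nat * nat -> C) M t : 0 < d -> pn d c M -> cmod t <= d ->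
  pev c 0 t = ser (fun j => c (0%N, j)) t.
Proof.
move=> d0 cM td; have [|_ ->] := pev_rows d0 cM (_ : cmod 0 <= d) td.
  by rewrite cmod0 ltW.
by rewrite ser0.
Qed.

Lemma cv1_shift d c M k : 0 < d -> cv1 d c M ->
  cv1 d (fun n => c (n + k)%N) (M / d ^+ k).
Proof.
move=> d0 cM; have dk : 0 < d ^+ k by rewrite exprn_gt0.
have Dc n : cmod (c n * (d%:C%C : C) ^+ n) = cmod (c n) * d ^+ n.
  by rewrite cmodM cmodX cmod_real ger0_norm// ltW.
have cM' : asum (fun n => c n * (d%:C%C : C) ^+ n) M.
  by move: cM; congr sumle; apply/funext => n; rewrite Dc.
have := sumleZ (_ : 0 <= (d ^+ k)^-1) (asum_inj (@addn_inj k) cM').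
rewrite invr_ge0 (ltW dk) => /(_ isT); rewrite mulrC.
congr sumle; apply/funext => n /=; rewrite Dc exprD.
by rewrite mulrCA [d ^+ n * _]mulrC mulKf// gt_eqF.
Qed.

Lemma ser_shift d c M k t : 0 < d -> cv1 d c M -> cmod t <= d ->
  (forall n, (n < k)%N -> c n = 0) -> ser c t = t ^+ k * ser (fun n => c (n + k)%N) t.
Proof.
move=> d0 cM td c0.
rewrite -(csumZ _ (cv1_asum (cv1_shift k d0 cM) td)).
rewrite [LHS]/ser -(csum_inj (@addn_inj k) (cv1_asum cM td)).
  by apply: eq_csum => n /=; rewrite exprD; ring.
move=> n nk; rewrite c0 ?mul0r// ltnNge; apply/negP => kn.
by have := nk (n - k)%N; rewrite subnK// eqxx.
Qed.

Lemma ser_bound d c M t : cv1 d c M -> cmod t <= d -> cmod (ser c t) <= M.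
Proof. by move=> cM td; apply: csum_le; exact: cv1_asum cM td. Qed.

Lemma ser_cont0 d c M t : 0 < d -> cv1 d c M -> cmod t <= d ->
  cmod (ser c t - c 0%N) <= cmod t * (M / d).
Proof.
move=> d0 cM td; pose c' n := if n is 0 then 0 else c n.
have E n : c n = (n == 0%N)%:R * c 0%N + c' n.
  by case: n => [|n]; rewrite /c' /= ?mul1r ?addr0 ?mul0r ?add0r.
have c'M : cv1 d c' M.
  apply: sumle_dom cM _ => -[|n]; rewrite /c' /=; first by rewrite cmod0 mul0r lexx mulr_ge0 ?exprn_ge0// ltW.
  by rewrite mulr_ge0 ?exprn_ge0//= ltW.
have H : asum (fun n => (n == 0%N)%:R * c 0%N * t ^+ n) (cmod ((0%N == 0%N)%:R * c 0%N * t ^+ 0)).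
  by apply: (@asum1 _ _ (fun n => (n == 0%N)%:R * c 0%N * t ^+ n)) => n /negPf ->; rewrite !mul0r.
have -> : ser c t = c 0%N + ser c' t.
  transitivity (csum (fun n => (n == 0%N)%:R * c 0%N * t ^+ n + c' n * t ^+ n)).
    by apply: eq_csum => n; rewrite {1}E mulrDl.
  rewrite (csumD H (cv1_asum c'M td)) (csum1 (i0 := 0%N)); last first.
    by move=> n /negPf ->; rewrite !mul0r.
  by rewrite /= mul1r mulr1.
rewrite addrAC subrr add0r (ser_shift (k := 1) d0 c'M td); last by case.
rewrite expr1 cmodM ler_wpM2l//; have := ser_bound (cv1_shift 1 d0 c'M) td.
by rewrite expr1.
Qed.

Lemma cv1_mono d d' c M : 0 <= d' <= d -> cv1 d c M -> cv1 d' c M.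
Proof.
move=> /andP[d'0 d'd] cM; apply: sumle_dom cM _ => n.
by rewrite mulr_ge0 ?exprn_ge0//= ler_wpM2l// lerXn2r// nnegrE (le_trans d'0).
Qed.

Lemma nat_order (c : nat -> C) : (forall n, c n = 0) \/
  exists k, c k != 0 /\ forall n, (n < k)%N -> c n = 0.
Proof.
have [H|H] := pselect (exists n, c n != 0); last first.
  by left=> n; apply/eqP/negPn/negP => cn; apply: H; exists n.
right; exists (ex_minn H); case: ex_minnP => k ck kmin; split=> // n nk.
by apply/eqP/negPn/negP => /kmin; rewrite leqNgt nk.
Qed.

Lemma exists_real_cmod e : 0 < e -> exists2 t : C, cmod t = e & t != 0.
Proof.
move=> e0; have te : cmod (e%:C%C : C) = e by rewrite cmod_real ger0_norm// ltW.
by exists (e%:C%C : C) => //; rewrite -cmod_gt0 te.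
Qed.

(** Divide by t^k with k the first nonzero index: the quotient tends to [c k]. Asking for zeros only
    at nonzero t lets identities be divided by powers of t before this is applied. *)
Lemma ser_eq0 d c M e : 0 < d -> cv1 d c M -> 0 < e ->
  (forall t, t != 0 -> cmod t <= e -> ser c t = 0) -> forall n, c n = 0.
Proof.
move=> d0 cM e0 H; have [//|[k [ck c0]]] := nat_order c; exfalso.
have M0 : 0 <= M / d ^+ k by exact: sumle_ge0 (cv1_shift k d0 cM).
pose K := M / d ^+ k / d.
have K0 : 0 <= K by rewrite divr_ge0// ltW.
have cc : 0 < cmod (c k) by rewrite cmod_gt0.
(* Small enough that |t| K <= |c k| / 2, so the quotient cannot vanish at t. *)
pose s := Num.min (Num.min d e) (cmod (c k) / (K + 1) / 2).
have s0 : 0 < s by rewrite !lt_min d0 e0 /= divr_gt0// divr_gt0//; lra.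
have [t ts t0] := exists_real_cmod s0.
have td : cmod t <= d by rewrite ts !ge_min lexx.
have te : cmod t <= e by rewrite ts !ge_min lexx ?orbT.
have tc : cmod t <= cmod (c k) / (K + 1) / 2 by rewrite ts !ge_min lexx ?orbT.
have := H t t0 te; rewrite (ser_shift d0 cM td c0) => /eqP.
rewrite mulf_eq0 expf_eq0 (negPf t0) andbF /= => /eqP E.
have := ser_cont0 d0 (cv1_shift k d0 cM) td.
rewrite E sub0r cmodN add0n -/K; apply/negP; rewrite -ltNge.
have : cmod t * K <= cmod (c k) / (K + 1) / 2 * K by rewrite ler_wpM2r.
have -> : cmod (c k) / (K + 1) / 2 * K = cmod (c k) / 2 * (K / (K + 1)) by field; lra.
have : K / (K + 1) <= 1 by rewrite ler_pdivrMr ?mul1r; lra.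
have : 0 <= K / (K + 1) by rewrite divr_ge0; lra.
move: (K / (K + 1)) => u; nra.
Qed.

Lemma ser_uniq d c M d' c' M' e : 0 < d -> cv1 d c M -> 0 < d' -> cv1 d' c' M' -> 0 < e ->
  (forall t, t != 0 -> cmod t <= e -> ser c t = ser c' t) -> c =1 c'.
Proof.
move=> d0 cM d'0 cM' e0 H.
pose s := Num.min d d'.
have s0 : 0 < s by rewrite lt_min d0.
have {}cM : cv1 s c M by apply: cv1_mono cM; rewrite (ltW s0) ge_min lexx.
have {}cM' : cv1 s c' M' by apply: cv1_mono cM'; rewrite (ltW s0) ge_min lexx orbT.
have cc : cv1 s (fun n => c n - c' n) (M + M').
  have [HH _] := nsumD cM cM'.
  apply: sumle_dom HH _ => n; rewrite mulr_ge0 ?exprn_ge0 ?(ltW s0)//= -mulrDl.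
  by rewrite ler_wpM2r ?exprn_ge0 ?(ltW s0)// cmodB.
have := @ser_eq0 s _ _ (Num.min s e) s0 cc; rewrite lt_min s0 e0 => /(_ isT) E n.
apply/eqP; rewrite -subr_eq0; apply/eqP; apply: E => t t0; rewrite le_min => /andP[ts te].
have := csumB (cv1_asum cM ts) (cv1_asum cM' ts); rewrite -/(ser c t) -/(ser c' t) H// subrr => <-.
by apply: eq_csum => k; rewrite mulrBl.
Qed.

End Ser.

(** * Germs of analytic functions, with radius and bound left existential *)

Section Germ.
Context {R : realType}.
Local Notation C := (Cx R).
Implicit Types (d r M : R) (F G : C -> C -> C).

Definition ang F := exists d, exists2 M, 0 < d & an d M F.

Lemma ang_le F : ang F -> exists2 d0, 0 < d0 &
  exists M, forall d, 0 < d <= d0 -> an d M F.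
Proof.
move=> [d0 [M d00 FM]]; exists d0 => //; exists M => d /andP[dp dd].
by apply: an_mono FM; rewrite ltW.
Qed.

Lemma ang_near e F G : 0 < e -> (forall x t, cmod x <= e -> cmod t <= e -> F x t = G x t) ->
  ang F -> ang G.
Proof.
move=> e0 FG [d [M d0 FM]]; exists (Num.min d e); exists M; first by rewrite lt_min d0.
apply: an_eq (an_mono _ FM); last by rewrite ge_min lexx le_min (ltW d0) ltW.
by move=> x t; rewrite !le_min => /andP[_ xe] /andP[_ te]; exact: FG.
Qed.

Lemma ang_mul F G : ang F -> ang G -> ang (fun x t => F x t * G x t).
Proof.
move=> /ang_le[d1 d10 [M1 F1]] /ang_le[d2 d20 [M2 G2]].
pose d := Num.min d1 d2; have d0 : 0 < d by rewrite lt_min d10.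
exists d; exists (M1 * M2) => //; apply: an_mul => //.
  by apply: F1; rewrite d0 ge_min lexx.
by apply: G2; rewrite d0 ge_min lexx orbT.
Qed.

Lemma ang_add F G : ang F -> ang G -> ang (fun x t => F x t + G x t).
Proof.
move=> /ang_le[d1 d10 [M1 F1]] /ang_le[d2 d20 [M2 G2]].
pose d := Num.min d1 d2; have d0 : 0 < d by rewrite lt_min d10.
exists d; exists (M1 + M2) => //; apply: an_add; first exact: ltW.
  by apply: F1; rewrite d0 ge_min lexx.
by apply: G2; rewrite d0 ge_min lexx orbT.
Qed.

Lemma ang_const (z : C) : ang (fun _ _ => z).
Proof. by exists 1; exists (cmod z) => //; exact: an_const. Qed.

Lemma ang_X : ang (fun x _ => x).
Proof. by exists 1; exists 1 => //; exact: an_X. Qed.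

Lemma ang_T : ang (fun _ t => t).
Proof. by exists 1; exists 1 => //; exact: an_T. Qed.

Lemma ang_opp F : ang F -> ang (fun x t => - F x t).
Proof.
move=> /(ang_mul (ang_const (-1))); apply: (ang_near ltr01) => x t _ _.
by rewrite mulN1r.
Qed.

Lemma ang_sub F G : ang F -> ang G -> ang (fun x t => F x t - G x t).
Proof. by move=> hF /ang_opp; exact: ang_add. Qed.

Lemma ang_exp F n : ang F -> ang (fun x t => F x t ^+ n).
Proof. by move=> [d [M d0 FM]]; exists d; exists (M ^+ n) => //; exact: an_exp. Qed.

Lemma ang_comp F G H : ang F -> ang G -> ang H -> G 0 0 = 0 -> H 0 0 = 0 ->
  ang (fun x t => F (G x t) (H x t)).
Proof.
move=> [r [M r0 [a aM aE]]] [d1 [M1 d10 GM]] [d2 [M2 d20 HM]] G0 H0.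
have M10 : 0 <= M1 := (an_ge0 GM).
have M20 : 0 <= M2 := (an_ge0 HM).
(* On this radius [an_small] brings the norms of [G] and [H] down to [r], the radius on which [F] is
   a series. *)
pose d := Num.min (Num.min d1 d2) (Num.min (r * d1 / (M1 + 1)) (r * d2 / (M2 + 1))).
have d0 : 0 < d.
  by rewrite !lt_min d10 d20 /= !divr_gt0 ?mulr_gt0//; lra.
have dd1 : d <= d1 by rewrite !ge_min lexx.
have dd2 : d <= d2 by rewrite !ge_min lexx ?orbT.
have rd1 : d <= r * d1 / (M1 + 1) by rewrite !ge_min lexx ?orbT.
have rd2 : d <= r * d2 / (M2 + 1) by rewrite !ge_min lexx ?orbT.
have Hr e N : 0 < e -> 0 <= N -> d <= r * e / (N + 1) -> d / e * N <= r.
  move=> e0 N0; rewrite ler_pdivlMr; last lra.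
  move=> h; rewrite mulrAC ler_pdivrMr//.
  by apply: le_trans h; rewrite ler_wpM2l ?(ltW d0)//; lra.
have Gr : an d r G.
  apply: an_weak (an_small _ GM G0); last by rewrite d0.
  exact: Hr.
have Hrr : an d r H.
  apply: an_weak (an_small _ HM H0); last by rewrite d0.
  exact: Hr.
exists d; exists M => //; have := an_comp d0 aM Gr Hrr.
apply: an_eq => x t xd td; rewrite aE//; first exact: an_bound Gr xd td.
exact: an_bound Hrr xd td.
Qed.

Lemma ang_bound F : ang F -> exists2 d, 0 < d & exists2 M, 0 <= M &
  forall x t, cmod x <= d -> cmod t <= d -> cmod (F x t) <= M.
Proof.
move=> [d [M d0 FM]]; exists d => //; exists M; last by move=> x t; exact: an_bound.
exact: an_ge0 FM.
Qed.

Lemma ang_coef F : ang F -> exists c d M, [/\ 0 < d, pn d c M &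
  forall x t, cmod x <= d -> cmod t <= d -> F x t = pev c x t].
Proof. by move=> [d [M d0 [c cM cE]]]; exists c, d, M. Qed.

Lemma ang_pev c d M : 0 < d -> pn d c M -> ang (pev c).
Proof. by move=> d0 cM; exists d; exists M => //; exists c. Qed.

Lemma ang_ser c d M : 0 < d -> cv1 d c M -> ang (fun _ t => ser c t).
Proof.
move=> d0 /(cv1_pn (ltW d0))[H1 H2].
exists d; exists M => //; exists (fun k => if k.1 == 0%N then c k.2 else 0) => //.
by move=> x t xd td; rewrite H2.
Qed.

Lemma ang1_coef (h : C -> C) : ang (fun _ t => h t) -> exists c d M, [/\ 0 < d, cv1 d c M &
  forall t, cmod t <= d -> h t = ser c t].
Proof.
move=> [d [M d0 [c cM cE]]]; exists (fun j => c (0%N, j)), d, (M / d ^+ 0).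
split=> //; first exact: pn_row.
move=> t td; rewrite -(pev_0t d0 cM td) -(cE 0)// cmod0; exact: ltW.
Qed.

Lemma ang1_order (h : C -> C) : ang (fun _ t => h t) ->
  (exists2 d, 0 < d & forall t, cmod t <= d -> h t = 0) \/
  (exists k v, [/\ ang (fun _ t => v t), v 0 != 0 &
    exists2 d, 0 < d & forall t, cmod t <= d -> h t = t ^+ k * v t]).
Proof.
move=> /ang1_coef[c [d [M [d0 cM cE]]]]; have [c0|[k [ck c0]]] := nat_order c.
  left; exists d => // t td; rewrite cE// /ser.
  by rewrite -[RHS](@csum0 R nat); apply: eq_csum => n; rewrite c0 mul0r.
right; exists k, (ser (fun n => c (n + k)%N)); split.
- exact: ang_ser d0 (cv1_shift k d0 cM).
- by rewrite ser0.
- by exists d => // t td; rewrite cE// (ser_shift d0 cM td c0).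
Qed.

End Germ.

Section Nat.
Context {R : realType}.
Local Notation C := (Cx R).

Lemma sumle_nat (g : nat -> R) M : (forall n, 0 <= g n) ->
  (forall N, \sum_(i < N) g i <= M) -> sumle g M.
Proof.
move=> g0 gM; apply: sumle_ub => // s us.
pose N := (\max_(i <- s) i).+1.
apply: le_trans (gM N); rewrite -(big_mkord xpredT) /=.
have ps : perm_eq s [seq i <- index_iota 0 N | i \in s].
  apply: uniq_perm => //; first by rewrite filter_uniq// iota_uniq.
  move=> i; rewrite mem_filter mem_index_iota /=.
  by case: (boolP (i \in s)) => //= si; rewrite ltnS leq_bigmax_seq.
rewrite (perm_big _ ps) big_filter big_mkcond.
by apply: ler_sum => i _; case: ifP.
Qed.

Lemma csum_split (h : nat -> C) M n : asum h M ->
  csum h = \sum_(i < n) h i + csum (fun i => h (i + n)%N).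
Proof.
move=> hM; pose h1 i := if (i < n)%N then h i else 0.
pose h2 i := if (i < n)%N then 0 else h i.
have h2M : asum h2 M.
  by apply: asum_dom hM _ => i; rewrite /h2; case: ifP => // _; rewrite cmod0.
have [h1M h1E] : asum h1 (\sum_(i <- iota 0 n) cmod (h1 i)) /\
    csum h1 = \sum_(i <- iota 0 n) h1 i.
  apply: csum_fin; first exact: iota_uniq.
  by move=> i; rewrite mem_iota /h1 add0n /= => /negPf ->.
have E : csum h = csum h1 + csum h2.
  rewrite -(csumD h1M h2M); apply: eq_csum => i.
  by rewrite /h1 /h2; case: ifP; rewrite ?addr0 ?add0r.
rewrite E h1E; congr (_ + _).
  rewrite -(big_mkord xpredT h) /index_iota subn0 big_seq [RHS]big_seq.
  by apply: eq_bigr => i; rewrite mem_iota /h1 add0n /= => ->.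
rewrite -(csum_inj (@addn_inj n) h2M).
  by apply: eq_csum => i /=; rewrite /h2 ltnNge leq_addl.
move=> i ni; rewrite /h2; case: ltnP => // /subnK ini.
by have := ni (i - n)%N; rewrite ini eqxx.
Qed.

Lemma geom_half (s : R) n : \sum_(i < n) s * 2^-1 ^+ i.+1 = s * (1 - 2^-1 ^+ n).
Proof.
elim: n => [|n IH]; first by rewrite big_ord0 expr0 subrr mulr0.
rewrite big_ord_recr /= IH exprS; move: (2^-1 ^+ n) => h; lra.
Qed.

Lemma sumle_geom (s : R) : 0 <= s -> sumle (fun n => s * 2^-1 ^+ n.+1) s.
Proof.
move=> s0; apply: sumle_nat => [n|N].
  by rewrite mulr_ge0// exprn_ge0// invr_ge0.
rewrite geom_half ler_piMr// gerBl exprn_ge0// invr_ge0//.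
Qed.

Lemma half_exp_small (e : R) : 0 < e -> exists n, 2^-1 ^+ n < e :> R.
Proof.
move=> e0; have ne : e^-1 < (Num.bound e^-1)%:R.
  by apply: archi_boundP; rewrite invr_ge0 ltW.
exists (Num.bound e^-1); rewrite exprVn invf_plt ?posrE ?exprn_gt0//.
apply: lt_trans ne _; rewrite -natrX ltr_nat; exact: ltn_expl.
Qed.

Lemma eq0_le_half (x : R) K : 0 <= x -> (forall n, x <= K * 2^-1 ^+ n) -> x = 0.
Proof.
move=> x0 H; apply/eqP/negPn/negP => xn.
have xp : 0 < x by rewrite lt_def xn.
have K0 : 0 < K by have := H 0%N; rewrite expr0 mulr1; lra.
have [n] := half_exp_small (divr_gt0 xp K0).
by rewrite ltr_pdivlMr// mulrC ltNge H.
Qed.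
End Nat.

(** * Implicit function theorem by contraction *)

Section IFT.
Context {R : realType}.
Local Notation C := (Cx R).
Implicit Types (d r M s L : R) (F G z w : C -> C -> C).

Lemma an_pow_sub d s e z w i : 0 < d -> an d s z -> an d s w ->
  an d e (fun x t => z x t - w x t) ->
  an d (i%:R * s ^+ i.-1 * e) (fun x t => z x t ^+ i - w x t ^+ i).
Proof.
move=> d0 zs ws ze; elim: i => [|i IH].
  have := an_const 0 (ltW d0); rewrite cmod0 !mul0r.
  by apply: an_eq => x t _ _; rewrite subrr.
have := an_add (ltW d0) (an_mul d0 zs IH) (an_mul d0 ze (an_exp i d0 ws)).
have -> : s * (i%:R * s ^+ i.-1 * e) + e * s ^+ i = i.+1%:R * s ^+ i.+1.-1 * e.
  case: i {IH} => [|i] /=; first by rewrite !mul0r mulr0 add0r !expr0 mulr1 !mul1r.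
  by rewrite -(natr1 i.+1) exprS; ring.
by apply: an_eq => x t _ _; rewrite !exprS; ring.
Qed.

Lemma an_lip d (b : nat * nat -> C) M s L z w e : 0 < d -> 0 <= s -> 0 <= e -> d <= s ->
  pn s b M ->
  sumle (fun k => cmod (b k) * (k.1%:R * s ^+ k.1.-1 * d ^+ k.2)) L ->
  an d s z -> an d s w -> an d e (fun x t => z x t - w x t) ->
  an d (L * e) (fun x t => pev b (z x t) t - pev b (w x t) t).
Proof.
move=> d0 s0 e0 ds bM bL zs ws ze.
have := @an_sum _ _ d (fun k x t => b k * ((z x t ^+ k.1 - w x t ^+ k.1) * t ^+ k.2))
  (fun k => cmod (b k) * (k.1%:R * s ^+ k.1.-1 * e * d ^+ k.2)) (L * e) d0.
move=> /(_ _ _)[].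
- move=> k; apply: an_scale; apply: an_mul => //; first exact: an_pow_sub.
  by apply: an_exp => //; apply: an_T; exact: ltW.
- rewrite mulrC; have := sumleZ e0 bL; congr sumle; apply/funext => k; ring.
move=> c cL cE; exists c => // x t xd td.
rewrite -cE//.
have zx := an_bound zs xd td; have wx := an_bound ws xd td.
have ts := le_trans td ds.
rewrite /pev -(csumB (pn_asum bM zx ts) (pn_asum bM wx ts)).
by apply: eq_csum => k; rewrite /mon; ring.
Qed.

Lemma leq_pred_exp2 i : (i <= 2 ^ i.-1)%N.
Proof. by case: i => // i; exact: ltn_expl. Qed.

(** As i <= 2^(i-1), the left side is at most (2 s)^(i+j-1) when i > 0, and i + j - 1 >= 1 once (1,
    0) is excluded. One factor 2 s is kept and the others are bounded by d, so a series without
    linear x-term is Lipschitz in x with constant O(s). *)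
Lemma lip_weight d s (i j : nat) : 0 < d -> 0 < s -> 2 * s <= d -> forall e, 0 <= e <= s ->
  (i, j) != (1%N, 0%N) ->
  i%:R * s ^+ i.-1 * e ^+ j <= 2 * s / d ^+ 2 * d ^+ (i + j).
Proof.
move=> d0 s0 sd e /andP[e0 es] ij.
have rhs0 : 0 <= 2 * s / d ^+ 2 * d ^+ (i + j).
  by rewrite mulr_ge0 ?exprn_ge0 ?divr_ge0 ?mulr_ge0 ?exprn_ge0// ltW.
case: i => [|i] in ij rhs0 *; first by rewrite !mul0r.
have H1 : i.+1%:R * s ^+ i <= (2 * s) ^+ i.
  rewrite exprMn ler_wpM2r ?exprn_ge0 ?(ltW s0)//.
  by rewrite -natrX ler_nat; exact: leq_pred_exp2.
have H2 : e ^+ j <= (2 * s) ^+ j by rewrite lerXn2r ?nnegrE; lra.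
apply: le_trans (ler_pM _ _ H1 H2) _; rewrite ?mulr_ge0 ?exprn_ge0 ?(ltW s0)//.
rewrite -exprD addSn exprS.
have [n ->] : exists n, (i + j = n.+1)%N.
  by case: i j ij {H1 H2 rhs0} => [|i] [|j]// _; eexists; rewrite ?addnS ?addSn.
rewrite !exprS expr0 mulr1 mulrA.
have -> : 2 * s / (d * d) * d * (d * d ^+ n) = 2 * s * d ^+ n.
  by field; rewrite gt_eqF.
rewrite ler_wpM2l ?mulr_ge0 ?(ltW s0)// lerXn2r ?nnegrE; lra.
Qed.

Lemma pn_mono d d' (c : nat * nat -> C) M : 0 <= d' <= d -> pn d c M -> pn d' c M.
Proof.
move=> /andP[d'0 d'd] cM; apply: sumle_dom cM _ => n.
by rewrite mulr_ge0 ?exprn_ge0//= ler_wpM2l// lerXn2r// nnegrE (le_trans d'0).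
Qed.

(** Picard iteration carried out in the norm of [an], so that the limit is again analytic. *)
Lemma fixpoint d (b : nat * nat -> C) M : 0 < d -> pn d b M ->
  b (0%N, 0%N) = 0 -> b (1%N, 0%N) = 0 ->
  exists h : C -> C, [/\ ang (fun _ t => h t), h 0 = 0 &
    exists2 e, 0 < e & forall t, cmod t <= e -> pev b (h t) t = h t].
Proof.
move=> d0 bM b00 b10; have M0 := sumle_ge0 bM.
(* Radius of the ball on which substitution into [b] is a contraction with constant 1/2. *)
pose s := Num.min (d / 2) (d ^+ 2 / (4 * M + 1)).
have s0 : 0 < s by rewrite lt_min !divr_gt0 ?exprn_gt0//; lra.
have sd : 2 * s <= d.
  have : s <= d / 2 by rewrite ge_min lexx.
  lra.
have sL : 2 * s / d ^+ 2 * M <= 2^-1.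
  have h : s <= d ^+ 2 / (4 * M + 1) by rewrite ge_min lexx orbT.
  move: h; rewrite ler_pdivlMr; last lra.
  rewrite [_ / _]mulrC -mulrA ler_pdivrMl ?exprn_gt0//; lra.
(* Radius in t on which the first iterate has norm at most s / 2; the increments then halve and all
   iterates stay in the ball. *)
pose e := Num.min s (s * d / (2 * M + 1)).
have e0 : 0 < e by rewrite lt_min s0 !divr_gt0 ?mulr_gt0//; lra.
have es : e <= s by rewrite ge_min lexx.
have eM : e / d * M <= s * 2^-1.
  have h : e <= s * d / (2 * M + 1) by rewrite ge_min lexx orbT.
  move: h; rewrite ler_pdivlMr; last lra.
  by rewrite mulrAC ler_pdivrMr//; lra.
have sdd : s <= d by lra.
have bs : pn s b M by apply: pn_mono bM; rewrite (ltW s0).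
have bL : sumle (fun k => cmod (b k) * (k.1%:R * s ^+ k.1.-1 * e ^+ k.2)) 2^-1.
  apply: sumle_weak sL.
  have c0 : 0 <= 2 * s / d ^+ 2 by rewrite divr_ge0 ?mulr_ge0 ?exprn_ge0// ltW.
  apply: sumle_dom (sumleZ c0 bM) _ => -[i j] /=.
  rewrite !mulr_ge0 ?exprn_ge0 ?(ltW s0) ?(ltW e0)//=.
  rewrite [leRHS]mulrCA; have [->|ij] := eqVneq (i, j) (1%N, 0%N).
    by rewrite b10 cmod0 !mul0r lexx.
  by rewrite ler_wpM2l//; apply: lip_weight; rewrite ?(ltW e0).
pose z := fix z n : C -> C -> C := if n is n'.+1 then fun x t => pev b (z n' x t) t else fun _ _ => 0.
have z1 : an e (s * 2^-1) (z 1%N).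
  have H : an d M (pev b) by exists b.
  have H2 : an e (e / d * M) (pev b).
    by apply: an_small => //; [rewrite e0 (le_trans es)|rewrite pev00].
  have [c cM cE] := H2; have cr := cv1_pn (ltW e0) (pn_row 0 e0 cM).
  exists (fun k => if k.1 == 0%N then c (0%N, k.2) else 0).
    by case: cr => + _; rewrite divr1 => h; exact: sumle_weak h eM.
  move=> x t xe te; case: cr => _ ->//=.
  by rewrite cE ?cmod0 ?(ltW e0)// (pev_0t e0 cM te).
have half_le n : 2^-1 ^+ n <= 1 :> R by rewrite exprn_ile1 ?invr_ge0//; lra.
have half_ge n : 0 <= 2^-1 ^+ n :> R by rewrite exprn_ge0 ?invr_ge0.
have zP n : an e (s * (1 - 2^-1 ^+ n)) (z n) /\
    an e (s * 2^-1 ^+ n.+1) (fun x t => z n.+1 x t - z n x t).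
  elim: n => [|n [IH1 IH2]].
    split; last by apply: an_eq z1 => x t _ _ /=; rewrite subr0.
    by rewrite subrr mulr0 -(@cmod0 R); apply: an_const; exact: ltW.
  have zn1 : an e (s * (1 - 2^-1 ^+ n.+1)) (z n.+1).
    have := an_add (ltW e0) IH1 IH2.
    have -> : s * (1 - 2^-1 ^+ n) + s * 2^-1 ^+ n.+1 = s * (1 - 2^-1 ^+ n.+1).
      by rewrite !exprS; field.
    by apply: an_eq => x t _ _; rewrite addrC subrK.
  split=> //.
  have weak k : an e (s * (1 - 2^-1 ^+ k)) (z k) -> an e s (z k).
    by apply: an_weak; rewrite ler_piMr ?(ltW s0)// gerBl.
  have -> : s * 2^-1 ^+ n.+2 = 2^-1 * (s * 2^-1 ^+ n.+1) by rewrite (exprS _ n.+1) mulrCA.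
  apply: (an_lip e0 (ltW s0) _ es bs bL (weak _ zn1) (weak _ IH1) IH2).
  by rewrite mulr_ge0// ltW.
pose dz n x t := z n.+1 x t - z n x t.
have dzM n : an e (s * 2^-1 ^+ n.+1) (dz n) by case: (zP n).
have zS n x t : z n.+1 x t = pev b (z n x t) t by [].
have z_t n x t : z n x t = z n 0 t.
  by elim: n => [|n IH]; [reflexivity|rewrite !zS IH].
pose h t := csum (fun n => dz n 0 t).
have hA : an e s (fun x t => h t).
  have := an_sum e0 dzM (sumle_geom (ltW s0)).
  by apply: an_eq => x t _ _; apply: eq_csum => n; rewrite /dz !z_t.
have hz n t : cmod t <= e -> cmod (h t - z n 0 t) <= s * 2^-1 ^+ n.
  move=> te; have x0 : cmod (0 : C) <= e by rewrite cmod0 ltW.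
  have H m : asum (fun i => dz (i + m)%N 0 t) (s * 2^-1 ^+ m).
    have sm : 0 <= s * 2^-1 ^+ m by rewrite mulr_ge0// ltW.
    apply: asum_dom (sumle_geom sm) _ => i.
    apply: le_trans (an_bound (dzM _) x0 te) _.
    by rewrite -mulrA -exprD addnS addnC.
  have tel : \sum_(i < n) dz i 0 t = z n 0 t.
    elim: n => [|n IH]; first by rewrite big_ord0.
    by rewrite big_ord_recr IH /dz /= addrC subrK.
  have h0 : asum (fun i => dz i 0 t) s.
    by have := H 0%N; rewrite expr0 mulr1; congr asum; apply/funext => i; rewrite addn0.
  by rewrite /h (csum_split n h0) tel addrAC subrr add0r; exact: csum_le.
exists h; split.
- by exists e; exists s.
- rewrite /h -[RHS](@csum0 R nat); apply: eq_csum => n; rewrite /dz.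
  have zz k : z k 0 0 = 0.
    by elim: k => [|k IH]; [reflexivity|rewrite zS IH pev00].
  by rewrite !zz subrr.
- exists e => // t te; apply/eqP; rewrite -subr_eq0 -cmod_eq0; apply/eqP.
  have x0 : cmod (0 : C) <= e by rewrite cmod0 ltW.
  have cst x : an s (cmod x) (fun _ _ => x) by apply: an_const; exact: ltW.
  have hs : cmod (h t) <= s := an_bound hA x0 te.
  apply: (@eq0_le_half _ _ (s * 2)) => // n.
  have zs : cmod (z n 0 t) <= s.
    apply: le_trans (an_bound (proj1 (zP n)) x0 te) _.
    by rewrite ler_piMr ?(ltW s0)// gerBl.
  have lip : cmod (pev b (h t) t - pev b (z n 0 t) t) <= 2^-1 * cmod (h t - z n 0 t).
    have wk x : cmod x <= s -> an e s (fun _ _ => x).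
      by move=> xs; apply: an_weak xs _; apply: an_const; exact: ltW.
    exact: (an_bound (an_lip e0 (ltW s0) (cmod_ge0 _) es bs bL (wk _ hs) (wk _ zs)
       (an_const (h t - z n 0 t) (ltW e0))) x0 te).
  (* Comparison with the n-th iterate: both differences are O(2^-n), for every n. *)
  have -> : pev b (h t) t - h t =
      (pev b (h t) t - pev b (z n 0 t) t) - (h t - z n.+1 0 t).
    by rewrite zS opprB addrA subrK.
  apply: le_trans (cmodB _ _) _.
  have := hz n t te; have := hz n.+1 t te; rewrite exprS.
  by have := half_ge n; nra.
Qed.

Lemma IFT d (c : nat * nat -> C) M : 0 < d -> pn d c M ->
  c (0%N, 0%N) = 0 -> c (1%N, 0%N) != 0 ->
  exists h : C -> C, [/\ ang (fun _ t => h t), h 0 = 0 &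
    exists2 e, 0 < e & forall t, cmod t <= e -> pev c (h t) t = 0].
Proof.
move=> d0 cM c00 c10.
pose a := (c (1%N, 0%N))^-1.
(* The series of x - c / c_(1,0), whose fixed points in x are the zeros of [c]; its coefficient at
   (1, 0) is 0. *)
pose b k := if k == (1%N, 0%N) then 0 else - (a * c k).
have bM : pn d b (cmod a * M).
  apply: sumle_dom (sumleZ (cmod_ge0 a) cM) _ => k.
  rewrite mulr_ge0 ?exprn_ge0 ?(ltW d0)//= mulrA ler_wpM2r ?exprn_ge0 ?(ltW d0)//.
  by rewrite /b; case: ifP => _; [rewrite cmod0 mulr_ge0|rewrite cmodN cmodM].
have [||h [hA h0 [e e0 he]]] := fixpoint d0 bM.
  by rewrite /b /= c00 mulr0 oppr0.
  by rewrite /b eqxx.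
exists h; split=> //.
have [d1 d10 [M1 _]] := ang_bound hA.
have [d2 d20 hd] : exists2 d2, 0 < d2 & forall t, cmod t <= d2 -> cmod (h t) <= d.
  have [c1 [d2 [M2 [d20 c1M c1E]]]] := ang1_coef hA.
  have M20 : 0 <= M2 := sumle_ge0 c1M.
  exists (Num.min d2 (d * d2 / (M2 + 1))).
    by rewrite lt_min d20 divr_gt0 ?mulr_gt0//; lra.
  move=> t; rewrite le_min => /andP[t2 tM].
  have c10' : c1 0%N = 0 by rewrite -ser0 -c1E ?cmod0 ?ltW.
  have := ser_cont0 d20 c1M t2; rewrite -c1E// c10' subr0 => /le_trans; apply.
  rewrite mulrA ler_pdivrMr//; move: tM; rewrite ler_pdivlMr; last lra.
  have := cmod_ge0 t; nra.
exists (Num.min e (Num.min d d2)); first by rewrite !lt_min e0 d0.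
move=> t; rewrite !le_min => /and3P[te td t2].
have xd := hd t t2.
have E : csum (fun k => a * (c k * mon (h t) t k) + b k * mon (h t) t k) = h t.
  rewrite (csum1 (i0 := (1%N, 0%N))).
    by rewrite /b eqxx mul0r addr0 mulrA mulVf// mul1r /mon /= mulr1.
  by move=> k /negPf k10; rewrite /b k10; ring.
have cA := pn_asum cM xd td.
rewrite (csumD (asumZ a cA) (pn_asum bM xd td)) (csumZ a cA) -/(pev c _ _) -/(pev b _ _) he// in E.
have {}E : a * pev c (h t) t = 0 by apply: (addIr (h t)); rewrite E add0r.
by move/eqP: E; rewrite mulf_eq0 invr_eq0 (negPf c10) => /eqP.
Qed.

End IFT.

(** * Newton-Puiseux factorization *)

Section Near.
Context {R : realType}.
Local Notation C := (Cx R).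
Implicit Types (F G : C -> C -> C) (h : C -> C).

Definition near1 (P : C -> Prop) := exists2 e : R, 0 < e & forall t, cmod t <= e -> P t.
Definition near2 (P : C -> C -> Prop) :=
  exists2 e : R, 0 < e & forall x t, cmod x <= e -> cmod t <= e -> P x t.

Lemma near1_and P Q : near1 P -> near1 Q -> near1 (fun t => P t /\ Q t).
Proof.
move=> [e e0 eP] [e' e'0 eQ]; exists (Num.min e e'); first by rewrite lt_min e0.
by move=> t; rewrite le_min => /andP[te te']; split; [exact: eP|exact: eQ].
Qed.

Lemma near2_and P Q : near2 P -> near2 Q -> near2 (fun x t => P x t /\ Q x t).
Proof.
move=> [e e0 eP] [e' e'0 eQ]; exists (Num.min e e'); first by rewrite lt_min e0.
move=> x t; rewrite !le_min => /andP[xe xe'] /andP[te te'].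
by split; [exact: eP|exact: eQ].
Qed.

Lemma near1_imp (P Q : C -> Prop) : (forall t, P t -> Q t) -> near1 P -> near1 Q.
Proof. by move=> PQ [e e0 eP]; exists e => // t /eP /PQ. Qed.

Lemma near2_imp (P Q : C -> C -> Prop) :
  (forall x t, P x t -> Q x t) -> near2 P -> near2 Q.
Proof. by move=> PQ [e e0 eP]; exists e => // x t xe /(eP _ _ xe) /PQ. Qed.

Lemma near1_near2 (P : C -> Prop) : near1 P -> near2 (fun _ t => P t).
Proof. by move=> [e e0 eP]; exists e => // x t _ /eP. Qed.

Lemma ang_small F (e : R) : ang F -> F 0 0 = 0 -> 0 < e ->
  near2 (fun x t => cmod (F x t) <= e).
Proof.
move=> [d [M d0 FM]] F0 e0; have M0 := an_ge0 FM.
pose d' := Num.min d (e * d / (M + 1)).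
have d'0 : 0 < d' by rewrite lt_min d0 divr_gt0 ?mulr_gt0//; lra.
have H : an d' (d' / d * M) F by apply: an_small FM F0; rewrite d'0 ge_min lexx.
exists d' => // x t xd td; apply: le_trans (an_bound H xd td) _.
have h : d' <= e * d / (M + 1) by rewrite ge_min lexx orbT.
rewrite mulrAC ler_pdivrMr//; move: h; rewrite ler_pdivlMr; last lra.
by apply: le_trans; rewrite ler_wpM2l ?(ltW d'0)//; lra.
Qed.

Lemma near2_comp (P : C -> C -> Prop) F G : near2 P -> ang F -> ang G ->
  F 0 0 = 0 -> G 0 0 = 0 -> near2 (fun x t => P (F x t) (G x t)).
Proof.
move=> [e e0 eP] FA GA F0 G0.
apply: near2_imp (near2_and (ang_small FA F0 e0) (ang_small GA G0 e0)) => x t.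
by move=> [xe te]; exact: eP.
Qed.

Lemma near2_comp1 (P : C -> C -> Prop) h h' : near2 P -> ang (fun _ t => h t) ->
  ang (fun _ t => h' t) -> h 0 = 0 -> h' 0 = 0 -> near1 (fun t => P (h t) (h' t)).
Proof.
move=> HP hA h'A h0 h'0; have [e e0 eP] := near2_comp HP hA h'A h0 h'0.
by exists e => // t te; apply: (eP 0) => //; rewrite cmod0 ltW.
Qed.

Lemma near1_comp (P : C -> Prop) h : near1 P -> ang (fun _ t => h t) -> h 0 = 0 ->
  near1 (fun t => P (h t)).
Proof. by move=> /near1_near2 HP hA h0; exact: (near2_comp1 HP hA hA h0 h0). Qed.

Lemma ang_swap1 h : ang (fun _ t => h t) -> ang (fun x _ => h x).
Proof.
move=> hA; have := @ang_comp _ (fun x t => h t - h 0) (fun _ _ => 0) (fun x _ => x)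
  (ang_sub hA (ang_const _)) (ang_const 0) ang_X erefl erefl.
move=> H; have := ang_add H (ang_const (h 0)); apply: (ang_near ltr01).
by move=> x t _ _; rewrite subrK.
Qed.

Lemma ang_comp1 h h' : ang (fun _ t => h t) -> ang (fun _ t => h' t) -> h' 0 = 0 ->
  ang (fun _ t => h (h' t)).
Proof.
by move=> hA h'A h'0; exact: (@ang_comp _ (fun _ t => h t) (fun _ t => h' t) (fun _ t => h' t)).
Qed.

Lemma ang_Tn n : ang (fun _ (t : C) => t ^+ n).
Proof. exact: ang_exp ang_T. Qed.

End Near.

(** * Taylor expansion in x and the Tschirnhaus shift *)

Section Tschirnhaus.
Context {R : realType}.
Local Notation C := (Cx R).
Implicit Types (c : nat * nat -> C) (d M : R).

(** Regularity in x alone. Mini-regularity also bounds the order of the whole germ, which can be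
    lost in a Newton step; this weaker notion is the one that Newton's algorithm propagates. *)
Definition has_order c m := (forall i, (i < m)%N -> c (i, 0%N) = 0) /\ c (m, 0%N) != 0.

(** The coefficients of the p-th x-derivative divided by p!. The binomial factors, at most 2^(k.1 +
    p), are paid for by halving the radius. *)
Definition dcoef p c (k : nat * nat) : C := c (k.1 + p, k.2)%N *+ 'C(k.1 + p, p).

Lemma bin_le_exp2 n p : ('C(n, p) <= 2 ^ n)%N.
Proof.
have [np|np] := leqP p n; last by rewrite bin_small.
have -> : (2 ^ n = \sum_(i < n.+1) 'C(n, i))%N.
  by rewrite -[2%N]/(1 + 1)%N expnDn; apply: eq_bigr => i _; rewrite !exp1n !muln1.
have pn' : (p < n.+1)%N by [].
by rewrite (bigD1 (Ordinal pn'))//= leq_addr.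
Qed.

Lemma inj_row p : injective (fun k : nat * nat => ((k.1 + p)%N, k.2)).
Proof. by move=> [i j] [i' j'] [/addIn -> ->]. Qed.

Lemma dcoef_pn d c M p : 0 < d -> pn d c M ->
  pn (d / 2) (dcoef p c) (M * (2 / d) ^+ p).
Proof.
move=> d0 cM; have d2 : 0 < d / 2 by rewrite divr_gt0.
have H : sumle (fun k : nat * nat => cmod (c (k.1 + p, k.2)%N) * d ^+ (k.1 + p + k.2)) M.
  apply: sumle_ub => [k|s us]; first by rewrite mulr_ge0// exprn_ge0// ltW.
  have := @sumle_fin _ _ _ _ (map (fun k : nat * nat => ((k.1 + p)%N, k.2)) s) cM.
  by rewrite (map_inj_uniq (@inj_row p)) big_map; apply.
have K0 : 0 <= (2 / d) ^+ p by rewrite exprn_ge0// divr_ge0// ltW.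
rewrite [M * _]mulrC; apply: sumle_dom (sumleZ K0 H) _ => -[i j] /=.
rewrite mulr_ge0 ?exprn_ge0 ?(ltW d2)//=.
rewrite /dcoef /= cmodMn [leRHS]mulrCA -mulrA ler_wpM2l//.
have -> : (2 / d) ^+ p * d ^+ (i + p + j) = 2 ^+ (i + p) * (d / 2) ^+ i * d ^+ j.
  rewrite !exprMn !exprVn !exprD; field.
  by rewrite !expf_neq0 ?pnatr_eq0 ?gt_eqF.
rewrite exprD mulrA; apply: ler_pM.
- by rewrite mulr_ge0// exprn_ge0// ltW.
- by rewrite exprn_ge0// ltW.
- by rewrite ler_wpM2r ?exprn_ge0 ?(ltW d2)// -natrX ler_nat bin_le_exp2.
- rewrite lerXn2r ?nnegrE ?(ltW d2) ?(ltW d0)//; lra.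
Qed.

Lemma asum_divr (I : choiceType) (h : I -> C) z M : z != 0 ->
  asum (fun k => h k * z) M -> asum h (cmod z^-1 * M).
Proof.
move=> z0 /(asumZ z^-1); congr asum; apply/funext => k.
by rewrite mulrC mulfK.
Qed.

(** Binomial expansion of each (x + y)^i followed by an interchange of sums: as |x| + |y| <= d, the
    triple family is dominated by the weights of [c] at radius [d]. *)
Lemma taylor d c M y t p : 0 < d -> pn d c M ->
  cmod y <= d / 2 -> cmod t <= d / 2 ->
  exists g, [/\ cv1 (d / 2) g M, g p = pev (dcoef p c) y t &
    forall x, cmod x <= d / 2 -> pev c (x + y) t = ser g x].
Proof.
move=> d0 cM yd td; have d2 : 0 < d / 2 by rewrite divr_gt0.
pose T1 (k : nat * nat) q : C := (c k * (y ^+ (k.1 - q) * t ^+ k.2)) *+ 'C(k.1, q).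
pose T x (k : (nat * nat) * nat) : C := T1 k.1 k.2 * x ^+ k.2.
have T10 k q : (k.1 < q)%N -> T1 k q = 0.
  by move=> kk; rewrite /T1 bin_small// mulr0n.
have T0 x k : (k.1.1 < k.2)%N -> T x k = 0.
  by move=> kk; rewrite /T T10// mul0r.
have binom x k : csum (fun q => T x (k, q)) = c k * mon (x + y) t k /\
   asum (fun q => T x (k, q)) (cmod (c k) * ((cmod x + cmod y) ^+ k.1 * cmod t ^+ k.2)).
  have hs q : q \notin iota 0 k.1.+1 -> T x (k, q) = 0.
    by rewrite mem_iota add0n ltnS /= -ltnNge => kq; apply: T0.
  have [H1 H2] := csum_fin (iota_uniq _ _) hs.
  split.
    rewrite H2 -[iota _ _]/(index_iota 0 k.1.+1) big_mkord /mon addrC exprDn.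
    rewrite mulr_suml mulr_sumr; apply: eq_bigr => i _.
    by rewrite /T /T1 /= -!(mulr_natr (_ * _)); ring.
  move: H1; congr asum.
  rewrite -[iota _ _]/(index_iota 0 k.1.+1) big_mkord addrC exprDn.
  rewrite mulr_suml mulr_sumr; apply: eq_bigr => i _.
  rewrite /T /T1 /= cmodM cmodMn !cmodM !cmodX -!(mulr_natr (_ * _)); ring.
have HT x : cmod x <= d / 2 -> asum (T x) M.
  move=> xd; apply: sumle_pair; first by move=> k; case: (binom x k) => _; exact.
  apply: sumle_dom cM _ => k; rewrite mulr_ge0 ?mulr_ge0 ?exprn_ge0 ?addr_ge0//=.
  rewrite ler_wpM2l// exprD; apply: ler_pM; rewrite ?exprn_ge0 ?addr_ge0//.
    by rewrite lerXn2r ?nnegrE ?addr_ge0 ?(ltW d0)//; lra.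
  by rewrite lerXn2r ?nnegrE ?(ltW d0)//; lra.
pose g q := csum (fun k : nat * nat => T1 k q).
have D2 : cmod ((d / 2)%:C%C : C) <= d / 2 by rewrite cmod_real ger0_norm// ltW.
have D20 q : ((d / 2)%:C%C : C) ^+ q != 0.
  by rewrite expf_neq0// -cmod_eq0 cmod_real ger0_norm ?gt_eqF// ltW.
have A1 q : asum (fun k : nat * nat => T1 k q) (cmod (((d / 2)%:C%C : C) ^+ q)^-1 * M).
  by have [h _ _] := csum_exch (HT _ D2); apply: (asum_divr (D20 q)); exact: h.
have gE x q : g q * x ^+ q = csum (fun k : nat * nat => T x (k, q)).
  by rewrite -(csumZr _ (A1 q)).
exists g; split.
- have [_ h _] := csum_exch (HT _ D2); move: h; congr sumle; apply/funext => q.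
  by rewrite -gE cmodM cmodX cmod_real ger0_norm// ltW.
- rewrite /g /pev -(csum_inj (@inj_row p) (A1 p)).
    apply: eq_csum => -[i j] /=.
    by rewrite /T1 /dcoef /mon /= addnK mulrnAl.
  move=> [i j] ij; apply: T10 => /=; rewrite ltnNge; apply/negP => pi.
  by have := ij ((i - p)%N, j); rewrite /= subnK// eqxx.
- move=> x xd; have [_ _ E1] := csum_pair (HT x xd).
  have [_ _ E2] := csum_exch (HT x xd).
  rewrite /ser (eq_csum (gE x)) -E2 E1; apply: eq_csum => k.
  by case: (binom x k).
Qed.

(* Choosing h as a root of the (m-1)-st x-derivative kills the coefficient of x^(m-1). *)
Lemma tschirnhaus d c M m : 0 < d -> pn d c M -> has_order c m.+1 ->
  exists (h : C -> C) b, exists2 d', 0 < d' & exists M',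
    [/\ ang (fun _ t => h t) /\ h 0 = 0, pn d' b M', has_order b m.+1,
     forall j, b (m, j) = 0 &
     near2 (fun x t => pev c (x + h t) t = pev b x t)].
Proof.
move=> d0 cM [c0 cm]; have d2 : 0 < d / 2 by rewrite divr_gt0.
(* The linear x-coefficient of the m-th divided derivative is (m + 1) c_(m+1,0), nonzero in
   characteristic 0. *)
have [||h [hA h0 [e e0 he]]] := IFT d2 (dcoef_pn m d0 cM).
- by rewrite /dcoef /= add0n c0 ?mul0rn.
- by rewrite /dcoef /= add1n binSn mulrn_eq0.
have FA : ang (fun x t => pev c (x + h t) t).
  apply: (@ang_comp _ (pev c) (fun x t => x + h t) (fun x t => t)) => //.
  - exact: (ang_pev d0 cM).
  - exact: (ang_add ang_X hA).
  - exact: ang_T.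
  - by rewrite add0r.
have [b [d' [M' [d'0 bM bE]]]] := ang_coef FA.
exists h, b, d' => //; exists M'.
have bN : near2 (fun x t => pev c (x + h t) t = pev b x t) by exists d'.
split=> //.
- have E i : b (i, 0%N) = c (i, 0%N).
    have b1 : cv1 d' (fun i => b (i, 0%N)) M'.
      have z0 : cmod (0 : C) <= d' by rewrite cmod0 ltW.
      have [h1 _] := pev_rows d'0 bM z0 z0; move: h1; congr sumle.
      by apply/funext => i'; rewrite ser0.
    have c1 : cv1 d (fun i => c (i, 0%N)) M.
      have z0 : cmod (0 : C) <= d by rewrite cmod0 ltW.
      have [h1 _] := pev_rows d0 cM z0 z0; move: h1; congr sumle.
      by apply/funext => i'; rewrite ser0.
    have m0 : 0 < Num.min d d' by rewrite lt_min d0.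
    apply: (ser_uniq d'0 b1 d0 c1 m0 _ i) => x _; rewrite le_min => /andP[xd xd'].
    have z0 : cmod (0 : C) <= d' by rewrite cmod0 ltW.
    have H1 := pev_x0 d'0 bM xd'; have H2 := pev_x0 d0 cM xd.
    have := bE x 0 xd' z0; rewrite h0 addr0 => H3.
    exact: (etrans (esym H1) (etrans (esym H3) H2)).
  by split=> [i im|]; rewrite E// c0.
(* As a function of t, the coefficient of x^m in [b] is the m-th divided derivative of [c] at (h t,
   t), which vanishes by the choice of [h]. *)
- move=> j.
  have [e1 e10 he1] : near1 (fun t => cmod (h t) <= d / 2).
    have [e1 e10 H] := ang_small hA h0 d2; exists e1 => // t te.
    by apply: (H 0) => //; rewrite cmod0 ltW.
  pose e2 := Num.min (Num.min e e1) (Num.min d' (d / 2)).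
  have e20 : 0 < e2 by rewrite !lt_min e0 e10 d'0.
  apply: (ser_eq0 d'0 (pn_row m d'0 bM) e20 _ j) => t _.
  rewrite !le_min => /andP[/andP[te te1] /andP[td' td2]].
  have [g [g1 g2 g3]] := taylor m d0 cM (he1 t te1) td2.
  have z0 : cmod (0 : C) <= d' by rewrite cmod0 ltW.
  have [b1 _] := pev_rows d'0 bM z0 td'.
  have m0 : 0 < Num.min d' (d / 2) by rewrite lt_min d'0.
  have := ser_uniq d'0 b1 d2 g1 m0 _ m; rewrite g2 he//; apply=> x _.
  rewrite le_min => /andP[xd' xd2].
  have [_ H] := pev_rows d'0 bM xd' td'; have H2 := bE x t xd' td'.
  by have H3 := g3 x xd2; rewrite -H -H2 H3.
Qed.

End Tschirnhaus.

(** * One step of the Newton polygon algorithm *)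

Section NewtonStep.
Context {R : realType}.
Local Notation C := (Cx R).
Implicit Types (c : nat * nat -> C) (d M : R).

Lemma ser_poly (P : {poly C}) (x : C) : ser (fun n => P`_n) x = P.[x].
Proof.
have [_ E] := @csum_fin _ _ (fun n => P`_n * x ^+ n) (iota 0 (size P)) (iota_uniq _ _)
  (fun n => ltac:(rewrite mem_iota add0n /= -leqNgt => nP; rewrite nth_default ?mul0r//)).
by rewrite /ser E horner_coef -(big_mkord xpredT (fun i => P`_i * x ^+ i)) /index_iota subn0.
Qed.

Lemma cv1_poly (P : {poly C}) d : 0 <= d -> exists M, cv1 d (fun n => P`_n) M.
Proof.
move=> d0; have [H _] := @csum_fin _ _ (fun n => P`_n * (d%:C%C : C) ^+ n) (iota 0 (size P)) (iota_uniq _ _)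
  (fun n => ltac:(rewrite mem_iota add0n /= -leqNgt => nP; rewrite nth_default ?mul0r//)).
eexists; move: H; congr sumle; apply/funext => n.
by rewrite cmodM cmodX cmod_real ger0_norm.
Qed.

(* A vertex (i, j) of the Newton polygon minimising the slope j / (m - i) among i < m. *)
Lemma newton_slope c m : (exists i j, (i < m)%N /\ c (i, j) != 0) ->
  (forall i, (i < m)%N -> c (i, 0%N) = 0) ->
  exists i p, [/\ (i < m)%N, (0 < p)%N, c (i, p) != 0 &
    forall k, c k != 0 -> (p * m <= p * k.1 + (m - i) * k.2)%N].
Proof.
move=> [i0 [j0 [im0 c0]]] cm.
(* Here n is m! times the slope: clearing denominators turns the minimum into one over natural
   numbers. *)
pose Q n := `[< exists i j, [/\ (i < m)%N, c (i, j) != 0 & n = (j * (m`! %/ (m - i)))%N] >].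
have exQ : exists n, Q n by eexists; apply/asboolP; exists i0, j0.
case: (ex_minnP exQ) => n /asboolP[i [p [im cip nE]]] nmin.
exists i, p; split=> //.
  by rewrite lt0n; apply: contraNneq cip => ->; rewrite cm.
move=> [i' j'] ci' /=; have [mi'|i'm] := leqP m i'.
  by rewrite (leq_trans _ (leq_addr _ _))// leq_mul2l mi' orbT.
have := nmin _ (asboolT (ex_intro _ i' (ex_intro _ j' (And3 i'm ci' erefl)))).
have dv l : (l < m)%N -> (m`! %/ (m - l) * (m - l) = m`!)%N.
  move=> lm; rewrite divnK// dvdn_fact// subn_gt0 lm leq_subr//.
rewrite nE => H.
have {}H : (p * (m - i') <= j' * (m - i))%N.
  have f0 : (0 < m`!)%N by exact: fact_gt0.
  rewrite -(leq_pmul2r f0).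
  have -> : (p * (m - i') * m`! = p * (m`! %/ (m - i)) * ((m - i) * (m - i')))%N.
    by rewrite -{1}(dv i im); lia.
  have -> : (j' * (m - i) * m`! = j' * (m`! %/ (m - i')) * ((m - i) * (m - i')))%N.
    by rewrite -{1}(dv i' i'm); lia.
  by rewrite leq_mul2r H orbT.
have : (p * (m - i') + p * i' = p * m)%N by rewrite -mulnDr subnK// ltnW.
lia.
Qed.

(** A root of full multiplicity m would give P = q (X - z)^m, whose X^(m-1) coefficient -m q z
    vanishes only for z = 0; then P = q X^m, against the nonzero lower coefficient. This drop of
    multiplicity is what makes the induction in [one_root] work. *)
Lemma root_mult_lt (P : {poly C}) m : size P = m.+1 -> (0 < m)%N -> P`_m.-1 = 0 ->
  (exists2 i, (i < m)%N & P`_i != 0) ->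
  exists (z : C) k (Q : {poly C}), [/\ P = Q * ('X - z%:P) ^+ k, Q.[z] != 0,
     (0 < k)%N & (k < m)%N].
Proof.
move=> sP m0 Pm [i im Pi].
have P0 : P != 0 by rewrite -size_poly_eq0 sP.
have [z rz] : exists z, root P z by apply/closed_rootP; rewrite sP eqSS -lt0n.
have [k [Q /implyP/(_ P0) rQ PE]] := multiplicity_XsubC P z.
exists z, k, Q; split=> //.
  rewrite lt0n; apply/eqP => k0; move: rz.
  by rewrite PE k0 expr0 mulr1 (negPf rQ).
have Q0 : Q != 0 by apply: contraNneq P0 => Q0; rewrite PE Q0 mul0r.
have sE : (size P = size Q + k)%N.
  by rewrite PE size_Mmonic ?monic_exp ?monicXsubC// size_exp_XsubC addnS.
have sQ : (0 < size Q)%N by rewrite lt0n size_poly_eq0.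
rewrite ltn_neqAle; apply/andP; split; last by lia.
apply/eqP => km; have sQ1 : size Q = 1%N by lia.
have [q q0 Qq] : exists2 q, q != 0 & Q = q%:P by apply/size_poly1P; rewrite sQ1.
have z0 : z = 0.
  move: Pm; rewrite PE Qq km mul_polyC coefZ.
  have E1 n : ('X - z%:P) ^+ n = \prod_(w <- nseq n z) ('X - w%:P) :> {poly C}.
    by elim: n => [|n IH]; rewrite ?big_nil //= big_cons -IH exprS.
  have E2 n : \sum_(w <- nseq n z) w = z *+ n.
    by elim: n => [|n IH]; rewrite ?big_nil //= big_cons IH mulrS.
  rewrite E1; have := @coefPn_prod_XsubC _ (nseq m z); rewrite size_nseq => ->; last by rewrite -lt0n.
  move=> /eqP; rewrite mulf_eq0 (negPf q0) /= oppr_eq0 E2.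
  by rewrite mulrn_eq0 eqn0Ngt m0 => /eqP.
move: Pi; rewrite PE Qq z0 km subr0 mul_polyC coefZ coefXn ltn_eqF// mulr0.
by rewrite eqxx.
Qed.

(** The substitution follows an edge of the Newton polygon, with [z] a root of the edge polynomial.
    The quotient by t^(p m) restricts at t = 0 to that polynomial translated by z, so its order is
    the multiplicity of z, less than m by [root_mult_lt]. *)
Lemma newton_step d c M m : 0 < d -> pn d c M -> (0 < m)%N -> has_order c m ->
  (forall j, c (m.-1, j) = 0) -> (exists i j, (i < m)%N /\ c (i, j) != 0) ->
  exists (z : C) (p q k : nat) b e M', [/\ (0 < p)%N, (0 < q)%N, (0 < k < m)%N &
    [/\ 0 < e, pn e b M', has_order b k &
     near2 (fun x t => pev c (t ^+ p * (z + x)) (t ^+ q) = t ^+ (p * m) * pev b x t)]].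
Proof.
move=> d0 cM m0 [c0 cm] cm1 exc.
have [i0 [p [im p0 ci0 slope]]] := newton_slope exc c0.
pose q := (m - i0)%N; have q0 : (0 < q)%N by rewrite subn_gt0.
(* The power of t left after division by t^(p m); [slope] makes the subtraction exact on the support
   of [c]. *)
pose ex (k : nat * nat) := (p * k.1 + q * k.2 - p * m)%N.
(* A point (i, j) lies on the edge exactly when q j = p (m - i), whence the divisibility test. *)
pose Pc i := if (q %| p * (m - i))%N then c (i, (p * (m - i)) %/ q)%N else 0.
pose P : {poly C} := \poly_(i < m.+1) Pc i.
have Pm : P`_m != 0.
  by rewrite coef_poly ltnSn /Pc subnn muln0 dvdn0 div0n.
have sP : size P = m.+1.
  apply/eqP; rewrite eqn_leq size_poly ltnNge /=; apply: contra Pm => h.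
  by rewrite nth_default.
have Pm1 : P`_m.-1 = 0.
  by rewrite coef_poly; case: ifP => // _; rewrite /Pc; case: ifP.
have Pi0 : exists2 i, (i < m)%N & P`_i != 0.
  exists i0 => //; rewrite coef_poly ltnS (ltnW im) /Pc -/q dvdn_mull// mulnK//.
have [z [k [Q [PE Qz k0 km]]]] := root_mult_lt sP m0 Pm1 Pi0.
(* With e <= 1 and e (|z| + 1) <= d both substituted arguments stay within radius [d]. *)
pose e := Num.min 1 (d / (cmod z + 1)).
have z1 : 0 < cmod z + 1 by have := cmod_ge0 z; lra.
have e0 : 0 < e by rewrite lt_min ltr01 divr_gt0.
have e1 : e <= 1 by rewrite ge_min lexx.
have ed : e * (cmod z + 1) <= d.
  by rewrite -ler_pdivlMr// ge_min lexx orbT.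
have ep n : (0 < n)%N -> e ^+ n <= e.
  by move=> n0; rewrite -[leRHS]expr1; apply: ler_wiXn2l => //; exact: ltW.
have eqd : e ^+ q <= d.
  by apply: le_trans (ep q q0) _; have := cmod_ge0 z; nra.
have epd : e ^+ p * (cmod z + e) <= d.
  apply: le_trans ed; apply: ler_pM; [|exact: addr_ge0 (ltW e0)|exact: ep|by rewrite lerD2l].
  by rewrite exprn_ge0// ltW.
clearbody e.
pose G x t := csum (fun k => c k * ((z + x) ^+ k.1 * t ^+ ex k)).
have em : 0 < e ^+ (p * m) by rewrite exprn_gt0.
have GA : an e ((e ^+ (p * m))^-1 * M) G.
  apply: (@an_sum _ _ e (fun k x t => c k * ((z + x) ^+ k.1 * t ^+ ex k))
    (fun k => cmod (c k) * ((cmod z + e) ^+ k.1 * e ^+ ex k))) => //.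
    move=> k'; apply: an_scale; apply: an_mul => //.
      by apply: an_exp => //; apply: an_add (an_const _ _) (an_X _); exact: ltW.
    by apply: an_exp => //; apply: an_T; exact: ltW.
  have im0 : 0 <= (e ^+ (p * m))^-1 by rewrite invr_ge0 ltW.
  apply: sumle_dom (sumleZ im0 cM) _ => k'.
  rewrite !mulr_ge0 ?exprn_ge0 ?addr_ge0 ?(ltW e0)//=.
  have [->|ck] := eqVneq (c k') 0; first by rewrite cmod0 !mul0r mulr0.
  rewrite [leRHS]mulrCA ler_wpM2l// ler_pdivlMl// mulrCA -exprD.
  rewrite subnKC; last exact: slope.
  rewrite exprD !exprM mulrA -exprMn exprD [(cmod z + e) * _]mulrC.
  by apply: ler_pM; rewrite ?exprn_ge0 ?mulr_ge0 ?exprn_ge0 ?addr_ge0 ?(ltW e0)//;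
    rewrite lerXn2r ?nnegrE ?mulr_ge0 ?exprn_ge0 ?addr_ge0 ?(ltW e0) ?(ltW d0).
have [b bM bE] := GA.
have GE : near2 (fun x t => pev c (t ^+ p * (z + x)) (t ^+ q) = t ^+ (p * m) * G x t).
  exists e => // x t xe te.
  have te' n : cmod (t ^+ n) <= e ^+ n by rewrite cmodX lerXn2r ?nnegrE ?(ltW e0).
  have [b' _ _] := GA.
  have Gs : asum (fun k => c k * ((z + x) ^+ k.1 * t ^+ ex k)) ((e ^+ (p * m))^-1 * M).
    have im0 : 0 <= (e ^+ (p * m))^-1 by rewrite invr_ge0 ltW.
    apply: asum_dom (sumleZ im0 cM) _ => k'.
    have [->|ck] := eqVneq (c k') 0; first by rewrite mul0r cmod0 !mul0r mulr0.
    rewrite cmodM cmodM [leRHS]mulrCA ler_wpM2l// ler_pdivlMl//.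
    apply: (@le_trans _ _ (e ^+ (p * m) * ((cmod z + e) ^+ k'.1 * e ^+ ex k'))).
      rewrite ler_wpM2l ?(ltW em)//; apply: ler_pM => //.
      rewrite cmodX lerXn2r ?nnegrE ?addr_ge0 ?(ltW e0)//.
      by apply: le_trans (cmodD _ _) _; rewrite lerD2l.
    rewrite mulrCA -exprD subnKC; last exact: slope.
    rewrite exprD !exprM mulrA -exprMn exprD [(cmod z + e) * _]mulrC.
    by apply: ler_pM; rewrite ?exprn_ge0 ?mulr_ge0 ?exprn_ge0 ?addr_ge0 ?(ltW e0)//;
      rewrite lerXn2r ?nnegrE ?mulr_ge0 ?exprn_ge0 ?addr_ge0 ?(ltW e0) ?(ltW d0).
  rewrite /G -(csumZ _ Gs); apply: eq_csum => k'.
  have [->|ck] := eqVneq (c k') 0; first by rewrite !mul0r mulr0.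
  rewrite [RHS]mulrCA; congr (_ * _); rewrite [RHS]mulrCA -exprD subnKC; last exact: slope.
  by rewrite /mon exprMn exprD -!exprM; ring.
(* At t = 0 only the monomials with [ex k = 0] survive, that is, the points on the edge. *)
have G0 x : G x 0 = P.[z + x].
  pose s := [seq (i, ((p * (m - i)) %/ q)%N) | i <- iota 0 m.+1].
  have us : uniq s by rewrite map_inj_uniq ?iota_uniq// => ? ? [].
  pose g k := c k * ((z + x) ^+ k.1 * 0 ^+ ex k).
  have gs k' : k' \notin s -> g k' = 0.
    move=> ks; rewrite /g; have [->|ck] := eqVneq (c k') 0; first by rewrite mul0r.
    rewrite expr0n; case: eqP => [ex0|]; last by rewrite !mulr0.
    case/negP: ks; apply/mapP; have sl := slope _ ck.
    have eq' : (p * k'.1 + q * k'.2 = p * m)%N.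
      by apply/eqP; rewrite eqn_leq sl andbT -subn_eq0 -/(ex k') ex0.
    have k1m : (k'.1 <= m)%N by rewrite -(leq_pmul2l p0) -eq' leq_addr.
    exists k'.1; first by rewrite mem_iota add0n ltnS.
    rewrite mulnBr -eq' addnC addnK mulKn//; exact: surjective_pairing.
  have [_ E] := csum_fin us gs.
  rewrite -[LHS]/(csum g) E big_map (_ : P.[z + x] = \sum_(i < m.+1) P`_i * (z + x) ^+ i); last first.
    by rewrite horner_coef sP.
  rewrite -(big_mkord xpredT (fun i => P`_i * (z + x) ^+ i)) /index_iota subn0.
  rewrite big_seq [RHS]big_seq; apply: eq_bigr => i; rewrite mem_iota add0n /= => im1.
  rewrite /g coef_poly im1 /Pc /= /ex /=.
  case: ifP => [dv|ndv].
    rewrite [(q * _)%N]mulnC divnK// -mulnDr subnKC// subnn expr0 mulr1//.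
  rewrite mul0r expr0n; case: eqP => h; last by rewrite !mulr0.
  have [->|ck] := eqVneq (c (i, (p * (m - i)) %/ q)%N) 0; first by rewrite mul0r.
  have sl := slope _ ck; rewrite /= -/q in sl.
  case/negP: ndv; apply/dvdnP; exists ((p * (m - i)) %/ q)%N.
  move: sl h; generalize ((p * (m - i)) %/ q)%N => J sl h.
  have e' : (p * i + q * J = p * m)%N.
    by apply/eqP; rewrite eqn_leq sl andbT -subn_eq0 h.
  by rewrite mulnBr -e' addnC addnK mulnC.
pose S := P \Po ('X + z%:P).
have SE x : S.[x] = P.[z + x] by rewrite horner_comp !hornerE addrC.
have [MS cS] := cv1_poly S ler01.
have bS i : b (i, 0%N) = S`_i.
  have b1 : cv1 e (fun i => b (i, 0%N)) ((e ^+ (p * m))^-1 * M).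
    have z0 : cmod (0 : C) <= e by rewrite cmod0 ltW.
    have [h1 _] := pev_rows e0 bM z0 z0; move: h1; congr sumle.
    by apply/funext => i'; rewrite ser0.
  apply: (ser_uniq e0 b1 ltr01 cS e0 _ i) => x _ xe.
  have z0 : cmod (0 : C) <= e by rewrite cmod0 ltW.
  have H1 := pev_x0 e0 bM xe; have H2 := bE x 0 xe z0.
  by rewrite ser_poly SE -G0 H2 H1.
have SQ : S = 'X^k * (Q \Po ('X + z%:P)).
  rewrite /S PE comp_polyM rmorphXn /= comp_polyB comp_polyX comp_polyC addrK.
  by rewrite mulrC.
exists z, p, q, k, b, e, ((e ^+ (p * m))^-1 * M); split=> //; first by rewrite k0.
split=> //.
- split=> [i ik|]; first by rewrite bS SQ coefXnM ik.
  by rewrite bS SQ coefXnM ltnn subnn -horner_coef0 horner_comp !hornerE.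
- have [e2 e20 He] := GE; exists (Num.min e e2); first by rewrite lt_min e0.
  move=> x t; rewrite !le_min => /andP[xe xe2] /andP[te te2].
  by have H1 := He x t xe2 te2; have H2 := bE x t xe te; rewrite H1 H2.
Qed.

End NewtonStep.

(** * Existence of roots and complete factorization *)

Section Factor.
Context {R : realType}.
Local Notation C := (Cx R).
Implicit Types (c : nat * nat -> C) (d M : R).

Lemma pn_x0 d c M : 0 < d -> pn d c M -> cv1 d (fun i => c (i, 0%N)) M.
Proof.
move=> d0 cM; have z0 : cmod (0 : C) <= d by rewrite cmod0 ltW.
have [h1 _] := pev_rows d0 cM z0 z0; move: h1; congr sumle.
by apply/funext => i; rewrite ser0.
Qed.

Lemma pev_x0_uniq d c M d' b M' e : 0 < d -> pn d c M -> 0 < d' -> pn d' b M' ->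
  0 < e -> (forall x, cmod x <= e -> pev b x 0 = pev c x 0) ->
  forall i, b (i, 0%N) = c (i, 0%N).
Proof.
move=> d0 cM d'0 bM e0 bc i.
have m0 : 0 < Num.min e (Num.min d d') by rewrite !lt_min e0 d0.
apply: (ser_uniq d'0 (pn_x0 d'0 bM) d0 (pn_x0 d0 cM) m0 _ i) => x _.
rewrite !le_min => /and3P[xe xd xd'].
have H1 := pev_x0 d'0 bM xd'; have H2 := pev_x0 d0 cM xd.
exact: (etrans (esym H1) (etrans (bc x xe) H2)).
Qed.

(** Strong induction on the order. After the Tschirnhaus shift, either no monomial of x-degree below
    the order is left and the shift itself is a root, or a Newton step strictly lowers the order and
    multiplies the ramification by its [q]. *)
Lemma one_root m d c M : (0 < m)%N -> 0 < d -> pn d c M -> has_order c m ->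
  exists N (h : C -> C), [/\ (0 < N)%N, ang (fun _ t => h t), h 0 = 0 &
    near1 (fun t => pev c (h t) (t ^+ N) = 0)].
Proof.
elim/ltn_ind: m d c M => -[//|m] IH d c M _ d0 cM co.
have [h0 [b [d' d'0 [M' [[h0A h00] bM bo bm bN]]]]] := tschirnhaus d0 cM co.
have [exb|nexb] := pselect (exists i j, (i < m.+1)%N /\ b (i, j) != 0); last first.
  exists 1%N, h0; split=> //.
  have z0 : near1 (fun t : C => cmod t <= d') by exists d'.
  have [e e0 He] := bN; have z1 : near1 (fun t : C => cmod t <= e) by exists e.
  apply: near1_imp (near1_and z0 z1) => t [td te].
  have E0 : cmod (0 : C) <= e by rewrite cmod0 ltW.
  have := He 0 t E0 te; rewrite add0r expr1 => ->.
  rewrite (pev_0t d'0 bM td) /ser -[RHS](@csum0 R nat); apply: eq_csum => j.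
  have [->|bj] := eqVneq (b (0%N, j)) 0; first by rewrite mul0r.
  by case: nexb; exists 0%N, j.
have [z [p [q [k [b2 [e [M2 [p0 q0 /andP[k0 km] [e0 b2M b2o b2N]]]]]]]]] :=
  newton_step d'0 bM (ltn0Sn m) bo bm exb.
have [N [h [N0 hA hz hN]]] := IH k km e b2 M2 k0 e0 b2M b2o.
have TA n : ang (fun _ (t : C) => t ^+ n) by exact: ang_Tn.
have T0 n : (0 < n)%N -> (0 : C) ^+ n = 0 by case: n => // n _; rewrite expr0n.
pose g (s : C) := (s ^+ N) ^+ p * (z + h s).
have gA : ang (fun _ s => g s).
  apply: ang_mul; first exact: ang_exp.
  exact: (ang_add (ang_const z) hA).
have g0 : g 0 = 0 by rewrite /g !T0 ?mul0r.
have h0qA : ang (fun _ (s : C) => h0 ((s ^+ N) ^+ q)).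
  by apply: (ang_comp1 h0A); [exact: ang_exp|rewrite !T0].
exists (N * q)%N, (fun s => g s + h0 ((s ^+ N) ^+ q)); split.
- by rewrite muln_gt0 N0.
- exact: ang_add gA h0qA.
- by rewrite g0 !T0// h00 addr0.
have H1 := near2_comp1 b2N hA (TA N) hz (T0 N N0).
have H2 : near1 (fun s : C => pev c (g s + h0 ((s ^+ N) ^+ q)) ((s ^+ N) ^+ q) =
    pev b (g s) ((s ^+ N) ^+ q)).
  apply: (near2_comp1 bN gA) => //; first exact: ang_exp.
  by rewrite !T0.
apply: near1_imp (near1_and hN (near1_and H1 H2)) => s [E0 [E1 E2]].
by rewrite exprM E2 E1 E0 mulr0.
Qed.

Lemma pn_tail d c M : 0 < d -> pn d c M ->
  pn d (fun k : nat * nat => c (k.1.+1, k.2)) (d^-1 * M).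
Proof.
move=> d0 cM.
have H : sumle (fun k : nat * nat => cmod (c (k.1.+1, k.2)%N) * d ^+ (k.1.+1 + k.2)) M.
  apply: sumle_ub => [k|s us]; first by rewrite mulr_ge0// exprn_ge0// ltW.
  have := @sumle_fin _ _ _ _ (map (fun k : nat * nat => (k.1.+1, k.2)) s) cM.
  rewrite map_inj_uniq ?big_map; first by apply.
  by move=> [i j] [i' j'] [-> ->].
have K0 : 0 <= d^-1 by rewrite invr_ge0 ltW.
apply: sumle_dom (sumleZ K0 H) _ => -[i j] /=.
rewrite mulr_ge0 ?exprn_ge0 ?(ltW d0)//= mulrCA addSn exprS mulKf//.
exact: lt0r_neq0.
Qed.

Lemma pev_tail d c M x t : 0 < d -> pn d c M -> cmod x <= d -> cmod t <= d ->
  (forall j, c (0%N, j) = 0) ->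
  pev c x t = x * pev (fun k : nat * nat => c (k.1.+1, k.2)) x t.
Proof.
move=> d0 cM xd td c0.
have [H1 ->] := pev_rows d0 cM xd td.
have [_ ->] := pev_rows d0 (pn_tail d0 cM) xd td.
rewrite (ser_shift (k := 1) d0 H1 xd).
  by rewrite expr1; congr (_ * _); apply: eq_csum => i; rewrite addn1.
case=> // _; rewrite /ser -[RHS](@csum0 R nat); apply: eq_csum => j.
by rewrite c0 mul0r.
Qed.

(** Move a root to x = 0, divide by x, move back, and repeat. The later stages ramify further, so
    the root found first is reparametrized by [t ^+ N']. What remains at order 0 is the unit. *)
Lemma NP_factor m d c M : 0 < d -> pn d c M -> has_order c m ->
  exists N (z : nat -> C -> C) (u : C -> C -> C),
    [/\ (0 < N)%N, forall k, ang (fun _ t => z k t) /\ z k 0 = 0,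
      ang u, u 0 0 != 0 &
      near2 (fun x t => pev c x (t ^+ N) = u x t * \prod_(k < m) (x - z k t))].
Proof.
elim: m d c M => [|m IH] d c M d0 cM co.
  exists 1%N, (fun _ _ => 0), (pev c); split=> //.
  - by move=> k; split=> //; exact: ang_const.
  - exact: ang_pev d0 cM.
  - by rewrite pev00; case: co.
  - by exists 1 => // x t _ _; rewrite big_ord0 mulr1 expr1.
have [N [h [N0 hA h0 hN]]] := one_root (ltn0Sn m) d0 cM co.
have T0 n : (0 < n)%N -> (0 : C) ^+ n = 0 by case: n => // n _; rewrite expr0n.
have FA : ang (fun x t => pev c (x + h t) (t ^+ N)).
  apply: (@ang_comp _ (pev c) (fun x t => x + h t) (fun x t => t ^+ N)).
  - exact: ang_pev d0 cM.
  - exact: (ang_add ang_X hA).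
  - exact: ang_Tn.
  - by rewrite add0r.
  - exact: T0.
have [b [d1 [M1 [d10 bM bE]]]] := ang_coef FA.
have z0 : cmod (0 : C) <= d1 by rewrite cmod0 ltW.
have b0 j : b (0%N, j) = 0.
  have [e e0 he] := hN.
  have m0 : 0 < Num.min e d1 by rewrite lt_min e0.
  have br := pn_row 0 d10 bM.
  apply: (ser_eq0 d10 br m0 _ j) => t _; rewrite le_min => /andP[te td].
  rewrite -(he t te); have := bE 0 t z0 td; rewrite add0r => ->.
  exact/esym/(pev_0t d10 bM td).
have bc := pev_x0_uniq d0 cM d10 bM d10.
have {}bc i : b (i, 0%N) = c (i, 0%N).
  apply: bc => x xd; have := bE x 0 xd z0.
  by rewrite h0 addr0 T0.
pose b' (k : nat * nat) := b (k.1.+1, k.2).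
have b'M : pn d1 b' (d1^-1 * M1) := pn_tail d10 bM.
have GA : ang (fun x t => pev b' (x - h t) t).
  apply: (@ang_comp _ (pev b') (fun x t => x - h t) (fun x t => t)).
  - exact: (ang_pev d10 b'M).
  - exact: (ang_sub ang_X hA).
  - exact: ang_T.
  - by rewrite h0 subrr.
  - by [].
have [c2 [d2 [M2 [d20 c2M c2E]]]] := ang_coef GA.
have c2b i : c2 (i, 0%N) = b (i.+1, 0%N).
  apply: (pev_x0_uniq d10 b'M d20 c2M d20 _ i) => x xd.
  have zd : cmod (0 : C) <= d2 by rewrite cmod0 ltW.
  by have := c2E x 0 xd zd; rewrite h0 subr0 => H; exact: esym H.
have c2o : has_order c2 m.
  by case: co => co1 co2; split=> [i im|]; rewrite c2b bc// co1.
have [N' [z [u [N'0 zP uA u0 uE]]]] := IH d2 c2 M2 d20 c2M c2o.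
pose z' k := if k is k'.+1 then z k' else fun t => h (t ^+ N').
have z'P k : ang (fun _ t => z' k t) /\ z' k 0 = 0.
  case: k => [|k] /=; last exact: zP.
  by rewrite T0// h0; split=> //; apply: (ang_comp1 hA) => //; [exact: ang_Tn|exact: T0].
exists (N' * N)%N, z', u; split=> //; first by rewrite muln_gt0 N'0.
have KEY : near2 (fun x t => pev c x (t ^+ N) = (x - h t) * pev c2 x t).
  have xhA : ang (fun x t => x - h t) := ang_sub ang_X hA.
  have xh0 : (0 : C) - h 0 = 0 by rewrite h0 subrr.
  have B1 : near2 (fun x t : C => cmod x <= d1 /\ cmod t <= d1) by exists d1.
  have B2 : near2 (fun x t : C => cmod x <= d2 /\ cmod t <= d2) by exists d2.
  have := near2_and (near2_comp B1 xhA (@ang_T R) xh0 erefl) B2.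
  apply: near2_imp => x t [[xd1 td1] [xd2 td2]].
  have := bE _ _ xd1 td1; rewrite subrK => ->.
  by rewrite (pev_tail d10 bM xd1 td1 b0) c2E.
have := near2_and (near2_comp KEY (@ang_X R) (ang_Tn N') erefl (T0 _ N'0)) uE.
apply: near2_imp => x t [E1 E2].
by rewrite exprM E1 E2 big_ord_recl /= mulrCA.
Qed.

End Factor.

(** * Derivatives *)

Section Qd.
Context {R : realType}.
Local Notation C := (Cx R).
Implicit Types (h g : C -> C) (x L : C) (M : R).

(** A derivative with quadratic error: the sum, product and chain rules become direct estimates,
    power series satisfy it by inspection, and [qd_derive1] leads back to [derive1]. *)
Definition qd h x L := exists2 M, 0 <= M & exists2 e : R, 0 < e &
  forall y, cmod (y - x) <= e -> cmod (h y - h x - (y - x) * L) <= M * cmod (y - x) ^+ 2.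

Lemma qd_ext h g x L : (exists2 e : R, 0 < e & forall y, cmod (y - x) <= e -> h y = g y) ->
  qd h x L -> qd g x L.
Proof.
move=> [e' e'0 hg] [M M0 [e e0 H]]; exists M => //; exists (Num.min e e'); first by rewrite lt_min e0.
move=> y; rewrite le_min => /andP[ye ye'].
by rewrite -!hg ?subrr ?cmod0 ?(ltW e'0)//; exact: H.
Qed.

Lemma qd_uniq h x L L' : qd h x L -> qd h x L' -> L = L'.
Proof.
move=> [M M0 [e e0 H]] [M' M'0 [e' e'0 H']].
apply/eqP; rewrite -subr_eq0 -cmod_eq0; apply/eqP/le_anti; rewrite cmod_ge0 andbT leNgt.
apply/negP => LL.
pose s := Num.min (Num.min e e') (cmod (L - L') / (M + M' + 1) / 2).
have s0 : 0 < s by rewrite !lt_min e0 e'0 !divr_gt0//; lra.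
have [y ys y0] := exists_real_cmod s0.
have xy : x + y - x = y by ring.
have se : cmod (x + y - x) <= e by rewrite xy ys !ge_min lexx.
have se' : cmod (x + y - x) <= e' by rewrite xy ys !ge_min lexx ?orbT.
have sL : s <= cmod (L - L') / (M + M' + 1) / 2 by rewrite !ge_min lexx ?orbT.
have := H _ se; have := H' _ se'; rewrite xy ys => h1 h2.
have h3 : s * cmod (L - L') <= (M + M') * s ^+ 2.
  have -> : s * cmod (L - L') = cmod ((h (x + y) - h x - y * L') - (h (x + y) - h x - y * L)).
    by rewrite -ys -cmodM; congr cmod; ring.
  by apply: le_trans (cmodB _ _) _; rewrite mulrDl [leRHS]addrC; apply: lerD.
move: h3; rewrite expr2 mulrCA ler_pM2l// => h3.
have : (M + M') * s <= (M + M') * (cmod (L - L') / (M + M' + 1) / 2).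
  by rewrite ler_wpM2l//; lra.
have -> : (M + M') * (cmod (L - L') / (M + M' + 1) / 2) =
   cmod (L - L') / 2 * ((M + M') / (M + M' + 1)) by field; lra.
have : (M + M') / (M + M' + 1) <= 1 by rewrite ler_pdivrMr ?mul1r; lra.
move: ((M + M') / (M + M' + 1)) => v; nra.
Qed.

Lemma qd_const (z : C) x : qd (fun _ => z) x 0.
Proof.
exists 0 => //; exists 1 => // y _.
by rewrite subrr mulr0 subrr cmod0 mul0r.
Qed.

Lemma qd_id x : qd id x 1.
Proof. by exists 0 => //; exists 1 => // y _; rewrite mulr1 subrr cmod0 mul0r. Qed.

Lemma qd_add h g x L L' : qd h x L -> qd g x L' -> qd (fun y => h y + g y) x (L + L').
Proof.
move=> [M M0 [e e0 H]] [M' M'0 [e' e'0 H']].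
exists (M + M'); first exact: addr_ge0.
exists (Num.min e e'); first by rewrite lt_min e0.
move=> y; rewrite le_min => /andP[ye ye'].
have -> : h y + g y - (h x + g x) - (y - x) * (L + L') =
  (h y - h x - (y - x) * L) + (g y - g x - (y - x) * L') by ring.
by apply: le_trans (cmodD _ _) _; rewrite [leRHS]mulrDl; apply: lerD; [exact: H|exact: H'].
Qed.

Lemma qd_opp h x L : qd h x L -> qd (fun y => - h y) x (- L).
Proof.
move=> [M M0 [e e0 H]]; exists M => //; exists e => // y ye.
by rewrite -cmodN (_ : - _ = h y - h x - (y - x) * L) ?H//; ring.
Qed.

Lemma qd_lip h x L : qd h x L -> exists2 K : R, 0 <= K & exists2 e : R, 0 < e &
  forall y, cmod (y - x) <= e -> cmod (h y - h x) <= K * cmod (y - x).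
Proof.
move=> [M M0 [e e0 H]]; exists (M + cmod L); first exact: addr_ge0.
exists (Num.min e 1); first by rewrite lt_min e0 ltr01.
move=> y; rewrite le_min => /andP[ye y1].
have -> : h y - h x = (h y - h x - (y - x) * L) + (y - x) * L by ring.
apply: le_trans (cmodD _ _) _; rewrite [leRHS]mulrDl cmodM [cmod L * _]mulrC lerD2r.
apply: le_trans (H y ye) _; rewrite expr2 ler_wpM2l// ler_piMr//.
Qed.

Lemma qd_mul h g x L L' : qd h x L -> qd g x L' ->
  qd (fun y => h y * g y) x (h x * L' + L * g x).
Proof.
move=> hL gL; have [K K0 [e1 e10 H1]] := qd_lip hL.
have [K' K'0 [e2 e20 H2]] := qd_lip gL.
case: hL gL => [M M0 [e e0 H]] [M' M'0 [e' e'0 H']].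
exists (K * K' + cmod (h x) * M' + M * cmod (g x)).
  by rewrite !addr_ge0 ?mulr_ge0.
exists (Num.min (Num.min e e') (Num.min e1 e2)); first by rewrite !lt_min e0 e'0 e10.
move=> y; rewrite !le_min => /andP[/andP[ye ye'] /andP[y1 y2]].
have -> : h y * g y - h x * g x - (y - x) * (h x * L' + L * g x) =
  (h y - h x) * (g y - g x) + h x * (g y - g x - (y - x) * L') +
  (h y - h x - (y - x) * L) * g x by ring.
apply: le_trans (cmodD _ _) _; apply: le_trans (lerD (cmodD _ _) (lexx _)) _.
rewrite !cmodM [leRHS]mulrDl; apply: lerD; first (rewrite [leRHS]mulrDl; apply: lerD).
- have -> : K * K' * cmod (y - x) ^+ 2 = K * cmod (y - x) * (K' * cmod (y - x)) by ring.
  by apply: ler_pM => //; [exact: H1|exact: H2].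
- by rewrite -mulrA ler_wpM2l// H'.
- by rewrite mulrAC ler_wpM2r// H.
Qed.

Lemma qd_exp n x : qd (fun y => y ^+ n.+1) x (n.+1%:R * x ^+ n).
Proof.
elim: n => [|n IH].
  rewrite expr0 mulr1; by apply: qd_ext (qd_id x); exists 1.
have := qd_mul (qd_id x) IH.
have -> : id x * (n.+1%:R * x ^+ n) + 1 * x ^+ n.+1 = n.+2%:R * x ^+ n.+1.
  by rewrite -(natr1 n.+1) exprS; ring.
by apply: qd_ext; exists 1 => // y _; rewrite [RHS]exprS.
Qed.

Lemma qd_comp h g x L L' : qd g x L -> qd h (g x) L' -> qd (fun y => h (g y)) x (L * L').
Proof.
move=> gL; have [K K0 [e1 e10 H1]] := qd_lip gL.
case: gL => [M M0 [e e0 H]] [M' M'0 [e' e'0 H']].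
exists (M' * K ^+ 2 + M * cmod L'); first by rewrite addr_ge0 ?mulr_ge0 ?exprn_ge0.
exists (Num.min (Num.min e e1) (e' / (K + 1))).
  by rewrite !lt_min e0 e10 divr_gt0//; lra.
move=> y; rewrite !le_min => /andP[/andP[ye y1] y2].
have ge : cmod (g y - g x) <= e'.
  apply: le_trans (H1 y y1) _; move: y2; rewrite ler_pdivlMr; last lra.
  by apply: le_trans; rewrite mulrC ler_wpM2l//; lra.
have -> : h (g y) - h (g x) - (y - x) * (L * L') =
  (h (g y) - h (g x) - (g y - g x) * L') + (g y - g x - (y - x) * L) * L' by ring.
apply: le_trans (cmodD _ _) _; rewrite [leRHS]mulrDl; apply: lerD.
  apply: le_trans (H' _ ge) _; rewrite -mulrA ler_wpM2l// -exprMn lerXn2r ?nnegrE ?mulr_ge0//.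
  exact: H1.
by rewrite cmodM mulrAC ler_wpM2r// H.
Qed.

Lemma qd_prod_log n (h : nat -> C -> C) (L : nat -> C) x :
  (forall k, (k < n)%N -> qd (h k) x (L k) /\ h k x != 0) ->
  qd (fun y => \prod_(k < n) h k y) x ((\prod_(k < n) h k x) * \sum_(k < n) L k / h k x).
Proof.
elim: n => [|n IH] H.
  rewrite !big_ord0 mulr0; apply: qd_ext (qd_const 1 x); exists 1 => // y _.
  by rewrite big_ord0.
have [Hn hn] := H n (ltnSn n).
have {}IH := IH (fun k kn => H k (ltnW kn)).
have := qd_mul IH Hn.
rewrite !big_ord_recr /=.
set P := \prod_(i < n) _; set S := \sum_(i < n) _.
have -> : P * L n + P * S * h n x = P * h n x * (S + L n / h n x) by field.
by apply: qd_ext; exists 1 => // y _; rewrite big_ord_recr.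
Qed.

Lemma ser_quad (c : nat -> C) d M t : 0 < d -> cv1 d c M -> cmod t <= d ->
  cmod (ser c t - c 0%N - t * c 1%N) <= M / d ^+ 2 * cmod t ^+ 2.
Proof.
move=> d0 cM td.
have E : ser c t = c 0%N + t * ser (fun n => c (n + 1)%N) t.
  rewrite {1}/ser (csum_split 1 (cv1_asum cM td)) big_ord1 mulr1; congr (_ + _).
  rewrite -(csumZ t (cv1_asum (cv1_shift 1 d0 cM) td)); apply: eq_csum => n.
  by rewrite addn1 exprS mulrCA.
have -> : ser c t - c 0%N - t * c 1%N = t * (ser (fun n => c (n + 1)%N) t - c (0 + 1)%N).
  by rewrite E add0n; ring.
rewrite cmodM; have := ser_cont0 d0 (cv1_shift 1 d0 cM) td.
move=> /(ler_wpM2l (cmod_ge0 t)) /le_trans; apply.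
by rewrite expr1 le_eqVlt; apply/orP; left; apply/eqP; field; rewrite gt_eqF.
Qed.

(** The derivative is the first Taylor coefficient. The remainder constant is uniform in the point
    because all the Taylor series share one norm bound. *)
Lemma ang_quad (F : C -> C -> C) : ang F -> exists (Fx : C -> C -> C) (e M : R),
  [/\ 0 < e, 0 <= M & forall x y t, cmod x <= e -> cmod y <= e -> cmod t <= e ->
   cmod (F y t - F x t - (y - x) * Fx x t) <= M * cmod (y - x) ^+ 2 /\
   cmod (Fx x t) <= M].
Proof.
move=> [d [M d0 [c cM cE]]].
have d2 : 0 < d / 2 by rewrite divr_gt0.
have M0 := sumle_ge0 cM.
pose M' := M / (d / 2) ^+ 2 + M * (2 / d) ^+ 1.
have M1 : 0 <= M / (d / 2) ^+ 2 by rewrite divr_ge0// exprn_ge0// ltW.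
have M2 : 0 <= M * (2 / d) ^+ 1 by rewrite mulr_ge0// exprn_ge0// divr_ge0// ltW.
exists (pev (dcoef 1 c)), (d / 4), M'; split; first by rewrite divr_gt0.
  by rewrite /M' addr_ge0.
move=> x y t xd yd td.
have xd2 : cmod x <= d / 2 by lra.
have yxd : cmod (y - x) <= d / 2 by apply: le_trans (cmodB _ _) _; lra.
have td2 : cmod t <= d / 2 by lra.
have [g [g1 g2 g3]] := taylor 1 d0 cM xd2 td2.
have E1 : F y t = ser g (y - x).
  have H := g3 _ yxd; rewrite subrK in H.
  by rewrite -H; apply: cE; lra.
have E0 : F x t = g 0%N.
  have z2 : cmod (0 : C) <= d / 2 by rewrite cmod0 ltW.
  have H := g3 _ z2; rewrite add0r ser0 in H.
  by rewrite -H; apply: cE; lra.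
split.
  rewrite E1 E0 -g2; apply: le_trans (ser_quad d2 g1 yxd) _.
  by rewrite ler_wpM2r ?exprn_ge0// /M' lerDl.
apply: le_trans (csum_le (pn_asum (dcoef_pn 1 d0 cM) xd2 td2)) _.
by rewrite /M' lerDr.
Qed.

Lemma quad_qd (F : C -> C -> C) (Fx : C -> C -> C) (e M : R) x t : 0 < e -> 0 <= M ->
  (forall x y t, cmod x <= e -> cmod y <= e -> cmod t <= e ->
   cmod (F y t - F x t - (y - x) * Fx x t) <= M * cmod (y - x) ^+ 2 /\
   cmod (Fx x t) <= M) -> cmod x <= e / 2 -> cmod t <= e ->
  qd (fun y => F y t) x (Fx x t).
Proof.
move=> e0 M0 H xe te; exists M => //; exists (e / 2); first by rewrite divr_gt0.
move=> y ye; have [] := H x y t _ _ te => //; first lra.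
have -> : y = (y - x) + x by ring.
apply: le_trans (cmodD _ _) _; lra.
Qed.

Lemma real_of_pos (e : C) : 0 < e -> 0 < cmod e /\ e = (cmod e)%:C%C.
Proof.
move=> e0; rewrite cmod_gt0 gt_eqF//; split=> //.
by rewrite -cmod_norm ger0_norm// ltW.
Qed.

Lemma qd_derive1 h x L : qd h x L -> derive1 h x = L.
Proof.
move=> [M M0 [e e0 H]]; rewrite /derive1; apply: cvg_lim => //.
apply/cvgrPdist_le => eps /real_of_pos[eps0 epsE].
pose s := Num.min e (cmod eps / (M + 1)).
have s0 : 0 < s by rewrite lt_min e0 divr_gt0//; lra.
have sC : 0 < (s%:C%C : C) by rewrite ltcR.
near=> k.
have k0 : k != 0 by near: k; exact: nbhs_dnbhs_neq.
have ks : cmod k <= s.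
  have : `|k| <= (s%:C%C : C).
    near: k; apply: dnbhs0_le; exact: sC.
  by rewrite cmod_norm lecR.
have ke : cmod (k + x - x) <= e by rewrite addrK (le_trans ks)// ge_min lexx.
have km : cmod k <= cmod eps / (M + 1) by rewrite (le_trans ks)// ge_min lexx orbT.
have := H (k + x) ke; rewrite addrK => Hk.
rewrite cmod_norm epsE lecR.
have -> : L - k^-1 *: (h (k + x) - h x) = - (k^-1 * (h (k + x) - h x - k * L)).
  by rewrite /GRing.scale /=; field.
rewrite cmodN cmodM cmodV ler_pdivrMl ?cmod_gt0//.
apply: le_trans Hk _; rewrite expr2 mulrCA ler_wpM2l//.
move: km; rewrite ler_pdivlMr; last lra.
by apply: le_trans; rewrite mulrC ler_wpM2l//; lra.
Unshelve. all: by end_near.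
Qed.

End Qd.

(** * Upper bound for the exponent *)

Section Uniform.
Context {R : realType}.
Local Notation C := (Cx R).
Implicit Types (P Q : R -> C -> C -> Prop) (A : R).

(* A single parameter A both bounds the constants and (by 1/A) the size of the
   neighbourhood of the origin. *)
Definition ucst P := exists2 A0 : R, 1 <= A0 & forall A, A0 <= A ->
  forall x t, cmod x * A <= 1 -> cmod t * A <= 1 -> P A x t.

Lemma ucst_and P Q : ucst P -> ucst Q -> ucst (fun A x t => P A x t /\ Q A x t).
Proof.
move=> [A A1 H] [B B1 H']; exists (Num.max A B); first by rewrite le_max A1.
by move=> A'; rewrite ge_max => /andP[AA BA] x t xA tA; split; [exact: H|exact: H'].
Qed.

Lemma ucst_imp P Q : (forall A x t, P A x t -> Q A x t) -> ucst P -> ucst Q.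
Proof. by move=> PQ [A A1 H]; exists A => // A' AA x t xA tA; exact/PQ/H. Qed.

Lemma ucst_forall n (P : nat -> R -> C -> C -> Prop) :
  (forall k, (k < n)%N -> ucst (P k)) -> ucst (fun A x t => forall k, (k < n)%N -> P k A x t).
Proof.
elim: n => [|n IH] H; first by exists 1.
have := ucst_and (IH (fun k kn => H k (ltnW kn))) (H n (ltnSn n)).
apply: ucst_imp => A x t [H1 H2] k; rewrite ltnS leq_eqVlt => /predU1P[->//|].
exact: H1.
Qed.

(** For constants built from [A]: [phi A] is the enlarged constant, and [Q] is only asked at
    parameters above it, where the neighbourhood is smaller as well. *)
Lemma ucst_trans P Q (phi : R -> R) : ucst P ->
  (forall A, 1 <= A -> forall B, phi A <= B -> A <= B ->
     forall x t, cmod x * B <= 1 -> cmod t * B <= 1 -> P A x t -> Q B x t) -> ucst Q.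
Proof.
move=> [A A1 H] PQ; exists (Num.max A (phi A)); first by rewrite le_max A1.
move=> B; rewrite ge_max => /andP[AB pB] x t xB tB; apply: (PQ A) => //.
by apply: H => //; [apply: le_trans xB|apply: le_trans tB]; rewrite ler_wpM2l.
Qed.

Lemma ucst_near2 (P : C -> C -> Prop) : near2 P -> ucst (fun _ => P).
Proof.
move=> [e e0 H]; exists (Num.max 1 e^-1); first by rewrite le_max lexx.
move=> A; rewrite ge_max => /andP[A1 Ae] x t xA tA.
have sm z : cmod z * A <= 1 -> cmod z <= e.
  move=> zA; rewrite -[leRHS]mul1r -ler_pdivrMr//; apply: le_trans zA.
  by rewrite ler_wpM2l.
apply: H; exact: sm.
Qed.

Lemma ucst_near1 (P : C -> Prop) : near1 P -> ucst (fun _ _ t => P t).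
Proof. by move=> /near1_near2 /ucst_near2. Qed.

Lemma ucst_bound (F : C -> C -> C) : ang F -> ucst (fun A x t => cmod (F x t) <= A).
Proof.
move=> /ang_bound[d d0 [M M0 H]].
have [A A1 HA] := ucst_near2 (ex_intro2 _ _ d d0 H).
exists (Num.max A M); first by rewrite le_max A1.
move=> B; rewrite ge_max => /andP[AB MB] x t xB tB.
by apply: le_trans MB; exact: (HA B).
Qed.

Lemma ucst_lb (F : C -> C -> C) : ang F -> F 0 0 != 0 ->
  ucst (fun A x t => A^-1 <= cmod (F x t)).
Proof.
move=> FA F0; pose c := cmod (F 0 0); have c0 : 0 < c by rewrite cmod_gt0.
have c2 : 0 < c / 2 by rewrite divr_gt0.
have [|A A1 HA] := ucst_near2 (ang_small (ang_sub FA (ang_const (F 0 0))) _ c2).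
  by rewrite subrr.
exists (Num.max A (c / 2)^-1); first by rewrite le_max A1.
move=> B; rewrite ge_max => /andP[AB cB] x t xB tB.
have := HA B AB x t xB tB => H.
have Bc : B^-1 <= c / 2.
  by rewrite invf_ple// posrE; apply: lt_le_trans AB; lra.
apply: le_trans Bc _.
have := cmod_lbB (F 0 0) (F 0 0 - F x t); rewrite subKr -/c.
rewrite cmodC in H; lra.
Qed.

Definition ang_qd (F Fx : C -> C -> C) : Prop :=
  ucst (fun A x t => qd (fun y => F y t) x (Fx x t) /\ cmod (Fx x t) <= A).

Lemma ang_has_qd F : ang F -> exists Fx, ang_qd F Fx.
Proof.
move=> /ang_quad[Fx [e [M [e0 M0 H]]]]; exists Fx.
have e2 : 0 < e / 2 by rewrite divr_gt0.
have H1 : near2 (fun x t => qd (fun y => F y t) x (Fx x t) /\ cmod (Fx x t) <= M).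
  exists (e / 2) => // x t xe te'; have te : cmod t <= e by lra.
  split; first exact: (quad_qd e0 M0 H).
  have xe' : cmod x <= e by lra.
  by have [_ ->] := H x x t xe' xe' te.
have [A A1 HA] := ucst_near2 H1.
exists (Num.max A M); first by rewrite le_max A1.
move=> B; rewrite ge_max => /andP[AB MB] x t xB tB.
have [Q1 Q2] := HA B AB x t xB tB; split=> //; exact: le_trans Q2 MB.
Qed.

(** Otherwise |t|^k / A <= K |t|^N with k < N, which fails as t tends to 0. *)
Lemma order_ge (h v : C -> C) k N (K : R) : ang (fun _ t => v t) -> v 0 != 0 ->
  near1 (fun t => h t = t ^+ k * v t) -> near1 (fun t => cmod (h t) <= K * cmod t ^+ N) ->
  (N <= k)%N.
Proof.
move=> vA v0 [e e0 he] [e' e'0 he']; rewrite leqNgt; apply/negP => kN.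
have [A A1 HA] := ucst_lb vA v0.
have A0 : 0 < A by lra.
have K0 : 0 <= K.
  have [t te t0] := exists_real_cmod e'0.
  have tn : 0 < cmod t ^+ N by rewrite exprn_gt0 ?cmod_gt0.
  rewrite -(pmulr_lge0 _ tn); apply: (le_trans (cmod_ge0 (h t))).
  by apply: he'; rewrite te.
pose s := Num.min (Num.min e e') (Num.min A^-1 (Num.min 1 (A^-1 / (K + 1) / 2))).
have s0 : 0 < s by rewrite !lt_min e0 e'0 ltr01 !divr_gt0 ?invr_gt0//; lra.
have [t ts t0] := exists_real_cmod s0.
have [se [se' [sA [s1 sK]]]] : s <= e /\ s <= e' /\ s <= A^-1 /\ s <= 1 /\ s <= A^-1 / (K + 1) / 2.
  by rewrite !ge_min !lexx ?orbT.
have tA : cmod t * A <= 1 by rewrite ts -ler_pdivlMr// mul1r.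
have z0 : cmod (0 : C) * A <= 1 by rewrite cmod0 mul0r.
have vb := HA A (lexx _) 0 t z0 tA.
have te' : cmod t <= e' by rewrite ts.
have te : cmod t <= e by rewrite ts.
have := he' t te'; rewrite he// cmodM cmodX -(subnKC kN) addSn -addnS exprD.
have tk : 0 < cmod t ^+ k by rewrite exprn_gt0 ?cmod_gt0.
rewrite mulrCA ler_pM2l// exprS ts => H.
have sn : s ^+ (N - k.+1) <= 1 by rewrite exprn_ile1 ?(ltW s0).
have Ai : 0 < A^-1 by rewrite invr_gt0.
have : K * (s * s ^+ (N - k.+1)) <= K * s.
  by rewrite ler_wpM2l// ler_piMr// ltW.
have : K * s <= K * (A^-1 / (K + 1) / 2) by rewrite ler_wpM2l.
have -> : K * (A^-1 / (K + 1) / 2) = A^-1 / 2 * (K / (K + 1)) by field; lra.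
have : K / (K + 1) <= 1 by rewrite ler_pdivrMr ?mul1r; lra.
move: (K / (K + 1)) => w; nra.
Qed.

(** For h = t^k v one has t h' - k h = t^(k+1) v' with v bounded away from 0: t d/dt multiplies h by
    its order up to a relative error O(|t|). This turns logarithmic derivatives of differences of
    roots into contact orders. *)
Lemma order_est (h v dh : C -> C) k : ang (fun _ t => v t) -> v 0 != 0 -> h 0 = 0 ->
  near1 (fun t => h t = t ^+ k * v t) -> ucst (fun _ t _ => qd h t (dh t)) ->
  (0 < k)%N /\
  ucst (fun A _ t => [/\ A^-1 * cmod t ^+ k <= cmod (h t), cmod (h t) <= A * cmod t ^+ k &
    cmod (t * dh t - k%:R * h t) <= A * cmod t * cmod (h t)]).
Proof.
move=> vA v0 h0 hE hq.
have k0 : (0 < k)%N.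
  rewrite lt0n; apply/eqP => k0; have [e e0 he] := hE.
  have := he 0; rewrite cmod0 h0 k0 expr0 mul1r => /(_ (ltW e0)) E.
  by rewrite -E eqxx in v0.
split=> //.
have [dv vq] := ang_has_qd (ang_swap1 vA).
have hE2 := hE; case: hE2 => e e0 he.
have e2 : 0 < e / 2 by rewrite divr_gt0.
have small : near2 (fun _ t : C => cmod t <= e / 2) by exists (e / 2).
have H := ucst_and (ucst_and (ucst_bound vA) (ucst_lb vA v0)) (ucst_near2 small).
have [A1 A11 HA1] := ucst_and H (ucst_near1 hE).
have [A2 A21 HA2] := hq; have [A3 A31 HA3] := vq.
pose A0 := Num.max A1 (Num.max A2 A3).
have A01 : 1 <= A0 by rewrite le_max A11.
(* Squared because |v'| <= A0 and |v| >= 1 / A0 combine to |v'| <= A0^2 |v|. *)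
exists (A0 ^+ 2) => [|A A0A x t xA tA]; first by rewrite exprn_ege1.
have A00 : 0 < A0 by lra.
have AA : A0 <= A by apply: le_trans A0A; rewrite -[leLHS]expr1 ler_weXn2l.
have ta : cmod t * A0 <= 1 by apply: le_trans tA; rewrite ler_wpM2l.
have z0 : cmod (0 : C) * A0 <= 1 by rewrite cmod0 mul0r.
have [|[[vb vl] te] hEt] := HA1 A0 _ 0 t z0 ta; first by rewrite le_max lexx.
have hqt : qd h t (dh t) by apply: (HA2 A0 _ t 0 ta z0); rewrite !le_max lexx ?orbT.
have [|vqt dvb] := HA3 A0 _ t 0 ta z0; first by rewrite !le_max lexx ?orbT.
have tk : 0 <= cmod t ^+ k by rewrite exprn_ge0.
have Ai : 0 < A0^-1 by rewrite invr_gt0.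
have AiA : A^-1 <= A0^-1 by rewrite lef_pV2// posrE; lra.
have hc : cmod (h t) = cmod t ^+ k * cmod (v t) by rewrite hEt cmodM cmodX.
split.
- by rewrite hc mulrC ler_wpM2l// (le_trans AiA).
- by rewrite hc mulrC ler_wpM2r// (le_trans vb).
have E : dh t = t ^+ k * dv t 0 + (k%:R * t ^+ k.-1) * v t.
  have qv : qd (fun y => y ^+ k * v y) t (t ^+ k * dv t 0 + (k%:R * t ^+ k.-1) * v t).
    apply: qd_mul => //; have := qd_exp k.-1 t; rewrite prednK//.
  apply: qd_uniq hqt _; apply: qd_ext qv; exists (e / 2) => // y ye.
  rewrite he//; have -> : y = (y - t) + t by ring.
  by apply: le_trans (cmodD _ _) _; lra.
have -> : t * dh t - k%:R * h t = t * t ^+ k * dv t 0.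
  have tE : t ^+ k = t * t ^+ k.-1 by rewrite -exprS prednK.
  rewrite E hEt tE; ring.
rewrite !cmodM cmodX hc.
have -> : A * cmod t * (cmod t ^+ k * cmod (v t)) = cmod t * cmod t ^+ k * (A * cmod (v t)) by ring.
rewrite ler_wpM2l ?mulr_ge0//; apply: le_trans dvb _.
have : A0 ^+ 2 * A0^-1 <= A * cmod (v t).
  by apply: ler_pM => //; rewrite ?exprn_ge0 ?(ltW Ai) ?(ltW A00).
by rewrite expr2 mulfK ?gt_eqF.
Qed.

End Uniform.

(** * Estimates at a single point *)

Section Point.
Context {R : realType}.
Local Notation C := (Cx R).
Local Notation Re := complex.Re.

Lemma ReD (a b : C) : Re (a + b) = Re a + Re b.
Proof. by case: a b => ? ? []. Qed.

Lemma Re_sum n (f : 'I_n -> C) : Re (\sum_(k < n) f k) = \sum_(k < n) Re (f k).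
Proof. by elim/big_rec2: _ => // i y1 y2 _ <-; rewrite ReD. Qed.

Lemma Re_nat n : Re (n%:R : C) = n%:R.
Proof. by elim: n => // n IH; rewrite -!natr1 ReD IH. Qed.

Lemma Re_ge (a : C) : - cmod a <= Re a.
Proof. have := cmod_Re a; rewrite ler_norml => /andP[]; lra. Qed.

Lemma Re_le (a : C) : Re a <= cmod a.
Proof. have := cmod_Re a; rewrite ler_norml => /andP[]; lra. Qed.

Lemma Re_close (T : C) (n : nat) (e : R) : (0 < n)%N -> cmod (T - n%:R) <= e ->
  1 - e <= Re T.
Proof.
move=> n0 H; have -> : T = (T - n%:R) + n%:R by rewrite subrK.
rewrite ReD Re_nat; have := Re_ge (T - n%:R).
have : 1 <= n%:R :> R by rewrite ler1n.
lra.
Qed.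

Lemma cmod_natB (p q D : nat) : (p <= D)%N -> (q <= D)%N ->
  cmod (p%:R - q%:R : C) <= D%:R.
Proof.
move=> pD qD; have [pq|qp] := leqP p q.
  by rewrite cmodC -natrB// cmod_nat ler_nat (leq_trans (leq_subr _ _)).
by rewrite -natrB 1?ltnW// cmod_nat ler_nat (leq_trans (leq_subr _ _)).
Qed.

Lemma cmod_div_le (a y : C) (b : R) : y != 0 -> cmod a <= b * cmod y -> cmod (a / y) <= b.
Proof. by move=> y0 H; rewrite cmodM cmodV ler_pdivrMr ?cmod_gt0. Qed.

(* T is the logarithmic derivative of the factor x - z_k along the vector field
   t d/dt + (t z_k0' + kap w) d/dx; it is close to the exponent kap of w or to the
   contact order dk of the two roots, whichever dominates. *)
Lemma field_term (t w a a' : C) (A : R) (D dk kap : nat) :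
  1 <= A -> (0 < dk <= D)%N -> (0 < kap <= D)%N ->
  cmod t * (A ^+ 2 * (16 * D%:R) ^+ 2) < 1 ->
  w != 0 -> cmod w <= cmod (w + a) ->
  cmod (t * a' - dk%:R * a) <= A * cmod t * cmod a ->
  (cmod w < 16 * D%:R * cmod a -> cmod a < 16 * D%:R * cmod w -> kap = dk) ->
  3 / 4 <= Re ((t * a' + kap%:R * w) / (w + a)).
Proof.
move=> A1 /andP[dk0 dkD] /andP[kap0 kapD] ts w0 wa ta' mid.
have D1 : 1 <= D%:R :> R by rewrite ler1n (leq_trans dk0).
have A0 : 0 < A by lra.
have At : A * cmod t <= 1 / 16.
  have h : A * cmod t * 16 <= cmod t * (A ^+ 2 * (16 * D%:R) ^+ 2).
    have -> : cmod t * (A ^+ 2 * (16 * D%:R) ^+ 2) = A * cmod t * (A * (16 * D%:R) ^+ 2) by ring.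
    rewrite ler_wpM2l ?mulr_ge0 ?(ltW A0)//.
    have : 16 <= (16 * D%:R) ^+ 2 :> R by nra.
    by move: ((16 * D%:R) ^+ 2) => q hq; nra.
  lra.
have y0 : w + a != 0.
  by rewrite -cmod_gt0; apply: lt_le_trans wa; rewrite cmod_gt0.
have ya : cmod a <= 2 * cmod (w + a).
  have := cmodB (w + a) w; rewrite addrAC subrr add0r; lra.
(* It suffices to approximate the quotient within 1/4 by some positive integer n. The error consists
   of the order error of [a] and of the mismatches of n with dk and with kap. *)
have key n : (0 < n)%N -> cmod (t * a' - dk%:R * a + ((dk%:R - n%:R) * a + (kap%:R - n%:R) * w)) <=
    1 / 4 * cmod (w + a) -> 3 / 4 <= Re ((t * a' + kap%:R * w) / (w + a)).
  move=> n0 H; have -> : 3 / 4 = 1 - 1 / 4 :> R by field.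
  apply: (Re_close n0).
  have -> : (t * a' + kap%:R * w) / (w + a) - n%:R =
    (t * a' - dk%:R * a + ((dk%:R - n%:R) * a + (kap%:R - n%:R) * w)) / (w + a) by field.
  exact: cmod_div_le.
have a0 := cmod_ge0 a; have w00 := cmod_ge0 w.
have Ata : A * cmod t * cmod a <= 1 / 16 * cmod a by rewrite ler_wpM2r.
(* Three regimes. A mismatch is at most D, and n is chosen so that it multiplies the smaller of |w|
   and |a|, smaller by 16 D; when the two are comparable, kap = dk leaves no mismatch. *)
have [h1|h1] := leP (16 * D%:R * cmod a) (cmod w).
  apply: (key kap) => //; rewrite subrr mul0r addr0.
  apply: le_trans (cmodD _ _) _; rewrite cmodM.
  have : cmod (dk%:R - kap%:R : C) * cmod a <= D%:R * cmod a.
    by rewrite ler_wpM2r// cmod_natB.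
  have : 0 <= D%:R * cmod a by rewrite mulr_ge0.
  have : cmod a <= D%:R * cmod a by rewrite ler_peMl.
  lra.
have [h2|h2] := leP (16 * D%:R * cmod w) (cmod a).
  apply: (key dk) => //; rewrite subrr mul0r add0r.
  apply: le_trans (cmodD _ _) _; rewrite cmodM.
  have : cmod (kap%:R - dk%:R : C) * cmod w <= D%:R * cmod w.
    by rewrite ler_wpM2r// cmod_natB.
  lra.
apply: (key dk) => //; rewrite mid// !subrr !mul0r !addr0.
apply: le_trans ta' _; lra.
Qed.

(** If p < q, then a < G^2 b would force |t|^p < A^2 G^2 |t|^(p+1), against |t| A^2 G^2 < 1. Applied
    both ways, it shows that all roots whose distance to the nearest one is comparable to |w| have
    the same contact order with it. *)
Lemma mid_orders (t w a b : C) (A G : R) (p q : nat) : 1 <= A -> 1 <= G ->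
  cmod t * (A ^+ 2 * G ^+ 2) < 1 -> t != 0 ->
  A^-1 * cmod t ^+ p <= cmod a -> cmod b <= A * cmod t ^+ q ->
  cmod a < G * cmod w -> cmod w < G * cmod b -> (q <= p)%N.
Proof.
move=> A1 G1 ts t0 ap bq aw wb; rewrite leqNgt; apply/negP => pq.
have A0 : 0 < A by lra.
have tp : 0 < cmod t by rewrite cmod_gt0.
have GG : 1 <= G ^+ 2 by nra.
have t1 : cmod t <= 1.
  have : 1 <= A ^+ 2 * G ^+ 2 by nra.
  move: (A ^+ 2 * G ^+ 2) ts => u; nra.
have H1 : A^-1 * cmod t ^+ p < G ^+ 2 * (A * cmod t ^+ q).
  apply: le_lt_trans ap _; apply: lt_le_trans aw _.
  rewrite expr2 -mulrA ler_wpM2l//; first lra.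
  by apply: (le_trans (ltW wb)); rewrite ler_wpM2l//; lra.
have H2 : cmod t ^+ q <= cmod t ^+ p.+1 by apply: ler_wiXn2l => //; exact: ltW.
have H3 : cmod t ^+ p < cmod t ^+ p * (cmod t * (A ^+ 2 * G ^+ 2)).
  have : A * (A^-1 * cmod t ^+ p) < A * (G ^+ 2 * (A * cmod t ^+ q)) by rewrite ltr_pM2l.
  rewrite mulVKf ?gt_eqF// => /lt_le_trans; apply.
  have -> : A * (G ^+ 2 * (A * cmod t ^+ q)) = (A ^+ 2 * G ^+ 2) * cmod t ^+ q by ring.
  have -> : cmod t ^+ p * (cmod t * (A ^+ 2 * G ^+ 2)) = (A ^+ 2 * G ^+ 2) * cmod t ^+ p.+1.
    by rewrite (exprS (cmod t) p); ring.
  by rewrite ler_wpM2l// mulr_ge0 ?exprn_ge0//; lra.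
move: H3; rewrite -[X in X < _]mulr1 ltr_pM2l ?exprn_gt0//; lra.
Qed.

(** The values at one point: [k0] is the index of a root nearest to x, [e] marks the factors equal
    to it, and [dd] gives the contact orders of the others with it. *)
Variables (m N D H : nat) (A : R) (x t : C) (z dz : nat -> C) (e : nat -> bool)
  (dd : nat -> nat) (k0 : nat).
Hypotheses (A1 : 1 <= A) (N0 : (0 < N)%N) (ND : (N <= D)%N) (k0m : (k0 < m)%N) (ek0 : e k0).
Hypothesis ddN : forall k, (k < m)%N -> ~~ e k -> (N <= dd k <= D)%N.
Hypothesis He : forall k, (k < m)%N -> e k -> z k = z k0 /\ dz k = dz k0.
Hypothesis Hn : forall k, (k < m)%N -> ~~ e k ->
  [/\ A^-1 * cmod t ^+ dd k <= cmod (z k0 - z k), cmod (z k0 - z k) <= A * cmod t ^+ dd k &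
    cmod (t * (dz k0 - dz k) - (dd k)%:R * (z k0 - z k)) <= A * cmod t * cmod (z k0 - z k)].
Hypothesis xmin : forall k, (k < m)%N -> cmod (x - z k0) <= cmod (x - z k).
Hypothesis xz : x != z k0.

Let w := x - z k0.
Let xzk k : x - z k = w + (z k0 - z k). Proof. by rewrite /w addrA subrK. Qed.
Let w0 : w != 0. Proof. by rewrite subr_eq0. Qed.
Let A0 : 0 < A. Proof. exact: lt_le_trans ltr01 A1. Qed.

Lemma half_dist k : (k < m)%N -> cmod (z k0 - z k) / 2 <= cmod (x - z k).
Proof.
move=> km; have := xmin km; have := cmodB (x - z k) (x - z k0).
have -> : x - z k - (x - z k0) = z k0 - z k by ring.
lra.
Qed.

(** One [kap] has to serve all factors at once: it is the contact order of any root in the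
    comparable regime, well defined by [mid_orders]. *)
Lemma field_sum : t != 0 -> cmod t * (A ^+ 2 * (16 * D%:R) ^+ 2) < 1 ->
  exists kap : nat, (kap <= D)%N /\
   3 / 4 <= Re (\sum_(k < m) (t * (dz k0 - dz k) + kap%:R * w) / (x - z k)).
Proof.
move=> t0 ts; have D0 : (0 < D)%N by exact: leq_trans ND.
have G1 : 1 <= 16 * D%:R :> R.
  have : 1 <= D%:R :> R by rewrite ler1n.
  lra.
pose mid k := (k < m)%N /\ [/\ ~~ e k, cmod w < 16 * D%:R * cmod (z k0 - z k) &
  cmod (z k0 - z k) < 16 * D%:R * cmod w].
have [kap [kap0 kapD kapm]] : exists kap : nat, [/\ (0 < kap)%N, (kap <= D)%N &
    forall k, mid k -> kap = dd k].
  have [[l [lm [el l1 l2]]]|nl] := pselect (exists l, mid l); last first.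
    (* No root is in the comparable regime: any value from 1 to D works, and N is one. *)
    by exists N; split=> // k mk; case: nl; exists k.
  have /andP[Nl lD] := ddN lm el; exists (dd l); split=> //; first exact: leq_trans Nl.
  move=> k [km [ek k1 k2]].
  have [a1 a2 _] := Hn lm el; have [b1 b2 _] := Hn km ek.
  apply/eqP; rewrite eqn_leq.
  rewrite (mid_orders A1 G1 ts t0 b1 a2 k2 l1).
  by rewrite (mid_orders A1 G1 ts t0 a1 b2 l2 k1).
exists kap; split=> //; rewrite Re_sum.
have term k : (k < m)%N -> 3 / 4 <= Re ((t * (dz k0 - dz k) + kap%:R * w) / (x - z k)).
  move=> km; have [ek|ek] := boolP (e k).
    have [-> ->] := He km ek; rewrite subrr mulr0 add0r mulfK//.
    rewrite Re_nat; have : 1 <= kap%:R :> R by rewrite ler1n.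
    lra.
  have [b1 b2 b3] := Hn km ek; rewrite xzk.
  have /andP[Nk kD] := ddN km ek.
  apply: (@field_term _ _ _ _ A D (dd k)) => //.
  - by rewrite kD andbT (leq_trans N0).
  - by rewrite kap0.
  - by rewrite -xzk xmin.
  - by move=> h1 h2; apply: kapm.
apply: (le_trans (term _ k0m)); rewrite (bigD1 (Ordinal k0m))//= lerDl.
by apply: sumr_ge0 => i _; apply: le_trans (term i (ltn_ord i)); lra.
Qed.

Variables (u ux ut F Fx Ft : C).
Hypotheses (u1 : A^-1 <= cmod u) (uxA : cmod ux <= A) (utA : cmod ut <= A).
Hypothesis FE : F = u * \prod_(k < m) (x - z k).
Hypothesis FxE : Fx = F * (ux / u + \sum_(k < m) (x - z k)^-1).
Hypothesis FtE : Ft = F * (ut / u - \sum_(k < m) dz k / (x - z k)).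

Let u0 : u != 0.
Proof. by rewrite -cmod_gt0; apply: lt_le_trans u1; rewrite invr_gt0. Qed.

Lemma div_u a : cmod a <= A -> cmod (a / u) <= A ^+ 2.
Proof.
move=> aA; apply: cmod_div_le => //; apply: le_trans aA _.
rewrite expr2 -mulrA -[leLHS]mulr1 ler_wpM2l ?(ltW A0)//.
by rewrite -ler_pdivrMl// mulr1.
Qed.

(** Along t d/dt + V d/dx the derivative of [F] is F times a number of real part at least 1/2: at
    least 3/4 from the roots, at most 1/4 lost to the unit. Inside the cone both t z_k0' and w are
    O(|t|^N), hence so is V. *)
Lemma field_bound : t != 0 -> cmod t * (A ^+ 2 * (16 * D%:R) ^+ 2) < 1 ->
  cmod x <= 4 * A * cmod t ^+ N -> cmod (z k0) <= A * cmod t ^+ N ->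
  cmod (t * dz k0) <= A * cmod t ^+ N ->
  cmod t * (A ^+ 2 * (1 + A + 5 * D%:R * A)) <= 1 / 4 ->
  cmod F / 2 <= cmod (t * Ft) + (A + 5 * D%:R * A) * cmod t ^+ N * cmod Fx.
Proof.
move=> t0 ts xc zc dzc ts2; have hA1 := A1; have hA0 := A0; have [kap [kapD Hk]] := field_sum t0 ts.
have AA : 0 <= A ^+ 2 by rewrite exprn_ge0 ?ltW.
have t1 : cmod t <= 1.
  have : 1 <= A ^+ 2 * (1 + A + 5 * D%:R * A).
    have h : 0 <= 5 * D%:R * A :> R by rewrite !mulr_ge0// ltW.
    rewrite -[leLHS]mulr1; apply: ler_pM => //; first exact: exprn_ege1.
    lra.
  move: (A ^+ 2 * (1 + A + 5 * D%:R * A)) ts2 => v; have := cmod_ge0 t; nra.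
have wc : cmod w <= 5 * A * cmod t ^+ N.
  by apply: le_trans (cmodB _ _) _; lra.
pose V := t * dz k0 + kap%:R * w.
have Vc : cmod V <= (A + 5 * D%:R * A) * cmod t ^+ N.
  apply: le_trans (cmodD _ _) _; rewrite mulrDl; apply: lerD => //.
  rewrite cmodM cmod_nat.
  have -> : 5 * D%:R * A * cmod t ^+ N = D%:R * (5 * A * cmod t ^+ N) by ring.
  by apply: ler_pM => //; rewrite ler_nat.
have E : t * Ft + V * Fx = F * (t * (ut / u) + V * (ux / u) +
    \sum_(k < m) (t * (dz k0 - dz k) + kap%:R * w) / (x - z k)).
  have -> : \sum_(k < m) (t * (dz k0 - dz k) + kap%:R * w) / (x - z k) =
     V * (\sum_(k < m) (x - z k)^-1) - t * \sum_(k < m) dz k / (x - z k).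
    rewrite !mulr_sumr -sumrB; apply: eq_bigr => k _; rewrite /V; ring.
  rewrite FtE FxE; ring.
set S := \sum_(k < m) _ in Hk E.
have tN : cmod t ^+ N <= cmod t.
  by rewrite -[leRHS]expr1; apply: ler_wiXn2l.
have small : cmod (t * (ut / u) + V * (ux / u)) <= 1 / 4.
  apply: le_trans (cmodD _ _) _; rewrite cmodM [cmod (V * _)]cmodM.
  have h1 : cmod t * cmod (ut / u) <= cmod t * A ^+ 2 by rewrite ler_wpM2l// div_u.
  have h2 : cmod V * cmod (ux / u) <= (A + 5 * D%:R * A) * cmod t * A ^+ 2.
    apply: ler_pM => //; last exact: div_u.
    apply: le_trans Vc _; rewrite ler_wpM2l// addr_ge0 ?mulr_ge0 ?(ltW A0)//.
  lra.
have big : 1 / 2 <= cmod (t * (ut / u) + V * (ux / u) + S).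
  apply: le_trans (Re_le _); rewrite ReD.
  have := Re_ge (t * (ut / u) + V * (ux / u)); lra.
have : cmod F / 2 <= cmod (t * Ft + V * Fx).
  rewrite E cmodM; have := cmod_ge0 F; nra.
move=> /le_trans; apply; apply: le_trans (cmodD _ _) _; rewrite lerD2l cmodM.
by rewrite ler_wpM2r.
Qed.

(** In w F_x / F each factor equal to the nearest one contributes 1, and each other factor at most 1
    / (4 m) in modulus, so the sum over the roots has real part at least 3/4. *)
Lemma near_root_bound : (0 < m)%N ->
  (forall k, (k < m)%N -> ~~ e k -> 8 * m%:R * cmod w <= cmod (z k0 - z k)) ->
  4 * A ^+ 2 * cmod w <= 1 -> cmod F <= 2 * cmod w * cmod Fx.
Proof.
move=> m0 hw ws; have hA1 := A1; have hA0 := A0.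
have mR : 1 <= m%:R :> R by rewrite ler1n.
have term k : (k < m)%N -> (e k)%:R - 1 / (4 * m%:R) <= Re (w / (x - z k)).
  move=> km; have m4 : 0 <= 1 / (4 * m%:R) :> R by rewrite divr_ge0//; lra.
  have [ek|ek] /= := boolP (e k).
    have [-> _] := He km ek; rewrite divff// (_ : Re 1 = 1)//; lra.
  have h : cmod (w / (x - z k)) <= 1 / (4 * m%:R).
    have xk0 : x - z k != 0.
      by rewrite -cmod_gt0; apply: lt_le_trans (xmin km); rewrite cmod_gt0.
    apply: cmod_div_le => //; rewrite mulrC -ler_pdivrMr; last first.
      by rewrite divr_gt0//; lra.
    have -> : cmod w / (1 / (4 * m%:R)) = 8 * m%:R * cmod w / 2 by field; lra.
    by apply: le_trans (half_dist km); rewrite ler_pM2r ?invr_gt0// hw.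
  have := Re_ge (w / (x - z k)); lra.
have E : w * Fx = F * (w * (ux / u) + \sum_(k < m) w / (x - z k)).
  by rewrite FxE -mulr_sumr; ring.
have S : 3 / 4 <= Re (\sum_(k < m) w / (x - z k)).
  rewrite Re_sum; apply: (@le_trans _ _ (\sum_(k < m) ((e k)%:R - 1 / (4 * m%:R)))).
    rewrite sumrB sumr_const card_ord (bigD1 (Ordinal k0m))//= ek0.
    have -> : (1 / (4 * m%:R)) *+ m = 1 / 4 :> R by rewrite -mulr_natr; field; lra.
    have : 0 <= \sum_(i < m | i != Ordinal k0m) ((e i)%:R : R) by apply: sumr_ge0.
    rewrite -[true%:R]/(1 : R); move: (\sum_(i < m | _) _) => v; lra.
  by apply: ler_sum => k _; exact: term.
have small : cmod (w * (ux / u)) <= 1 / 4.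
  rewrite cmodM; have := div_u uxA; have := cmod_ge0 w; have := cmod_ge0 (ux / u); nra.
have big : 1 / 2 <= cmod (w * (ux / u) + \sum_(k < m) w / (x - z k)).
  apply: le_trans (Re_le _); rewrite ReD.
  have := Re_ge (w * (ux / u)); lra.
have : cmod F / 2 <= cmod (w * Fx).
  rewrite E cmodM; have := cmod_ge0 F; nra.
rewrite cmodM; lra.
Qed.

End Point.

(** * Case distinction on the position of the point *)

Section Regions.
Context {R : realType}.
Local Notation C := (Cx R).
Local Notation Re := complex.Re.

Lemma prod_exp_if n (e : nat -> bool) (dd : nat -> nat) (p q : R) :
  \prod_(k < n) (if e k then p else q ^+ dd k) =
  p ^+ (\sum_(k < n) e k) * q ^+ (\sum_(k < n) if e k then 0 else dd k)%N.
Proof.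
elim: n => [|n IH]; first by rewrite !big_ord0 !expr0 mulr1.
rewrite !big_ord_recr /= IH; case: (e n); rewrite ?addn1 ?addn0 ?exprS ?exprD; ring.
Qed.

Lemma sum_if_split n (e : nat -> bool) (dd : nat -> nat) s :
  (\sum_(k < n) (if e k then s else dd k) =
   (\sum_(k < n) e k) * s + \sum_(k < n) if e k then 0 else dd k)%N.
Proof.
elim: n => [|n IH]; first by rewrite !big_ord0.
rewrite !big_ord_recr /= IH; case: (e n) => /=; rewrite ?addn1 ?addn0 ?mulSn; lia.
Qed.

Lemma prod_exp n (dd : nat -> nat) (q : R) :
  \prod_(k < n) q ^+ dd k = q ^+ (\sum_(k < n) dd k).
Proof.
by elim: n => [|n IH]; rewrite ?big_ord0// !big_ord_recr /= IH exprD.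
Qed.

Lemma le_prodc n (p y : nat -> R) (c : R) : 0 <= c ->
  (forall k, (k < n)%N -> 0 <= p k) -> (forall k, (k < n)%N -> c * p k <= y k) ->
  c ^+ n * \prod_(k < n) p k <= \prod_(k < n) y k.
Proof.
move=> c0 p0 py; rewrite -[X in c ^+ X](card_ord n) -prodr_const -big_split /=.
apply: ler_prod => k _; rewrite mulr_ge0//= ?py//; exact: p0.
Qed.

Lemma exists_argmin n (f : nat -> R) : (0 < n)%N ->
  exists2 k, (k < n)%N & forall l, (l < n)%N -> f k <= f l.
Proof.
move=> n0; have [i _ H] := @arg_minP _ _ _ (Ordinal n0) predT (fun i : 'I_n => f i) isT.
by exists i => // l ln; exact: (H (Ordinal ln)).
Qed.

Lemma exists_argmax n (P : nat -> bool) (f : nat -> nat) : (exists2 k, (k < n)%N & P k) ->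
  exists k, [/\ (k < n)%N, P k & forall l, (l < n)%N -> P l -> (f l <= f k)%N].
Proof.
move=> [k kn Pk].
have [i Pi H] := @arg_maxnP _ (Ordinal kn) (fun i : 'I_n => P i) (fun i : 'I_n => f i) Pk.
by exists i; split=> // l ln Pl; exact: (H (Ordinal ln)).
Qed.

(** The constants are fixed before the point and the values there, so they are uniform. Comparing
    [rho ^+ H] with [cmod F ^+ N] postpones fractional powers to [power_final]. *)
Lemma regions (m N D H : nat) (A : R) : 1 <= A -> (0 < N <= D)%N -> (0 < m)%N ->
  (m * N <= H)%N -> exists K c B : R, [/\ 0 < K, 0 < c, A <= B &
  forall (x t : C) (z dz : nat -> C) (E : nat -> nat -> bool) (dd : nat -> nat -> nat)
    (u ux ut F Fx Ft : C),
  cmod x * B <= 1 -> cmod t * B <= 1 ->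
  (forall k, (k < m)%N -> E k k) ->
  (forall k l, (k < m)%N -> (l < m)%N -> ~~ E k l -> (N <= dd k l <= D)%N) ->
  (forall k l, (k < m)%N -> (l < m)%N -> E k l -> z l = z k /\ dz l = dz k) ->
  (forall k l, (k < m)%N -> (l < m)%N -> ~~ E k l ->
    [/\ A^-1 * cmod t ^+ dd k l <= cmod (z k - z l), cmod (z k - z l) <= A * cmod t ^+ dd k l &
    cmod (t * (dz k - dz l) - (dd k l)%:R * (z k - z l)) <= A * cmod t * cmod (z k - z l)]) ->
  (forall k s, (k < m)%N -> (s < m)%N -> ~~ E k s ->
    (\sum_(l < m) (if E k l then dd k s else minn (dd k l) (dd k s)) <= H)%N) ->
  (forall k, (k < m)%N -> cmod (z k) <= A * cmod t ^+ N /\ cmod (t * dz k) <= A * cmod t ^+ N) ->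
  (forall k, (k < m)%N -> x != z k) ->
  A^-1 <= cmod u -> cmod ux <= A -> cmod ut <= A ->
  F = u * \prod_(k < m) (x - z k) ->
  Fx = F * (ux / u + \sum_(k < m) (x - z k)^-1) ->
  Ft = F * (ut / u - \sum_(k < m) dz k / (x - z k)) ->
  exists rho, [/\ 0 < rho, c * rho ^+ H <= cmod F ^+ N &
    cmod F <= K * rho * cmod Fx \/
    [/\ t != 0, rho = cmod t ^+ N & cmod F <= 2 * cmod (t * Ft) + K * rho * cmod Fx]]].
Proof.
move=> A1 /andP[N0 ND] m0 mH.
have A0 : 0 < A by lra.
have D1 : 1 <= D%:R :> R by rewrite ler1n (leq_trans N0).
have m1 : 1 <= m%:R :> R by rewrite ler1n.
pose K := 2 * (A + 5 * D%:R * A).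
have DA : 0 <= D%:R * A by rewrite mulr_ge0 ?(ltW A0).
have K2 : 2 <= K by rewrite /K; lra.
(* Each other root satisfies |x - z_k| >= |t|^dd / (2 A), and if it lies within 8 m |w| of the
   nearest one, then |w| >= |t|^dd / (8 m A). This [b] covers both. *)
pose b := 8 * m%:R * A.
have b2 : 2 * A <= b.
  have : A <= m%:R * A by rewrite ler_peMl// ltW.
  rewrite /b; lra.
have b0 : 0 < b by lra.
have b1 : 1 <= b by lra.
have m8 : 1 <= 8 * m%:R :> R by lra.
have bi : 0 < b^-1 by rewrite invr_gt0.
have hb : b^-1 <= A^-1 / 2 by rewrite -invfM lef_pV2 ?posrE; lra.
pose c0 := A^-1 * b^-1 ^+ m.
have c00 : 0 < c0 by rewrite mulr_gt0 ?invr_gt0// exprn_gt0.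
pose c := c0 ^+ N * A^-1 ^+ H.
have cp : 0 < c by rewrite mulr_gt0// exprn_gt0// invr_gt0.
pose B1 := A ^+ 2 * (16 * D%:R) ^+ 2.
pose B2 := A ^+ 2 * (1 + A + 5 * D%:R * A).
have A2 : 1 <= A ^+ 2 by rewrite exprn_ege1.
have B10 : 0 <= B1 by rewrite mulr_ge0// exprn_ge0//; lra.
have B20 : 0 <= B2 by rewrite mulr_ge0//; lra.
have A3 : 1 <= A ^+ 3 by rewrite exprn_ege1.
have A23 : A ^+ 3 = A * A ^+ 2 by rewrite exprS.
(* The smallness demands of all regions added up, so that each follows from |v| B <= 1. *)
pose B := 2 * B1 + 4 * B2 + 8 * A ^+ 3 + 8 * A ^+ 2 + A.
have small v : cmod v * B <= 1 -> [/\ cmod v * B1 <= 1 / 2, cmod v * B2 <= 1 / 4,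
    cmod v * A ^+ 3 <= 1 / 8, cmod v * A ^+ 2 <= 1 / 8 & cmod v <= 1].
  rewrite /B => vB; have v0 := cmod_ge0 v.
  have h1 : 0 <= cmod v * B1 by rewrite mulr_ge0.
  have h2 : 0 <= cmod v * B2 by rewrite mulr_ge0.
  have h3 : 0 <= cmod v * A ^+ 3 by rewrite mulr_ge0//; lra.
  have h4 : 0 <= cmod v * A ^+ 2 by rewrite mulr_ge0//; lra.
  have h5 : cmod v <= cmod v * A by rewrite ler_peMr.
  by split; lra.
exists K, c, B; split=> //; first lra.
  by rewrite /B; lra.
move=> x t z dz E dd u ux ut F Fx Ft xB tB Erefl ddN He Hn HH zA xz u1 uxA utA FE FxE FtE.
have [x1 x2 x3 x4 x5] := small x xB; have [t1 t2 t3 t4 t5] := small t tB.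
clear small xB tB; clearbody B.
have x0 := cmod_ge0 x; have tp := cmod_ge0 t.
have ui : 0 < A^-1 by rewrite invr_gt0.
have u0 : u != 0 by rewrite -cmod_gt0; apply: lt_le_trans u1.
have Flow (p : nat -> R) : (forall k, (k < m)%N -> 0 <= p k) ->
    (forall k, (k < m)%N -> b^-1 * p k <= cmod (x - z k)) -> c0 * \prod_(k < m) p k <= cmod F.
  move=> p0 py; rewrite FE cmodM cmod_prod /c0 -mulrA.
  apply: ler_pM => //; first exact: ltW.
    by rewrite mulr_ge0 ?exprn_ge0 ?(ltW bi)// prodr_ge0// => k _; exact: p0.
  by apply: (@le_prodc m p (fun k => cmod (x - z k)) b^-1) => //; exact: ltW.
have Fpow (Y rho : R) : 0 <= Y -> c0 * Y <= cmod F -> A^-1 ^+ H * rho ^+ H <= Y ^+ N ->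
    c * rho ^+ H <= cmod F ^+ N.
  move=> Y0 YF Yr; apply: (@le_trans _ _ ((c0 * Y) ^+ N)).
    by rewrite /c -mulrA [(c0 * Y) ^+ N]exprMn ler_wpM2l// exprn_ge0// ltW.
  by rewrite lerXn2r ?nnegrE// mulr_ge0// ltW.
clearbody c; clearbody c0.
have AiH : A^-1 ^+ H <= 1 by rewrite exprn_ile1 ?(ltW ui)// invf_le1.
have AiHp : 0 <= A^-1 ^+ H by rewrite exprn_ge0 ?(ltW ui).
have tN0 : 0 <= cmod t ^+ N by rewrite exprn_ge0.
(* Off the cone |z_k| <= |x| / 4, so each x / (x - z_k) is within 1/3 of 1, and |F| is at least a
   multiple of |x|^m; m N <= H turns this into the bound with |x|^H. *)
have [out|inn] := leP (4 * A * cmod t ^+ N) (cmod x).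
  have zx k : (k < m)%N -> cmod (z k) <= cmod x / 4.
    by move=> km; have [h _] := zA k km; lra.
  have xp : 0 < cmod x.
    rewrite cmod_gt0; apply/eqP => x00; have := zx 0%N m0.
    rewrite x00 cmod0 mul0r => z00; have := xz 0%N m0; rewrite x00 eq_sym -cmod_eq0.
    by rewrite eq_le z00 cmod_ge0.
  have zz k : (k < m)%N -> 3 / 4 * cmod x <= cmod (x - z k).
    by move=> km; have := cmod_lbB x (z k); have := zx k km; lra.
  exists (cmod x); split=> //.
    apply: (Fpow (cmod x ^+ m)); first by rewrite exprn_ge0.
      have := Flow (fun=> cmod x) (fun _ _ => x0).
      rewrite prodr_const card_ord; apply=> k km; apply: le_trans (zz k km).
      rewrite ler_wpM2r//; apply: (@le_trans _ _ 2^-1); last by clear; lra.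
      by rewrite lef_pV2 ?posrE//; move: A1 b2; clear; lra.
    apply: (@le_trans _ _ (cmod x ^+ H)).
      by rewrite ler_piMl// exprn_ge0.
    by rewrite -exprM; apply: ler_wiXn2l.
  left; have -> : K * cmod x * cmod Fx = K * cmod (x * Fx) by rewrite cmodM mulrA.
  have EE : x * Fx = F * (x * (ux / u) + \sum_(k < m) x / (x - z k)).
    by rewrite FxE -mulr_sumr; ring.
  have S : 2 / 3 <= Re (\sum_(k < m) x / (x - z k)).
    have term k : (k < m)%N -> 2 / 3 <= Re (x / (x - z k)).
      move=> km; have xk0 : x - z k != 0 by rewrite subr_eq0 xz.
      have -> : 2 / 3 = 1 - 1 / 3 :> R by field.
      apply: (@Re_close _ _ 1) => //.
      have -> : x / (x - z k) - 1%:R = z k / (x - z k) by field.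
      apply: cmod_div_le => //; have := zx k km; have := zz k km; lra.
    rewrite Re_sum (bigD1 (Ordinal m0))//=.
    have := term 0%N m0.
    have : 0 <= \sum_(i < m | i != Ordinal m0) Re (x / (x - z i)).
      by apply: sumr_ge0 => i _; apply: le_trans (term i (ltn_ord i)); lra.
    move: (\sum_(i < m | _) _) => v; lra.
  have sm : cmod (x * (ux / u)) <= 1 / 8.
    rewrite cmodM; apply: le_trans x4; rewrite ler_wpM2l//; exact: div_u.
  have big : 1 / 2 <= cmod (x * (ux / u) + \sum_(k < m) x / (x - z k)).
    apply: le_trans (Re_le _); rewrite ReD.
    have := Re_ge (x * (ux / u)); lra.
  have h : cmod F / 2 <= cmod (x * Fx).
    by rewrite EE cmodM ler_wpM2l//; lra.
  have : 2 * cmod (x * Fx) <= K * cmod (x * Fx) by rewrite ler_wpM2r.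
  lra.
have t0 : t != 0.
  apply/eqP => t00; move: inn; rewrite t00 cmod0 expr0n eqn0Ngt N0 /= mulr0 => h.
  have := cmod_ge0 x; lra.
have tpp : 0 < cmod t by rewrite cmod_gt0.
have [k0 k0m xmin] := exists_argmin (fun k => cmod (x - z k)) m0.
have xz0 := xz k0 k0m.
have w0 : 0 < cmod (x - z k0) by rewrite cmod_gt0 subr_eq0.
have hd := half_dist xmin.
have [zk dzk] := zA k0 k0m.
have tNt : cmod t ^+ N <= cmod t by rewrite -[leRHS]expr1; apply: ler_wiXn2l.
have w8 : A ^+ 2 * cmod (x - z k0) <= 1 / 4.
  have h1 : cmod (x - z k0) <= cmod x + A * cmod t.
    apply: le_trans (cmodB _ _) _; rewrite lerD2l; apply: le_trans zk _.
    by rewrite ler_wpM2l// ltW.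
  have : A ^+ 2 * cmod (x - z k0) <= A ^+ 2 * (cmod x + A * cmod t).
    by rewrite ler_wpM2l//; lra.
  have -> : A ^+ 2 * (cmod x + A * cmod t) = cmod x * A ^+ 2 + cmod t * A ^+ 3.
    by rewrite A23; ring.
  lra.
have w1 : cmod (x - z k0) <= 1.
  have : cmod (x - z k0) <= A ^+ 2 * cmod (x - z k0) by rewrite ler_peMl// ltW.
  lra.
have afar k : (k < m)%N -> ~~ E k0 k -> b^-1 * cmod t ^+ dd k0 k <= cmod (x - z k).
  move=> km ek; apply: le_trans (hd k km); have [h _ _] := Hn _ _ k0m km ek.
  apply: (@le_trans _ _ (A^-1 * cmod t ^+ dd k0 k / 2)); last by rewrite ler_pM2r.
  by rewrite mulrAC ler_wpM2r ?exprn_ge0.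
have [near|far] := pselect (forall k, (k < m)%N -> ~~ E k0 k ->
    8 * m%:R * cmod (x - z k0) <= cmod (z k0 - z k)).
  exists (cmod (x - z k0)); split=> //; last first.
    left; have := near_root_bound A1 k0m (Erefl _ k0m) (fun k km => He _ _ k0m km) xmin
      xz0 u1 uxA FxE m0 near.
    have ws : 4 * A ^+ 2 * cmod (x - z k0) <= 1 by lra.
    move=> /(_ ws) /le_trans; apply.
    by apply: ler_wpM2r => //; exact: ler_wpM2r.
  set w := cmod (x - z k0) in w0 w1 *.
  have wge := ltW w0.
  pose P := \prod_(k < m) (if E k0 k then w else cmod t ^+ dd k0 k).
  have P0 : 0 <= P by apply: prodr_ge0 => k _; case: ifP => _ //; rewrite exprn_ge0.
  apply: (Fpow P) => //.
    apply: (Flow (fun k => if E k0 k then w else cmod t ^+ dd k0 k)).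
      by move=> k km; case: ifP => _ //; rewrite exprn_ge0.
    move=> k km; case: ifP => [ek|/negbT ek]; last exact: afar.
    have [-> _] := He _ _ k0m km ek.
    by rewrite ler_piMl// invf_le1.
  rewrite /P prod_exp_if exprMn -!exprM.
  set m1' := (\sum_(k < m) E k0 k)%N; set S := (\sum_(k < m) _)%N.
  have m1m : (m1' <= m)%N.
    rewrite /m1' -[leqRHS]card_ord -sum1_card; apply: leq_sum => i _; exact: leq_b1.
  have m1H : (m1' * N <= H)%N by apply: leq_trans mH; rewrite leq_mul2r m1m orbT.
  have [far|nofar] := pselect (exists2 k, (k < m)%N & ~~ E k0 k); last first.
    have S0 : S = 0%N.
      rewrite /S big1// => k _; case: ifP => // /negbT ek.
      by case: nofar; exists k.
    rewrite S0 mul0n expr0 mulr1; apply: (@le_trans _ _ (w ^+ H)).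
      by rewrite ler_piMl// exprn_ge0.
    by apply: ler_wiXn2l => //; exact: ltW.
  (* For the largest contact order d_s the minima in [HH] disappear, which leaves m1' d_s + S <= H.
     With r = H - m1' N, the bounds |w| <= A |t|^d_s and N S <= d_s r let the factors |t|^(N S)
     dominate w^r. *)
  have [s [sm es smax]] := exists_argmax (fun k => dd k0 k) far.
  have sumH : (m1' * dd k0 s + S <= H)%N.
    rewrite /m1' /S -sum_if_split.
    apply: leq_trans (HH k0 s k0m sm es); apply: leq_sum => k _.
    by case: ifP => // /negbT ek; rewrite leq_min leqnn smax.
  have /andP[Ns _] := ddN _ _ k0m sm es.
  have [_ ws _] := Hn _ _ k0m sm es.
  have {}ws : w <= A * cmod t ^+ dd k0 s.
    apply: (le_trans _ (le_trans (near s sm es) ws)); by rewrite ler_peMl.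
  rewrite -{2}(subnKC m1H) exprD mulrCA ler_wpM2l ?exprn_ge0 ?(ltW w0)//.
  set r := (H - m1' * N)%N.
  have Sr : (S <= r)%N.
    rewrite /r leq_subRL//; apply: leq_trans sumH.
    by rewrite leq_add2r leq_mul2l Ns orbT.
  apply: (@le_trans _ _ (A^-1 ^+ H * (A * cmod t ^+ dd k0 s) ^+ r)).
    by rewrite ler_wpM2l// lerXn2r ?nnegrE ?mulr_ge0 ?exprn_ge0 ?(ltW w0) ?(ltW A0).
  rewrite exprMn mulrA -exprM.
  apply: (@le_trans _ _ (1 * cmod t ^+ (dd k0 s * r))).
    rewrite ler_wpM2r ?exprn_ge0// exprVn ler_pdivrMl ?exprn_gt0// mulr1.
    by rewrite ler_weXn2l// leq_subr.
  by rewrite mul1r; apply: ler_wiXn2l => //; rewrite mulnC leq_mul.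
exists (cmod t ^+ N); split; first by rewrite exprn_gt0.
  (* Here some other root is not far compared with |w|, so |w| >= |t|^d_s / b for the largest
     contact order d_s. This bounds the factors equal to the nearest one, and the total exponent of
     |t| is the sum in [HH]. *)
  have [k1 [k1m [ek1 wk1]]] : exists k, (k < m)%N /\ ~~ E k0 k /\
      cmod (z k0 - z k) < 8 * m%:R * cmod (x - z k0).
    apply: contrapT => H0; apply: far => k km ek; rewrite leNgt; apply/negP => hk.
    by apply: H0; exists k.
  have [s [sm es smax]] := exists_argmax (fun k => dd k0 k)
    (ex_intro2 _ _ k1 k1m (ek1 : (fun k => ~~ E k0 k) k1)).
  pose dl k := if E k0 k then dd k0 s else minn (dd k0 k) (dd k0 s).
  have wlow : b^-1 * cmod t ^+ dd k0 s <= cmod (x - z k0).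
    have [h _ _] := Hn _ _ k0m k1m ek1.
    have h2 : cmod t ^+ dd k0 s <= cmod t ^+ dd k0 k1.
      by apply: ler_wiXn2l => //; exact: smax.
    rewrite ler_pdivrMl//; apply: le_trans h2 _.
    move: h; rewrite ler_pdivrMl// => /le_trans; apply.
    have -> : b * cmod (x - z k0) = A * (8 * m%:R * cmod (x - z k0)) by rewrite /b; ring.
    by rewrite ler_wpM2l ?(ltW A0)// ltW.
  apply: (Fpow (cmod t ^+ H)); first by rewrite exprn_ge0.
    apply: (@le_trans _ _ (c0 * \prod_(k < m) cmod t ^+ dl k)).
      rewrite prod_exp ler_wpM2l ?(ltW c00)//; apply: ler_wiXn2l => //.
      exact: HH.
    apply: (Flow (fun k => cmod t ^+ dl k)); first by move=> k _; rewrite exprn_ge0.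
    move=> k km; rewrite /dl; case: ifP => [ek|/negbT ek].
      by have [-> _] := He _ _ k0m km ek.
    by rewrite (minn_idPl (smax k km ek)); exact: afar.
  by rewrite -!exprM mulnC ler_piMl// exprn_ge0.
right; split=> //.
have ts1 : cmod t * (A ^+ 2 * (16 * D%:R) ^+ 2) < 1 by apply: le_lt_trans t1 _; lra.
have := field_bound A1 N0 ND k0m (fun k km => ddN _ _ k0m km) (fun k km => He _ _ k0m km)
  (fun k km => Hn _ _ k0m km) xmin xz0 u1 uxA utA FxE FtE t0 ts1 (ltW inn) zk dzk t2.
have -> : K * cmod t ^+ N * cmod Fx = 2 * ((A + 5 * D%:R * A) * cmod t ^+ N * cmod Fx).
  by rewrite /K; ring.
lra.
Qed.

End Regions.

(** * Taylor expansion of f and the cone containing its zeros *)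

Section Taylor.
Context {R : realType}.
Local Notation C := (Cx R).

Lemma csum_cvg (h : nat -> C) M : asum h M ->
  (fun n => \sum_(k < n) h k) @ \oo --> csum h.
Proof.
move=> hM; have gM := sumle_nsum hM; set g := fun i => cmod (h i) in gM.
apply/cvgrPdist_lt => eps /real_of_pos[eps0 epsE].
have [n0 n0P] : exists n0, nsum g - cmod eps < \sum_(k < n0) g k.
  apply: contrapT => H; have : sumle g (nsum g - cmod eps).
    apply: sumle_nat => [i|n]; first exact: cmod_ge0.
    by rewrite leNgt; apply/negP => Hn; apply: H; exists n.
  move=> /nsum_le; lra.
near=> n; have n0n : (n0 <= n)%N by near: n; exact: nbhs_infty_ge.
rewrite (csum_split n hM) addrAC subrr add0r cmod_norm epsE ltcR.
apply: (@le_lt_trans _ _ (nsum g - \sum_(k < n) g k)); last first.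
  have : \sum_(k < n0) g k <= \sum_(k < n) g k.
    rewrite (big_ord_widen _ _ n0n) [leRHS](bigID (fun i : 'I_n => (i < n0)%N)) /=.
    by rewrite lerDl sumr_ge0 // => i _; exact: cmod_ge0.
  lra.
apply: csum_le; apply: sumle_nat => [i|N]; first exact: cmod_ge0.
rewrite lerBrDl.
have -> : \sum_(k < n) g k + \sum_(i < N) cmod (h (i + n)%N) = \sum_(k < n + N) g k.
  rewrite big_split_ord /=; congr (_ + _); apply: eq_bigr => i _.
  by rewrite /g /= addnC.
by rewrite -(big_mkord xpredT g); apply: sumle_fin gM (iota_uniq _ _).
Unshelve. all: by end_near.
Qed.

Variables (f : C -> C -> C) (a : nat -> nat -> C).
Let c (k : nat * nat) := a k.1 k.2.

(** Absolute convergence at the real point (d, d) is the norm bound, and regrouping by total degree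
    identifies the limit of the homogeneous sums with the unordered sum. Taking d = d0 / 2 keeps the
    closed bidisc in the open domain. *)
Lemma taylor_pev : taylor_at0 f a -> exists d M : R, [/\ 0 < d, pn d c M &
  forall x t, cmod x <= d -> cmod t <= d -> f x t = pev c x t].
Proof.
move=> [d0 d00 H]; pose d := d0 / 2.
have dp : 0 < d by rewrite divr_gt0.
have dd : d < d0 by rewrite /d; lra.
have Dd : cmod (d%:C%C : C) = d by rewrite cmod_real ger0_norm// ltW.
have [||H1 _] := H d%:C%C d%:C%C; rewrite ?Dd//.
pose g (k : nat * nat) := cmod (c k) * d ^+ (k.1 + k.2).
have gE k : (cmod (a k.1 k.2 * (d%:C%C : C) ^+ k.1 * (d%:C%C : C) ^+ k.2)) = g k.
  by rewrite !cmodM !cmodX Dd /g exprD mulrA.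
have gE' : (\esum_(k in [set: nat * nat]) (g k)%:E < +oo)%E.
  by move: H1; rewrite (eq_esum (b := fun k => (g k)%:E))// => k _; rewrite gE.
have cM : pn d c (fine (\esum_(k in [set: nat * nat]) (g k)%:E)%E).
  split; first by move=> k; rewrite mulr_ge0// exprn_ge0// ltW.
  rewrite fineK// ge0_fin_numE// esum_ge0// => k _.
  by rewrite lee_fin mulr_ge0// exprn_ge0// ltW.
exists d, (fine (\esum_(k in [set: nat * nat]) (g k)%:E)%E); split=> // x t xd td.
have [_ H2] := H x t (le_lt_trans xd dd) (le_lt_trans td dd).
have hM := pn_asum cM xd td.
have [_ fM fE] := csum_fiber (fun k : nat * nat => (k.1 + k.2)%N) hM.
rewrite /pev fE; have := csum_cvg fM.
have -> : (fun n => \sum_(k < n) csum (fun i : nat * nat =>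
    if (i.1 + i.2)%N == k then c i * mon x t i else 0)) = (fun n => \sum_(k < n) homog_part a k x t).
  apply/funext => n; apply: eq_bigr => k _; rewrite /homog_part.
  pose s := [seq (i, (k - i)%N) | i <- iota 0 k.+1].
  have us : uniq s by rewrite map_inj_uniq ?iota_uniq// => ? ? [].
  have sE i : i \notin s -> (if (i.1 + i.2)%N == k then c i * mon x t i else 0) = 0.
    move=> si; case: eqP => // ik; case/negP: si; apply/mapP; exists i.1.
      by rewrite mem_iota add0n ltnS -ik leq_addr.
    by rewrite -ik addKn; exact: surjective_pairing.
  have [_ ->] := csum_fin us sE; rewrite big_map.
  rewrite -(big_mkord xpredT (fun i => a i (k - i)%N * x ^+ i * t ^+ (k - i))) /index_iota subn0.
  rewrite big_seq [RHS]big_seq; apply: eq_bigr => i; rewrite mem_iota add0n ltnS => /= ik.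
  by rewrite subnKC// eqxx /c /mon /= mulrA.
move=> H3; exact: (cvg_unique (@norm_hausdorff C C) H2 H3).
Qed.

Hypothesis f_an : taylor_at0 f a.
Variable m : nat.
Hypothesis f_reg : mini_regular a m.

Lemma homog_coef k : (k < m)%N -> forall i j, (i + j)%N = k -> a i j = 0.
Proof.
move=> km i j ijk; case: f_reg => -[H _] _.
pose P : {poly C} := \poly_(i < k.+1) a i (k - i)%N.
have P0 x : ser (fun n => P`_n) x = 0.
  rewrite ser_poly horner_poly -[RHS](H k km x 1); apply: eq_bigr => l _.
  by rewrite expr1n mulr1.
have [M PM] := cv1_poly P (ler01 : 0 <= 1 :> R).
have := ser_eq0 ltr01 PM ltr01 (fun t _ _ => P0 t) i.
by rewrite coef_poly -ijk ltnS leq_addr addKn.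
Qed.

Lemma regular_order : has_order c m.
Proof.
split=> [i im|]; first by apply: (homog_coef im); rewrite addn0.
case: f_reg => _; apply: contraNneq => a0.
rewrite /homog_part big_ord_recr /= subnn expr1n !mulr1 -[a m 0%N]/(c (m, 0%N)) a0 addr0.
by apply/eqP; apply: big1 => i _; rewrite expr0n subn_eq0 leqNgt ltn_ord /= mulr0.
Qed.

(** Where |y| <= kap |x|, every monomial of degree at least m other than x^m either contains y or
    has degree above m, and gains a factor kap in each case; so the term x^m dominates. This uses
    the order of f in both variables, beyond regularity in x. *)
Lemma cone : exists2 K : R, 0 < K & near2 (fun x y => f x y = 0 -> cmod x <= K * cmod y).
Proof.
have [d [M [d0 cM fE]]] := taylor_pev f_an; have M0 := sumle_ge0 cM.
have [_ am] := regular_order; set q := cmod (c (m, 0%N)).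
have q0 : 0 < q by rewrite cmod_gt0.
pose M' := M / d ^+ m; have M'0 : 0 <= M' by rewrite divr_ge0// exprn_ge0// ltW.
pose kap := Num.min 1 (q / (4 * M' + 1)).
have k0 : 0 < kap by rewrite lt_min ltr01 divr_gt0//; lra.
have k1 : kap <= 1 by rewrite ge_min lexx.
have kM : M' * kap <= q / 4.
  have : kap <= q / (4 * M' + 1) by rewrite ge_min lexx orbT.
  rewrite ler_pdivlMr; last lra.
  nra.
pose e := Num.min d (d * kap).
have e0 : 0 < e by rewrite lt_min d0 mulr_gt0.
have ed : e <= d by rewrite ge_min lexx.
have ek : e <= d * kap by rewrite ge_min lexx orbT.
exists kap^-1; first by rewrite invr_gt0.
exists e => // x y xe ye f0; rewrite leNgt; apply/negP => yx.
have x0 : 0 < cmod x.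
  by apply: le_lt_trans yx; rewrite mulr_ge0// invr_ge0 ltW.
have {}yx : cmod y <= kap * cmod x by move: yx; rewrite ltr_pdivrMl// => /ltW.
have xd := le_trans xe ed; have yd := le_trans ye ed.
pose T (k : nat * nat) := if k == (m, 0%N) then 0 else c k * mon x y k.
have small : asum T (cmod x ^+ m * (q / 2)).
  have xdk : cmod x / d <= kap by rewrite ler_pdivrMr// mulrC (le_trans xe).
  have W0 : 0 <= cmod x ^+ m / d ^+ m * kap.
    by rewrite !mulr_ge0 ?invr_ge0 ?exprn_ge0// ltW.
  have le1 : cmod x ^+ m / d ^+ m * kap * M <= cmod x ^+ m * (q / 2).
    have -> : cmod x ^+ m / d ^+ m * kap * M = cmod x ^+ m * (M' * kap) by rewrite /M'; ring.
    rewrite ler_wpM2l ?exprn_ge0//; lra.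
  apply: sumle_weak le1; apply: asum_dom (sumleZ W0 cM) _ => -[i j]; rewrite /T.
  case: eqP => [_|ij]; first by rewrite cmod0 !mulr_ge0 ?invr_ge0 ?exprn_ge0// ltW.
  have [ijm|mij] := ltnP (i + j) m.
    by rewrite /c /= (homog_coef ijm erefl) mul0r cmod0 mul0r mulr0.
  rewrite cmodM [leRHS]mulrCA ler_wpM2l//= cmodM !cmodX /=.
  have h1 : cmod x ^+ i * cmod y ^+ j <= cmod x ^+ (i + j) * kap ^+ j.
    rewrite exprD -mulrA ler_wpM2l ?exprn_ge0// -exprMn mulrC lerXn2r ?nnegrE// mulr_ge0//.
    exact: ltW.
  apply: (le_trans h1).
  have dm : d ^+ m != 0 by rewrite expf_neq0// gt_eqF.
  have xm0 : 0 <= cmod x ^+ m by rewrite exprn_ge0.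
  have -> : cmod x ^+ m / d ^+ m * kap * d ^+ (i + j) = cmod x ^+ m * (kap * d ^+ (i + j - m)).
    by rewrite -{1}(subnKC mij) exprD; field.
  rewrite -{1}(subnKC mij) exprD -mulrA ler_wpM2l//.
  case E : (i + j - m)%N => [|n].
    have j0 : (0 < j)%N.
      rewrite lt0n; apply/eqP => j0; apply: ij; rewrite j0; congr (_, _).
      by move: E mij; rewrite j0 addn0 => E mi; apply/eqP; rewrite eqn_leq mi -subn_eq0 E.
    rewrite !expr0 mul1r mulr1 -[leRHS]expr1; apply: ler_wiXn2l => //; exact: ltW.
  have kj : kap ^+ j <= 1 by rewrite exprn_ile1// ltW.
  apply: (@le_trans _ _ (cmod x ^+ n.+1)).
    by rewrite ler_piMr// exprn_ge0.
  have -> : cmod x ^+ n.+1 = cmod x / d * (d * cmod x ^+ n) by rewrite exprS; field; rewrite gt_eqF.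
  apply: ler_pM => //; first by rewrite divr_ge0// ltW.
    by rewrite mulr_ge0 ?exprn_ge0// ltW.
  by rewrite exprS ler_wpM2l ?(ltW d0)// lerXn2r ?nnegrE// ltW.
have E : f x y = c (m, 0%N) * x ^+ m + csum T.
  rewrite fE//; pose S (k : nat * nat) := if k == (m, 0%N) then c k * mon x y k else 0.
  have S0 k : k != (m, 0%N) -> S k = 0 by rewrite /S => /negPf ->.
  have SA := asum1 S0.
  rewrite /pev (eq_csum (h := fun k => S k + T k)); last first.
    by move=> k; rewrite /S /T; case: ifP; rewrite ?addr0 ?add0r.
  rewrite (csumD SA small) (csum1 S0) /S eqxx /mon /= mulr1//.
have := csum_le small; have -> : csum T = - (c (m, 0%N) * x ^+ m).
  by apply/eqP; rewrite -addr_eq0 addrC -E f0.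
rewrite cmodN cmodM cmodX -/q mulrC; apply/negP; rewrite -ltNge.
rewrite ltr_pM2l ?exprn_gt0//; lra.
Qed.

End Taylor.

(** * The roots with their contact orders and uniform estimates *)

Section Setup.
Context {R : realType}.
Local Notation C := (Cx R).

(* sE k l says that the k-th and l-th factors are the same series; otherwise they
   have contact order sd k l. *)
Record setup (f : C -> C -> C) (m : nat) := Setup {
  sN : nat; sz : nat -> C -> C; su : C -> C -> C;
  sdz : nat -> C -> C; sux : C -> C -> C; sut : C -> C -> C;
  sE : nat -> nat -> bool; sd : nat -> nat -> nat; sv : nat -> nat -> C -> C; sD : nat;
  sN0 : (0 < sN <= sD)%N;
  szA : forall k, ang (fun _ t => sz k t);
  sz0 : forall k, sz k 0 = 0;
  suA : ang su;
  su0 : su 0 0 != 0;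
  sF : near2 (fun x t => f x (t ^+ sN) = su x t * \prod_(k < m) (x - sz k t));
  sEP : forall k l, reflect (near1 (fun t => sz k t = sz l t)) (sE k l);
  svP : forall k l, ~~ sE k l -> [/\ ang (fun _ t => sv k l t), sv k l 0 != 0 &
    near1 (fun t => sz k t - sz l t = t ^+ sd k l * sv k l t)];
  sdN : forall k l, (k < m)%N -> (l < m)%N -> ~~ sE k l -> (sN <= sd k l <= sD)%N;
  su_est : ucst (fun A x t => [/\ A^-1 <= cmod (su x t), cmod (su x t) <= A,
    qd (fun y => su y t) x (sux x t) /\ cmod (sux x t) <= A &
    qd (fun s => su x s) t (sut x t) /\ cmod (sut x t) <= A]);
  sz_est : ucst (fun A _ t => forall k, (k < m)%N ->
    [/\ qd (sz k) t (sdz k t), cmod (sz k t) <= A * cmod t ^+ sN &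
     cmod (t * sdz k t) <= A * cmod t ^+ sN]);
  seq_est : ucst (fun A _ t => forall k l, (k < m)%N -> (l < m)%N -> sE k l ->
    sz l t = sz k t /\ sdz l t = sdz k t);
  sne_est : ucst (fun A _ t => forall k l, (k < m)%N -> (l < m)%N -> ~~ sE k l ->
    [/\ A^-1 * cmod t ^+ sd k l <= cmod (sz k t - sz l t),
     cmod (sz k t - sz l t) <= A * cmod t ^+ sd k l &
     cmod (t * (sdz k t - sdz l t) - (sd k l)%:R * (sz k t - sz l t)) <=
       A * cmod t * cmod (sz k t - sz l t)])
}.

Lemma ang_swap (F : C -> C -> C) : ang F -> ang (fun x t => F t x).
Proof.
move=> FA; pose G x t := F x t - F 0 0.
have GA : ang G := ang_sub FA (ang_const _).
have H := @ang_comp _ G (fun _ t => t) (fun x _ => x) GA (@ang_T R) (@ang_X R) erefl erefl.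
have := ang_add H (ang_const (F 0 0)).
by apply: (ang_near ltr01) => x t _ _; rewrite /G subrK.
Qed.

Lemma ang1_has_qd (h : C -> C) : ang (fun _ t => h t) ->
  exists dh, ucst (fun _ t _ => qd h t (dh t)).
Proof.
move=> hA; have [Fx [A A1 HA]] := ang_has_qd (ang_swap1 hA).
exists (fun t => Fx t 0); exists A => // B AB x t xB tB.
have z0 : cmod (0 : C) * B <= 1 by rewrite cmod0 mul0r.
by have [] := HA B AB x 0 xB z0.
Qed.

Lemma near1_qd (h g dh dg : C -> C) : near1 (fun t => h t = g t) ->
  ucst (fun _ t _ => qd h t (dh t)) -> ucst (fun _ t _ => qd g t (dg t)) ->
  ucst (fun _ t _ => h t = g t /\ dh t = dg t).
Proof.
move=> [e e0 hg] hq gq; have e2 : 0 < e / 2 by rewrite divr_gt0.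
have sm : near2 (fun t _ : C => cmod t <= e / 2) by exists (e / 2).
apply: ucst_imp (ucst_and (ucst_near2 sm) (ucst_and hq gq)) => A t _ [te [h1 h2]].
split; first by apply: hg; lra.
apply: qd_uniq h1 _; apply: qd_ext h2; exists (e / 2) => // y ye.
apply/esym/hg; have -> : y = (y - t) + t by rewrite subrK.
by apply: le_trans (cmodD _ _) _; lra.
Qed.

Lemma ucst_swap (P : R -> C -> C -> Prop) : ucst P -> ucst (fun A x t => P A t x).
Proof. by move=> [A A1 H]; exists A => // B AB x t xB tB; exact: H. Qed.

Lemma le_expn_small (t : C) (p q : nat) : cmod t <= 1 -> (p <= q)%N ->
  cmod t ^+ q <= cmod t ^+ p.
Proof. by move=> t1 pq; apply: ler_wiXn2l. Qed.

Lemma ucst_le1 : ucst (fun (A : R) (x t : C) => [/\ 1 <= A, cmod x <= 1 & cmod t <= 1]).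
Proof.
exists 1 => // A A1 x t xA tA; split=> //.
  by apply: le_trans xA; rewrite ler_peMr.
by apply: le_trans tA; rewrite ler_peMr.
Qed.

(** A root is zero or t^k times a unit, with k >= N because of the cone; t d/dt does not lower that
    order. *)
Lemma root_est (h dh : C -> C) N (K : R) : ang (fun _ t => h t) -> h 0 = 0 ->
  ucst (fun _ t _ => qd h t (dh t)) -> near1 (fun t => cmod (h t) <= K * cmod t ^+ N) ->
  ucst (fun A _ t => [/\ qd h t (dh t), cmod (h t) <= A * cmod t ^+ N &
     cmod (t * dh t) <= A * cmod t ^+ N]).
Proof.
move=> hA h0 hq hK; have hq' := ucst_swap hq.
have [hz|[k [v [vA v0 hE]]]] := ang1_order hA.
  have cq : ucst (fun _ (t _ : C) => qd (fun _ : C => 0 : C) t 0).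
    by exists 1 => // A _ x t _ _; exact: qd_const.
  have H := near1_qd hz hq cq.
  apply: ucst_imp (ucst_and ucst_le1 (ucst_and hq' (ucst_swap H))) => A x t [[A1 _ _] [q [h1 h2]]].
  have h1' : h t = 0 := h1; have h2' : dh t = 0 := h2.
  by split=> //; rewrite ?h1' ?h2' ?mulr0 cmod0 mulr_ge0 ?exprn_ge0//; lra.
have [k0 H] := order_est vA v0 h0 hE hq.
have Nk := order_ge vA v0 hE hK.
(* The constant comes from |t h'| <= k |h| + A |t| |h| with A |t| <= 1. *)
apply: (@ucst_trans _ _ _ (fun A => (k%:R + 1) * A) (ucst_and ucst_le1 (ucst_and hq' H))).
move=> A A1 B kB AB x t xB tB [[_ _ t1] [q [_ h2 h3]]].
have tk := le_expn_small t1 Nk; have tN0 : 0 <= cmod t ^+ N by rewrite exprn_ge0.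
have h4 : cmod (h t) <= A * cmod t ^+ N.
  by apply: le_trans h2 _; rewrite ler_wpM2l//; lra.
split=> //; first by apply: le_trans h4 _; rewrite ler_wpM2r.
have At1 : A * cmod t <= 1.
  by apply: le_trans tB; rewrite mulrC ler_wpM2l.
have -> : t * dh t = (t * dh t - k%:R * h t) + k%:R * h t by rewrite subrK.
apply: le_trans (cmodD _ _) _; rewrite cmodM cmod_nat.
apply: (@le_trans _ _ ((k%:R + 1) * A * cmod t ^+ N)); last by rewrite ler_wpM2r.
have : A * cmod t * cmod (h t) <= 1 * cmod (h t) by rewrite ler_wpM2r.
have : k%:R * cmod (h t) <= k%:R * (A * cmod t ^+ N) by rewrite ler_wpM2l.
have := ler0n R k; nra.
Qed.

Lemma setup_exists (f : C -> C -> C) c (d M K : R) m : 0 < d -> pn d c M -> has_order c m ->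
  near2 (fun x t => f x t = pev c x t) ->
  near2 (fun x y => f x y = 0 -> cmod x <= K * cmod y) -> exists _ : setup f m, True.
Proof.
move=> d0 cM co fE fcone; have [N [z [u [N0 zP uA u0 Feq]]]] := NP_factor d0 cM co.
have zA k : ang (fun _ t => z k t) by case: (zP k).
have z0 k : z k 0 = 0 by case: (zP k).
have T0 : (0 : C) ^+ N = 0 by rewrite expr0n eqn0Ngt N0.
have FE : near2 (fun x t => f x (t ^+ N) = u x t * \prod_(k < m) (x - z k t)).
  have H := near2_comp fE (@ang_X R) (ang_Tn N) erefl T0.
  by apply: near2_imp (near2_and H Feq) => x t [-> ->].
have zK k : (k < m)%N -> near1 (fun t => cmod (z k t) <= K * cmod t ^+ N).
  move=> km; have H1 := near2_comp1 fcone (zA k) (ang_Tn N) (z0 k) T0.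
  have H2 := near2_comp1 FE (zA k) (@ang_T R) (z0 k) erefl.
  apply: near1_imp (near1_and H1 H2) => t [h1 h2]; rewrite -cmodX; apply: h1.
  by rewrite h2 (bigD1 (Ordinal km))//= subrr mul0r mulr0.
pose E k l := `[< near1 (fun t => z k t = z l t) >].
have EP k l : reflect (near1 (fun t => z k t = z l t)) (E k l) by exact: asboolP.
have /choice[dv dvP] : forall kl : nat * nat, exists dv : nat * (C -> C), ~~ E kl.1 kl.2 ->
    [/\ ang (fun _ t => dv.2 t), dv.2 0 != 0 &
     near1 (fun t => z kl.1 t - z kl.2 t = t ^+ dv.1 * dv.2 t)].
  move=> [k l] /=; have [|[p [v [vA v0 vE]]]] := ang1_order (ang_sub (zA k) (zA l)).
    move=> [e e0 H]; exists (0%N, fun=> 0); case/EP; exists e => // t /H /eqP.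
    by rewrite subr_eq0 => /eqP.
  by exists (p, v).
pose dd k l := (dv (k, l)).1; pose v k l := (dv (k, l)).2.
have vP k l : ~~ E k l -> [/\ ang (fun _ t => v k l t), v k l 0 != 0 &
    near1 (fun t => z k t - z l t = t ^+ dd k l * v k l t)].
  exact: (dvP (k, l)).
(* A convenient common bound of the contact orders; N is added so that N <= D even when all factors
   agree. *)
pose D := (N + \sum_(k < m) \sum_(l < m) dd k l)%N.
have ddN k l : (k < m)%N -> (l < m)%N -> ~~ E k l -> (N <= dd k l <= D)%N.
  move=> km lm ek; have [vA v0 vE] := vP k l ek; apply/andP; split.
    apply: (order_ge vA v0 vE (K := K + K)).
    apply: near1_imp (near1_and (zK k km) (zK l lm)) => t [h1 h2].
    by apply: le_trans (cmodB _ _) _; rewrite mulrDl lerD.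
  rewrite /D (bigD1 (Ordinal km))//= (bigD1 (Ordinal lm))//=.
  by rewrite addnA addnCA -!addnA leq_addr.
have /choice[dz dzP] : forall k, exists dh, ucst (fun _ t _ => qd (z k) t (dh t)).
  by move=> k; exact: ang1_has_qd.
have [ux uxP] := ang_has_qd uA; have [ut utP] := ang_has_qd (ang_swap uA).
unshelve eexists (@Setup f m N z u dz ux (fun x t => ut t x) E dd v D
  _ zA z0 uA u0 FE EP vP ddN _ _ _ _) => //.
- by rewrite N0 leq_addr.
- apply: ucst_imp (ucst_and (ucst_lb uA u0) (ucst_and (ucst_bound uA)
    (ucst_and uxP (ucst_swap utP)))) => A x t [h1 [h2 [h3 h4]]].
  by split.
- apply: ucst_forall => k km; exact: root_est (zA k) (z0 k) (dzP k) (zK k km).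
- have H k l : (k < m)%N -> (l < m)%N -> ucst (fun A (_ t : C) => E k l ->
     z l t = z k t /\ dz l t = dz k t).
    move=> km lm; have [/EP ekl|nkl] := boolP (E k l); last by exists 1.
    have H := ucst_swap (near1_qd ekl (dzP k) (dzP l)).
    by apply: ucst_imp H => A x t [-> ->].
  have := ucst_forall (fun k km => ucst_forall (fun l lm => H k l km lm)).
  by apply: ucst_imp => A x t h k l km lm; exact: h.
have H k l : (k < m)%N -> (l < m)%N -> ucst (fun A (_ t : C) => ~~ E k l ->
    [/\ A^-1 * cmod t ^+ dd k l <= cmod (z k t - z l t),
     cmod (z k t - z l t) <= A * cmod t ^+ dd k l &
     cmod (t * (dz k t - dz l t) - (dd k l)%:R * (z k t - z l t)) <=
       A * cmod t * cmod (z k t - z l t)]).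
  move=> km lm; have [|ekl] := boolP (E k l); first by exists 1.
  have [vA v0 vE] := vP k l ekl.
  have dq : ucst (fun _ t (_ : C) => qd (fun t => z k t - z l t) t (dz k t - dz l t)).
    apply: ucst_imp (ucst_and (dzP k) (dzP l)) => A x t [h1 h2].
    by apply: qd_add => //; exact: qd_opp.
  have [|_ H] := order_est vA v0 _ vE dq; first by rewrite !z0 subrr.
  by apply: ucst_imp H => A x t h _.
have := ucst_forall (fun k km => ucst_forall (fun l lm => H k l km lm)).
by apply: ucst_imp => A x t h k l km lm; exact: h.
Qed.

End Setup.

(** * The gradient inequality *)

Section Upper.
Context {R : realType}.
Local Notation C := (Cx R).

Lemma norm2_ge1 (a b : C) : cmod a <= norm2 a b.
Proof.
rewrite -[leLHS](ger0_norm (cmod_ge0 a)) -sqrtr_sqr ler_sqrt ?lerDl ?sqr_ge0//.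
by rewrite addr_ge0 ?sqr_ge0.
Qed.

Lemma norm2_ge2 (a b : C) : cmod b <= norm2 a b.
Proof.
rewrite -[leLHS](ger0_norm (cmod_ge0 b)) -sqrtr_sqr ler_sqrt ?lerDr ?sqr_ge0//.
by rewrite addr_ge0 ?sqr_ge0.
Qed.

Lemma norm2_le (a b : C) : norm2 a b <= cmod a + cmod b.
Proof.
rewrite -[leRHS]ger0_norm ?addr_ge0// -sqrtr_sqr ler_sqrt ?sqr_ge0//.
rewrite sqrrD -addrAC lerDl mulrn_wge0// mulr_ge0//.
Qed.

Lemma norm2_ge0 (a b : C) : 0 <= norm2 a b.
Proof. exact: sqrtr_ge0. Qed.

(** Taking H-th roots gives c^(1/H) rho <= F^(N/H); eliminating [rho] leaves F^(1 - N/H). *)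
Lemma power_final (F rho g c K : R) (N H : nat) : (0 < N <= H)%N -> 0 < F -> 0 < rho ->
  0 < c -> 0 < K -> c * rho ^+ H <= F ^+ N -> F <= K * rho * g ->
  c `^ (H%:R)^-1 / K * F `^ (1 - N%:R / H%:R) <= g.
Proof.
move=> /andP[N0 NH] F0 r0 c0 K0 h1 h2.
have H0 : 0 < H%:R :> R by rewrite ltr0n (leq_trans N0).
have E : F `^ (1 - N%:R / H%:R) * F `^ (N%:R / H%:R) = F.
  by rewrite -powRD ?subrK ?powRr1 ?(ltW F0)// gt_eqF// implybT.
have h3 : c `^ (H%:R)^-1 * rho <= F `^ (N%:R / H%:R).
  rewrite powRrM powR_mulrn ?(ltW F0)//.
  have -> : rho = (rho ^+ H) `^ (H%:R)^-1.
    by rewrite -powR_mulrn ?(ltW r0)// -powRrM divff ?gt_eqF// powRr1// ltW.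
  rewrite -powRM ?exprn_ge0 ?(ltW r0) ?(ltW c0)//.
  by apply: ge0_ler_powR;
    rewrite ?nnegrE ?invr_ge0 ?ler0n ?mulr_ge0 ?exprn_ge0 ?(ltW r0) ?(ltW c0) ?(ltW F0).
have P0 := powR_ge0 F (1 - N%:R / H%:R).
have : F `^ (1 - N%:R / H%:R) * (c `^ (H%:R)^-1 * rho) <= K * rho * g.
  by apply: le_trans h2; rewrite -[leRHS]E ler_wpM2l.
move=> h4; rewrite mulrAC ler_pdivrMr// -(ler_pM2r r0).
by move: (_ `^ _) (F `^ _) h4 {P0 h3 E} => p q; rewrite mulrA [q * p]mulrC -!mulrA [g * _]mulrC -!mulrA.
Qed.

Lemma prod_ord1 n (h : nat -> C) : n = 1%N -> \prod_(k < n) h k = h 0%N.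
Proof. by move=> ->; rewrite big_ord1. Qed.

Variables (f : C -> C -> C) (m : nat).
Hypothesis fA : ang f.
Variable S : setup f m.
Local Notation N := (sN S).
Local Notation z := (sz S).
Local Notation u := (su S).
Local Notation dz := (sdz S).
Local Notation ux := (sux S).
Local Notation ut := (sut S).

Definition fx (x y : C) : C := derive1 (fun s => f s y) x.
Definition fy (x y : C) : C := derive1 (fun s => f x s) y.

(** f_y is reached through the ramified variable, as t d/dt of f(x, t^N) is N t^N f_y. The factor t
    is kept on both sides, so the formula includes t = 0. *)
Lemma grad_formula : ucst (fun A x t => f x (t ^+ N) = u x t * \prod_(k < m) (x - z k t) /\
  ((forall k, (k < m)%N -> x != z k t) ->
   fx x (t ^+ N) = f x (t ^+ N) * (ux x t / u x t + \sum_(k < m) (x - z k t)^-1) /\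
   N%:R * t ^+ N * fy x (t ^+ N) =
    t * (f x (t ^+ N) * (ut x t / u x t - \sum_(k < m) dz k t / (x - z k t))))).
Proof.
have [e e0 He] := sF S; have e2 : 0 < e / 2 by rewrite divr_gt0.
have sm : near2 (fun x t : C => cmod x <= e / 2 /\ cmod t <= e / 2) by exists (e / 2).
have [Fy [A2 A21 HA2]] := ang_has_qd (ang_swap fA).
have fyP : ucst (fun A x t => exists L, qd (fun s => f x s) (t ^+ N) L).
  exists A2 => // B AB x t xB tB; exists (Fy (t ^+ N) x).
  have B1 : 1 <= B by apply: le_trans AB.
  have [N0 _] := andP (sN0 S).
  have tB' : cmod (t ^+ N) * B <= 1.
    have B0 : 0 <= B := le_trans ler01 B1.
    have t1 : cmod t <= 1 by apply: (le_trans _ tB); rewrite ler_peMr.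
    apply: le_trans tB; rewrite ler_wpM2r//.
    rewrite cmodX -[leRHS]expr1; apply: ler_wiXn2l => //.
  by have [] := HA2 B AB (t ^+ N) x tB' xB.
apply: ucst_imp (ucst_and ucst_le1 (ucst_and (ucst_and (ucst_near2 sm) fyP) (ucst_and (su_est S) (sz_est S)))).
move=> A x t [[A1 _ _] [[[xe te] [L fyL]] [[u1 _ [uxq _] [utq _]] zq]]].
have xe' : cmod x <= e by lra.
have te' : cmod t <= e by lra.
have FE := He x t xe' te'; split=> // xz.
have u0 : u x t != 0.
  by rewrite -cmod_gt0; apply: lt_le_trans u1; rewrite invr_gt0; lra.
have xz' k : (k < m)%N -> x - z k t != 0 by move=> /xz; rewrite subr_eq0.
have close s v : cmod v <= e / 2 -> cmod (s - v) <= e / 2 -> cmod s <= e.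
  move=> h1 h2; have -> : s = (s - v) + v by rewrite subrK.
  by apply: le_trans (cmodD _ _) _; lra.
split.
- apply: qd_derive1.
  have H1 : qd (fun s => \prod_(k < m) (s - z k t)) x
      ((\prod_(k < m) (x - z k t)) * \sum_(k < m) 1 / (x - z k t)).
    apply: (@qd_prod_log _ m (fun k s => s - z k t) (fun=> 1)) => k km; split; last exact: xz'.
    have := qd_add (qd_id x) (qd_const (- z k t) x); rewrite addr0.
    by apply: qd_ext; exists 1.
  have := qd_mul uxq H1; set P := \prod_(k < m) _ in FE *.
  have -> : u x t * (P * \sum_(k < m) 1 / (x - z k t)) + ux x t * P =
    f x (t ^+ N) * (ux x t / u x t + \sum_(k < m) (x - z k t)^-1).
    rewrite (eq_bigr (fun k : 'I_m => (x - z k t)^-1)); last by move=> k _; rewrite mul1r.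
    by rewrite FE; field.
  apply: qd_ext; exists (e / 2) => // y ye.
  exact/esym/(He _ _ (close y x xe ye) te').
have H1 : qd (fun s => \prod_(k < m) (x - z k s)) t
      ((\prod_(k < m) (x - z k t)) * \sum_(k < m) - dz k t / (x - z k t)).
  apply: (@qd_prod_log _ m (fun k s => x - z k s) (fun k => - dz k t)) => k km.
  split; last exact: xz'.
  have [q _ _] := zq k km.
  have := qd_add (qd_const x t) (qd_opp q); rewrite add0r.
  by apply: qd_ext; exists 1.
have H2 := qd_mul utq H1.
have H3 : qd (fun s => f x (s ^+ N)) t
    (u x t * ((\prod_(k < m) (x - z k t)) * \sum_(k < m) - dz k t / (x - z k t)) +
     ut x t * \prod_(k < m) (x - z k t)).
  apply: qd_ext H2; exists (e / 2) => // y ye.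
  exact/esym/(He _ _ xe' (close y t te ye)).
have [N0 _] := andP (sN0 S).
have H4 : qd (fun s => f x (s ^+ N)) t (N%:R * t ^+ N.-1 * L).
  apply: qd_comp => //; have := qd_exp N.-1 t; rewrite prednK//.
rewrite /fy (qd_derive1 fyL).
have E := qd_uniq H3 H4.
have -> : N%:R * t ^+ N * L = t * (N%:R * t ^+ N.-1 * L).
  by rewrite -{2}(prednK N0) exprS; ring.
rewrite -E FE; congr (t * _).
have -> : \sum_(k < m) - dz k t / (x - z k t) = - \sum_(k < m) dz k t / (x - z k t).
  by rewrite -sumrN; apply: eq_bigr => k _; rewrite mulNr.
by field.
Qed.

Lemma grad_formula1 : m = 1%N -> ucst (fun A x t => x = z 0 t -> fx x (t ^+ N) = u x t).
Proof.
move=> m1; have [e e0 He] := sF S; have e2 : 0 < e / 2 by rewrite divr_gt0.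
have sm : near2 (fun x t : C => cmod x <= e / 2 /\ cmod t <= e / 2) by exists (e / 2).
apply: ucst_imp (ucst_and (ucst_near2 sm) (su_est S)).
move=> A x t [[xe te] [u1 _ [uxq _] _]] xE.
have te' : cmod t <= e by lra.
apply: qd_derive1.
have := qd_mul uxq (qd_add (qd_id x) (qd_const (- z 0 t) x)).
have -> : u x t * (1 + 0) + ux x t * (id x - z 0 t) = u x t.
  by rewrite /= -xE subrr; ring.
apply: qd_ext; exists (e / 2) => // y ye.
rewrite He//; last first.
  have -> : y = (y - x) + x by rewrite subrK.
  by apply: le_trans (cmodD _ _) _; lra.
by rewrite (prod_ord1 (fun k => y - z k t) m1).
Qed.

Lemma upper (H : nat) : (0 < m)%N -> (m * N <= H)%N ->
  (forall k s, (k < m)%N -> (s < m)%N -> ~~ sE S k s ->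
    (\sum_(l < m) (if sE S k l then sd S k s else minn (sd S k l) (sd S k s)) <= H)%N) ->
  gradient_exponents f (1 - N%:R / H%:R).
Proof.
move=> m0 mH HH; have /andP[N0 ND] := sN0 S.
have NH : (N <= H)%N by apply: leq_trans mH; rewrite leq_pmull //.
have H0 : (0 < H)%N by exact: leq_trans NH.
have [A0 A01 HA] := ucst_and (ucst_and (ucst_and (su_est S) (sz_est S))
   (ucst_and (seq_est S) (sne_est S))) grad_formula.
have [A1 A11 HA1] : ucst (fun A x t => m = 1%N -> x = z 0 t -> fx x (t ^+ N) = u x t).
  have [m1|/eqP m1] := eqVneq m 1%N; last by exists 1.
  by apply: ucst_imp (grad_formula1 m1) => A x t h _.
pose A := Num.max A0 A1.
have AA0 : A0 <= A by rewrite le_max lexx.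
have AA1 : A1 <= A by rewrite le_max lexx orbT.
have Age1 : 1 <= A by apply: le_trans AA0.
have [K [c [B [K0 c0 AB reg]]]] := regions Age1 (sN0 S) m0 mH.
have {}HA := HA A AA0; have {}HA1 := HA1 A AA1.
have Ap : 0 < A := lt_le_trans ltr01 Age1.
clearbody A; clear AA0 AA1 A01 A11 A0 A1.
(* The 2 comes from [regions], the N from writing the t-derivative as N t^N f_y. *)
pose K' := 2 * N%:R + K.
have K'0 : 0 < K' by rewrite /K' ltr_wpDl// mulr_ge0.
pose c1 := c `^ (H%:R)^-1 / K'.
have c10 : 0 < c1 by rewrite divr_gt0// powR_gt0.
pose c2 := Num.min c1 A^-1.
have c20 : 0 < c2 by rewrite lt_min c10 invr_gt0; lra.
have B1 : 1 <= B by lra.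
have Bi : 0 < B^-1 by rewrite invr_gt0; lra.
split.
  rewrite subr_ge0 ler_pdivrMr ?ltr0n// mul1r ler_nat//.
exists c2, (B^-1 ^+ N); split=> //; first by rewrite exprn_gt0.
move=> x y xy.
have [t tE] : exists t : C, t ^+ N = y by exists (N.-root y); rewrite rootCK.
have xs : cmod x <= B^-1.
  apply: le_trans (ltW (le_lt_trans (norm2_ge1 x y) xy)) _.
  rewrite -[leRHS]expr1; apply: ler_wiXn2l => //; first exact: ltW.
  by rewrite invf_le1//; lra.
have ts : cmod t <= B^-1.
  rewrite -(ler_pXn2r N0) ?nnegrE ?(ltW Bi)//.
  by rewrite -cmodX tE (ltW (le_lt_trans (norm2_ge2 x y) xy)).
have B0 : 0 < B by lra.
have xB : cmod x * B <= 1 by rewrite -ler_pdivlMr// mul1r.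
have tB : cmod t * B <= 1 by rewrite -ler_pdivlMr// mul1r.
have xA : cmod x * A <= 1 by apply: le_trans xB; rewrite ler_wpM2l.
have tA : cmod t * A <= 1 by apply: le_trans tB; rewrite ler_wpM2l.
have [[[[u1 u2 [_ uxA] [_ utA]] zest] [est1 est2]] [FE Fd]] := HA x t xA tA.
rewrite /grad_norm -/(fx x y) -/(fy x y) -tE.
have g1 : cmod (fx x (t ^+ N)) <= norm2 (fx x (t ^+ N)) (fy x (t ^+ N)) := norm2_ge1 _ _.
have g2 : cmod (fy x (t ^+ N)) <= norm2 (fx x (t ^+ N)) (fy x (t ^+ N)) := norm2_ge2 _ _.
have g0 : 0 <= norm2 (fx x (t ^+ N)) (fy x (t ^+ N)) := norm2_ge0 _ _.
move: (norm2 _ _) g1 g2 g0 => g g1 g2 g0.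
have [F0|F0] := eqVneq (f x (t ^+ N)) 0; last first.
  have xz k : (k < m)%N -> x != z k t.
    move=> km; apply: contraNneq F0 => xE.
    by rewrite FE (bigD1 (Ordinal km))//= xE subrr mul0r mulr0.
  have [fxE fyE] := Fd xz.
  have [rho [r0 rH rF]] := reg x t (fun k => z k t) (fun k => dz k t) (sE S) (sd S)
    _ _ _ _ _ _ xB tB
    (fun k _ => introT (sEP S k k) (ex_intro2 _ _ 1 ltr01 (fun _ _ => erefl)))
    (sdN (s := S)) est1 est2 HH (fun k km => let: And3 _ a b := zest k km in conj a b) xz u1 uxA utA
    FE fxE erefl.
  have Fp : 0 < cmod (f x (t ^+ N)) by rewrite cmod_gt0.
  have NHH : (0 < N <= H)%N by rewrite N0.
  have Fg : cmod (f x (t ^+ N)) <= K' * rho * g.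
    have k1 := ler_wpM2l (mulr_ge0 (ltW K0) (ltW r0)) g1.
    have k3 : 0 <= 2 * N%:R * rho := mulr_ge0 (mulr_ge0 (ler0n _ 2) (ler0n _ N)) (ltW r0).
    have k2 : 0 <= 2 * N%:R * rho * g := mulr_ge0 k3 g0.
    have -> : K' * rho * g = 2 * N%:R * rho * g + K * rho * g by rewrite /K'; ring.
    case: rF => [h|[t0 rE h]].
      by apply: (le_trans h); apply: (le_trans k1); rewrite lerDr.
    move: h; rewrite -fyE !cmodM cmod_nat cmodX -rE => h.
    have k4 := ler_wpM2l k3 g2.
    apply: (le_trans h); apply: lerD k1.
    by apply: le_trans k4; rewrite -!mulrA.
  have := power_final NHH Fp r0 c0 K'0 rH Fg.
  by apply: le_trans; rewrite ler_wpM2r ?powR_ge0// ge_min lexx.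
rewrite F0 cmod0.
(* On the zero set a positive exponent makes the left side 0. Exponent 0 means H = N, and then m N
   <= H forces m = 1. *)
have [NH1|NH1] := eqVneq H N; last first.
  rewrite powR0 ?mulr0// subr_eq0 eq_sym.
  rewrite -subr_eq0 (_ : _ - 1 = (N%:R - H%:R) / H%:R); last first.
    by field; rewrite pnatr_eq0 -lt0n.
  by rewrite mulf_neq0 ?invr_eq0 ?pnatr_eq0 -?lt0n// subr_eq0 eqr_nat eq_sym.
have m1 : m = 1%N.
  by apply/eqP; rewrite eqn_leq m0 andbT -(leq_pmul2r N0) mul1n -{2}NH1.
have xE : x = z 0 t.
  move: F0; rewrite FE => /eqP; rewrite mulf_eq0 -cmod_eq0 gt_eqF /=; last first.
    by apply: lt_le_trans u1; rewrite invr_gt0.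
  by rewrite (prod_ord1 (fun k => x - z k t) m1) subr_eq0 => /eqP.
rewrite NH1 divff ?pnatr_eq0 -?lt0n// subrr powRr0 mulr1.
apply: (@le_trans _ _ A^-1); first by rewrite ge_min lexx orbT.
apply: le_trans u1 _; by rewrite -(HA1 x t xA tA m1 xE).
Qed.

End Upper.

(** * Lower bound for the exponent *)

Section Critical.
Context {R : realType}.
Local Notation C := (Cx R).

Lemma mem_rem_neq (T : eqType) (s : seq T) (x y : T) : x \in s -> x != y -> x \in rem y s.
Proof.
elim: s => //= a s IH; rewrite inE => /predU1P[->|xs] xy.
  by rewrite (negPf xy) inE eqxx.
by case: ifP => // _; rewrite inE IH// orbT.
Qed.

(* The logarithmic derivative of a polynomial with at least two distinct roots vanishes
   somewhere off the roots. *)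
Lemma critical_value (rs : seq C) (r1 r2 : C) : r1 \in rs -> r2 \in rs -> r1 != r2 ->
  exists (P : {poly C}) (g0 : C), [/\ P != 0, root P g0, g0 \notin rs &
   forall g, g \notin rs ->
    \sum_(w <- rs) (g - w)^-1 = P.[g] / \prod_(w <- undup rs) (g - w)].
Proof.
move=> r1s r2s r12; pose U := undup rs.
have uU : uniq U := undup_uniq rs.
pose Q r : {poly C} := \prod_(s <- rem r U) ('X - s%:P).
(* Numerator of the logarithmic derivative over the distinct roots, with multiplicities as weights.
   At a root only its own term survives, so [P] vanishes at none of them. *)
pose P : {poly C} := \sum_(r <- U) (count_mem r rs)%:R *: Q r.
have U2 : (1 < size U)%N.
  have : (size [:: r1; r2] <= size U)%N.
    apply: uniq_leq_size; first by rewrite /= inE r12.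
    by move=> w; rewrite !inE mem_undup => /orP[] /eqP ->.
  by [].
have Proot r : r \in U -> P.[r] != 0.
  move=> rU; rewrite /P horner_sum (bigD1_seq r)//= big_seq_cond big1 ?addr0.
    rewrite hornerZ mulf_neq0//.
      by rewrite pnatr_eq0 -lt0n -has_count has_pred1 -mem_undup.
    rewrite horner_prod prodf_seq_neq0; apply/allP => s; rewrite mem_rem_uniq// inE => /andP[sr _].
    by rewrite /= hornerXsubC subr_eq0 eq_sym.
  move=> s /andP[sU sr]; rewrite hornerZ horner_prod.
  have : r \in rem s U by rewrite mem_rem_neq// eq_sym.
  by move=> /(big_rem r) -> /=; rewrite hornerXsubC subrr mul0r mulr0.
have P0 : P != 0.
  have rU : r1 \in U by rewrite mem_undup.
  by apply: contraNneq (Proot r1 rU) => ->; rewrite horner0.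
have sQ r : r \in U -> size (Q r) = size U.
  by move=> rU; rewrite size_prod_XsubC size_rem// prednK// ltnW.
(* The top coefficient is the total multiplicity of the roots, so P has degree size U - 1 >= 1 and
   therefore a root. *)
have cP : P`_(size U).-1 != 0.
  rewrite coef_sum (eq_big_seq (fun r => (count_mem r rs)%:R)); last first.
    move=> r rU; rewrite coefZ -(sQ r rU) -[X in _ * X]/(lead_coef (Q r)).
    by rewrite lead_coef_prod_XsubC mulr1.
  rewrite -natr_sum pnatr_eq0 (bigD1_seq r1) ?mem_undup//= addn_eq0 negb_and.
  by rewrite -lt0n -has_count has_pred1 r1s.
have [g0 rg] : exists g0, root P g0.
  apply/closed_rootP; rewrite neq_ltn; apply/orP; right.
  apply: (leq_trans U2); rewrite leqNgt; apply/negP => h.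
  by move: cP; rewrite nth_default ?eqxx// -ltnS prednK// ltnW.
exists P, g0; split=> //.
  apply/negP; rewrite -mem_undup => /Proot; by rewrite -rootE rg.
move=> g gs.
have gU r : r \in U -> g - r != 0.
  by rewrite mem_undup subr_eq0 => rrs; apply: contraNneq gs => ->.
have -> : \sum_(w <- rs) (g - w)^-1 = \sum_(r <- U) (g - r)^-1 *+ count_mem r rs.
  rewrite -[LHS]big_undup_iterop_count; apply: eq_bigr => r _.
  by rewrite Monoid.iteropE iter_addr_0.
rewrite /P horner_sum mulr_suml; apply: eq_big_seq => r rU.
rewrite hornerZ horner_prod (big_rem r rU) /= -mulr_natl.
rewrite (eq_bigr (fun s => g - s)); last by move=> s _; rewrite hornerXsubC.
have p0 : \prod_(s <- rem r U) (g - s) != 0.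
  rewrite prodf_seq_neq0; apply/allP => s /mem_rem sU /=; exact: gU.
by field; rewrite p0 gU.
Qed.

End Critical.

(** * The gradient along a curve *)

Section Lower.
Context {R : realType}.
Local Notation C := (Cx R).

Lemma ucst_near (P : R -> C -> C -> Prop) : ucst P -> exists2 A, 1 <= A & near2 (P A).
Proof.
move=> [A A1 H]; exists A => //; exists A^-1; first by rewrite invr_gt0; lra.
have A0 : 0 < A by lra.
by move=> x t xA tA; apply: H => //; rewrite -ler_pdivlMr// mul1r.
Qed.

Lemma near1_small (e : R) : 0 < e -> near1 (fun t : C => cmod t <= e).
Proof. by exists e. Qed.

Variables (f : C -> C -> C) (m : nat).
Hypothesis fA : ang f.
Variable S : setup f m.
Local Notation N := (sN S).
Local Notation z := (sz S).
Local Notation u := (su S).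
Local Notation dz := (sdz S).

Section Curve.
(** The curve is x = z_i + g(s) t^rho with t = s^M; the further variable s is there because g may be
    a Puiseux series in t. [del] and [b] split z_i - z_l into a power of t of exponent at most rho
    and a cofactor. *)
Variables (i rho : nat) (del : nat -> nat) (b : nat -> C -> C) (g : C -> C) (M : nat).
Hypotheses (im : (i < m)%N) (Nrho : (N <= rho)%N) (M0 : (0 < M)%N).
Hypothesis del_rho : forall l, (l < m)%N -> (del l <= rho)%N.
Hypothesis bA : forall l, (l < m)%N -> ang (fun _ t => b l t).
Hypothesis bE : forall l, (l < m)%N -> near1 (fun t => z i t - z l t = t ^+ del l * b l t).
Hypothesis gA : ang (fun _ s => g s).
Hypothesis g0 : forall l, (l < m)%N -> g 0 * 0 ^+ (rho - del l) + b l 0 != 0.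

(** The quotient (x - z_l) / t^(del l) along the curve; [g0] says that it is nonzero at s = 0. *)
Definition Lf l (s : C) := g s * (s ^+ M) ^+ (rho - del l) + b l (s ^+ M).
Definition xs (s : C) := z i (s ^+ M) + g s * (s ^+ M) ^+ rho.

(** The sum is t^rho prod_l Lf_l times sum_k 1 / (x - z_k), cleared of denominators. In the
    alternative rho = N each 1 / (x - z_k) is by itself O(|t|^-N). *)
Hypothesis crit : near1 (fun s => \sum_(k < m) (s ^+ M) ^+ (rho - del k) *
   \prod_(l < m | l != k) Lf l s = 0) \/ rho = N.

Let T0 : (0 : C) ^+ M = 0. Proof. by rewrite expr0n eqn0Ngt M0. Qed.

Lemma xs_ang : ang (fun _ s => xs s) /\ xs 0 = 0.
Proof.
split.
  apply: ang_add; first exact: (ang_comp1 (szA S i) (ang_Tn M) T0).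
  by apply: ang_mul => //; apply: ang_exp; exact: ang_Tn.
have r0 : (0 < rho)%N by case/andP: (sN0 S) => N0 _; exact: leq_trans Nrho.
by rewrite /xs T0 sz0 expr0n eqn0Ngt r0 mulr0 addr0.
Qed.

Lemma Lf_ang l : (l < m)%N -> ang (fun _ s => Lf l s) /\ Lf l 0 != 0.
Proof.
move=> lm; split; last by rewrite /Lf T0; exact: g0.
apply: ang_add; last exact: (ang_comp1 (bA lm) (ang_Tn M) T0).
by apply: ang_mul => //; apply: ang_exp; exact: ang_Tn.
Qed.

Lemma dist_Lf : near1 (fun s => forall l, (l < m)%N -> xs s - z l (s ^+ M) = (s ^+ M) ^+ del l * Lf l s).
Proof.
have H l : (l < m)%N -> ucst (fun (_ : R) (_ t : C) => z i t - z l t = t ^+ del l * b l t).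
  by move=> lm; exact: ucst_near1 (bE lm).
have [A A1 [e e0 He]] := ucst_near (ucst_forall H).
have H1 : near1 (fun t => forall l, (l < m)%N -> z i t - z l t = t ^+ del l * b l t).
  by exists e => // t te; apply: (He 0) => //; rewrite cmod0 ltW.
apply: near1_imp (near1_comp H1 (ang_Tn M) T0) => s h l lm.
rewrite /xs /Lf addrAC h// mulrDr addrC; congr (_ + _).
by rewrite mulrCA -exprD subnKC// del_rho.
Qed.

Local Notation H := (\sum_(l < m) del l)%N.

(** In f_x / f there remain u_x / u and, if rho = N, terms O(|t|^-N). For f_y one differentiates
    along t d/dt + t z_i' d/dx rather than along the curve: t (z_i' - z_k') is O(|z_i - z_k|), hence
    O(|x - z_k|), so t^N f_y is O(|f|) as well. *)
Lemma curve_est : exists2 C0 : R, 1 <= C0 & near1 (fun s => s != 0 ->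
  [/\ C0^-1 * cmod (s ^+ M) ^+ H <= cmod (f (xs s) ((s ^+ M) ^+ N)) &
   norm2 (fx f (xs s) ((s ^+ M) ^+ N)) (fy f (xs s) ((s ^+ M) ^+ N)) * cmod (s ^+ M) ^+ N <=
    C0 * cmod (s ^+ M) ^+ H]).
Proof.
have [A A1 dat] := ucst_near (ucst_and (ucst_and ucst_le1 (ucst_and (su_est S) (sz_est S)))
   (ucst_and (ucst_and (seq_est S) (sne_est S)) (grad_formula fA S))).
have [xA x0] := xs_ang.
have dat1 := near2_comp1 dat xA (ang_Tn M) x0 T0.
have HL l : (l < m)%N -> ucst (fun A _ s => [/\ A^-1 <= cmod (Lf l s), cmod (Lf l s) <= A &
    cmod (b l (s ^+ M)) <= A]).
  move=> lm; have [la l0] := Lf_ang lm.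
  have bM := ang_comp1 (bA lm) (ang_Tn M) T0.
  apply: ucst_imp (ucst_and (ucst_lb la l0) (ucst_and (ucst_bound la) (ucst_bound bM))) => B x s.
  by move=> [h1 [h2 h3]].
have [B B1 [e e0 datL]] := ucst_near (ucst_forall HL).
have {}datL : near1 (fun s => forall l, (l < m)%N -> [/\ B^-1 <= cmod (Lf l s),
    cmod (Lf l s) <= B & cmod (b l (s ^+ M)) <= B]).
  by exists e => // s se; apply: (datL 0) => //; rewrite cmod0 ltW.
have Hb : ucst (fun (_ : R) (_ t : C) => forall l, (l < m)%N -> z i t - z l t = t ^+ del l * b l t).
  by apply: ucst_forall => l lm; exact: ucst_near1 (bE lm).
have [A2 A21 [e2 e20 Hb1]] := ucst_near Hb.
have {Hb A2 A21}Hb1 : near1 (fun t => forall l, (l < m)%N -> z i t - z l t = t ^+ del l * b l t).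
  by exists e2 => // t te; apply: (Hb1 0) => //; rewrite cmod0 ltW.
have {}Hb1 := near1_comp Hb1 (ang_Tn M) T0.
have crit' : near1 (fun s => \sum_(k < m) (s ^+ M) ^+ (rho - del k) *
   \prod_(l < m | l != k) Lf l s = 0 \/ rho = N).
  by case: crit => [h|h]; [apply: near1_imp h => s h; left|exists 1 => // s _; right].
have mR : 0 <= m%:R :> R by [].
have B0 : 0 < B by lra.
have A0 : 0 < A by lra.
have Bi : 0 < B^-1 by rewrite invr_gt0.
(* [c1] bounds t^N f_x relative to f, [c2] the derivative along the field, and [c3] both components
   of the gradient. *)
pose c1 := A ^+ 2 + m%:R * B.
pose c2 := A ^+ 2 + A * A ^+ 2 + m%:R * (((sD S)%:R + 1) * B * B).
pose c3 := c1 + (c2 + A * c1).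
have A20 : 0 <= A ^+ 2 by rewrite exprn_ge0 ?ltW.
have c10 : 0 <= c1 by rewrite addr_ge0 ?mulr_ge0// ltW.
have D0 : 0 <= (sD S)%:R :> R by [].
have c20 : 0 <= c2.
  by rewrite /c2 !addr_ge0 ?mulr_ge0 ?addr_ge0// ltW.
have c30 : 0 <= c3 by rewrite /c3 !addr_ge0 ?mulr_ge0// ltW.
have Bm : 1 <= B ^+ m by exact: exprn_ege1.
have ABm : 1 <= A * B ^+ m by rewrite -[leLHS]mulr1; apply: ler_pM.
exists ((c3 + 1) * (A * B ^+ m)).
  by rewrite -[leLHS]mulr1; apply: ler_pM => //; lra.
have Ai : 0 < A^-1 by rewrite invr_gt0.
have := near1_and (near1_comp (near1_small Ai) (ang_Tn M) T0)
  (near1_and (near1_and dat1 datL) (near1_and (near1_and Hb1 crit') dist_Lf)).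
apply: near1_imp => s [tA [[[[[_ _ t1] [[u1 u2 [_ uxA] [_ utA]] zest]]
   [[est1 est2] [FE Fd]]] Lb] [[bs cr] dL]]] s0.
set t := s ^+ M in tA t1 u1 u2 uxA utA zest est1 est2 FE Fd Lb bs cr dL *.
set x := xs s in u1 u2 uxA utA FE Fd dL *.
have t0 : t != 0 by rewrite expf_neq0.
have tp : 0 < cmod t by rewrite cmod_gt0.
have L0 l : (l < m)%N -> Lf l s != 0.
  by move=> lm; case: (Lb l lm) => h _ _; rewrite -cmod_gt0; apply: lt_le_trans h.
have xz k : (k < m)%N -> x != z k t.
  by move=> km; rewrite -subr_eq0 dL// mulf_neq0 ?expf_neq0// L0.
have [fxE fyE] := Fd xz.
have PE : \prod_(k < m) (x - z k t) = t ^+ H * \prod_(k < m) Lf k s.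
  rewrite expr_sum -big_split /=.
  by apply: eq_bigr => k _; exact: dL.
have Fabs : cmod (f x (t ^+ N)) = cmod (u x t) * (cmod t ^+ H * \prod_(k < m) cmod (Lf k s)).
  by rewrite FE PE !cmodM cmodX cmod_prod.
have PL1 : \prod_(k < m) cmod (Lf k s) <= B ^+ m.
  rewrite -[X in B ^+ X](card_ord m) -prodr_const; apply: ler_prod => k _.
  by rewrite cmod_ge0; case: (Lb k (ltn_ord k)).
have PL2 : B^-1 ^+ m <= \prod_(k < m) cmod (Lf k s).
  rewrite -[X in B^-1 ^+ X](card_ord m) -prodr_const; apply: ler_prod => k _.
  by rewrite (ltW Bi); case: (Lb k (ltn_ord k)).
have tH : 0 <= cmod t ^+ H by rewrite exprn_ge0.
have F1 : cmod (f x (t ^+ N)) <= A * B ^+ m * cmod t ^+ H.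
  rewrite Fabs -mulrA [B ^+ m * _]mulrC; apply: ler_pM => //.
    by rewrite mulr_ge0 ?prodr_ge0.
  by rewrite ler_wpM2l.
have F2 : (A * B ^+ m)^-1 * cmod t ^+ H <= cmod (f x (t ^+ N)).
  rewrite Fabs invfM -exprVn -mulrA [B^-1 ^+ m * _]mulrC; apply: ler_pM => //.
  - by rewrite invr_ge0 ltW.
  - by rewrite mulr_ge0 ?exprn_ge0 ?(ltW Bi).
  - by rewrite ler_wpM2l.
have u0 : u x t != 0 by rewrite -cmod_gt0; apply: lt_le_trans u1; rewrite invr_gt0.
have cux : cmod (sux S x t / u x t) <= A ^+ 2 := div_u A1 u1 uxA.
have cut : cmod (sut S x t / u x t) <= A ^+ 2 := div_u A1 u1 utA.
have tN : 0 <= cmod t ^+ N by rewrite exprn_ge0.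
have tN1 : cmod t ^+ N <= 1 by rewrite exprn_ile1.
set F := f x (t ^+ N) in F1 F2 fxE fyE *.
have Fge := cmod_ge0 F.
have fxb : cmod t ^+ N * cmod (fx f x (t ^+ N)) <= c1 * cmod F.
  have key : cmod t ^+ N * cmod (\sum_(k < m) (x - z k t)^-1) <= m%:R * B.
    case: cr => [cr|rN].
      suff -> : \sum_(k < m) (x - z k t)^-1 = 0 by rewrite cmod0 mulr0 mulr_ge0// ltW.
      have e1 : t ^+ rho * \prod_(l < m) Lf l s * \sum_(k < m) (x - z k t)^-1 =
          \sum_(k < m) t ^+ (rho - del k) * \prod_(l < m | l != k) Lf l s.
        rewrite mulr_sumr; apply: eq_bigr => k _.
        rewrite dL// (bigD1 k)//= -{1}(subnK (del_rho (ltn_ord k))) exprD.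
        by field; rewrite L0// expf_neq0.
      move: e1; rewrite cr => /eqP; rewrite !mulf_eq0 expf_eq0 (negPf t0) andbF /=.
      by rewrite prodf_seq_eq0 => /orP[/hasP[l _ /=]|/eqP//]; rewrite (negPf (L0 _ (ltn_ord l))).
    apply: (@le_trans _ _ (\sum_(k < m) B)); last first.
      by rewrite sumr_const card_ord mulr_natl.
    apply: (@le_trans _ _ (cmod t ^+ N * \sum_(k < m) cmod (x - z k t)^-1)).
      by rewrite ler_wpM2l// cmod_sum.
    rewrite mulr_sumr; apply: ler_sum => k _; rewrite dL// cmodV cmodM cmodX invfM.
    have dN : (del k <= N)%N by rewrite -rN del_rho.
    have eN : cmod t ^+ N / cmod t ^+ del k = cmod t ^+ (N - del k).
      by rewrite -{1}(subnK dN) exprD mulfK// gt_eqF// exprn_gt0.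
    rewrite mulrA eN -[leRHS]mul1r; apply: ler_pM; rewrite ?exprn_ge0 ?invr_ge0//.
      by rewrite exprn_ile1.
    have [h _ _] := Lb k (ltn_ord k).
    by rewrite invf_ple ?posrE// cmod_gt0 L0.
  rewrite fxE cmodM mulrCA mulrC ler_wpM2r//.
  apply: (@le_trans _ _ (cmod t ^+ N * (cmod (sux S x t / u x t) + cmod (\sum_(k < m) (x - z k t)^-1)))).
    by rewrite ler_wpM2l// cmodD.
  rewrite mulrDr; apply: lerD => //.
  by rewrite -[leRHS]mul1r; apply: ler_pM.
have [_ _ dzi] := zest i im.
have Fyb : cmod t ^+ N * cmod (fy f x (t ^+ N)) <= (c2 + A * c1) * cmod F.
  have e1 : N%:R * t ^+ N * fy f x (t ^+ N) = F * (t * (sut S x t / u x t) +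
      t * dz i t * (sux S x t / u x t) + \sum_(k < m) t * (dz i t - dz k t) / (x - z k t)) -
      t * dz i t * fx f x (t ^+ N).
    have -> : \sum_(k < m) t * (dz i t - dz k t) / (x - z k t) =
        t * dz i t * (\sum_(k < m) (x - z k t)^-1) - t * \sum_(k < m) dz k t / (x - z k t).
      rewrite !mulr_sumr -sumrB; apply: eq_bigr => k _; ring.
    rewrite fyE fxE; ring.
  have N1 : 1 <= N%:R :> R by rewrite ler1n; case/andP: (sN0 S).
  have h1 : cmod t ^+ N * cmod (fy f x (t ^+ N)) <= cmod (N%:R * t ^+ N * fy f x (t ^+ N)).
    by rewrite !cmodM cmod_nat cmodX -mulrA ler_peMl// mulr_ge0.
  apply: (le_trans h1); rewrite e1; apply: le_trans (cmodB _ _) _.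
  rewrite mulrDl; apply: lerD; last first.
    rewrite cmodM; apply: (@le_trans _ _ (A * cmod t ^+ N * cmod (fx f x (t ^+ N)))).
      by rewrite ler_wpM2r.
    by rewrite -!mulrA ler_wpM2l// ltW.
  rewrite cmodM mulrC ler_wpM2r//.
  apply: le_trans (cmodD _ _) _; apply: lerD.
    apply: le_trans (cmodD _ _) _; apply: lerD; rewrite cmodM.
      by rewrite -[leRHS]mul1r; apply: ler_pM.
    apply: ler_pM => //; apply: (le_trans dzi).
    by rewrite ler_piMr// ltW.
  apply: le_trans (cmod_sum _ _ _) _.
  apply: (@le_trans _ _ (\sum_(k < m) (((sD S)%:R + 1) * B * B))); last first.
    by rewrite sumr_const card_ord mulr_natl.
  apply: ler_sum => k _.
  have xk : x - z k t != 0 by rewrite subr_eq0 xz.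
  apply: cmod_div_le => //; rewrite dL// [cmod (t ^+ _ * _)]cmodM cmodX.
  have [lb _ bb] := Lb k (ltn_ord k).
  have [ek|ek] := boolP (sE S i k).
    have [_ ->] := est1 i k im (ltn_ord k) ek.
    by rewrite subrr mulr0 cmod0 !mulr_ge0 ?addr_ge0 ?exprn_ge0// ltW.
  have [_ _ h3] := est2 i k im (ltn_ord k) ek.
  have /andP[_ dD] := sdN im (ltn_ord k) ek.
  apply: (@le_trans _ _ (((sD S)%:R + 1) * cmod (z i t - z k t))).
    have -> : t * (dz i t - dz k t) = (t * (dz i t - dz k t) - (sd S i k)%:R * (z i t - z k t)) +
      (sd S i k)%:R * (z i t - z k t) by rewrite subrK.
    apply: le_trans (cmodD _ _) _; rewrite mulrDl mul1r addrC; apply: lerD.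
      by rewrite cmodM cmod_nat ler_wpM2r// ler_nat.
    apply: (le_trans h3); rewrite ler_piMl//.
    by rewrite -ler_pdivlMl// mulr1.
  rewrite bs// cmodM cmodX -!mulrA ler_wpM2l ?addr_ge0//.
  rewrite [leRHS]mulrCA [X in _ <= X](_ : _ = cmod t ^+ del k * (B * (B * cmod (Lf k s)))); last by ring.
  rewrite ler_wpM2l ?exprn_ge0// -[leLHS]mulr1; apply: ler_pM => //.
  by rewrite -ler_pdivrMl// mulr1.
split.
  have W0 : 0 < A * B ^+ m := lt_le_trans ltr01 ABm.
  have c31 : 1 <= c3 + 1 by rewrite lerDr.
  have W1 := ler_peMl (ltW W0) c31.
  apply: le_trans F2; apply: ler_wpM2r => //.
  by rewrite lef_pV2 ?posrE//; exact: lt_le_trans W1.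
apply: (@le_trans _ _ ((cmod (fx f x (t ^+ N)) + cmod (fy f x (t ^+ N))) * cmod t ^+ N)).
  by rewrite ler_wpM2r// norm2_le.
apply: (@le_trans _ _ (c3 * cmod F)).
  by rewrite mulrDl /c3 [leRHS]mulrDl; apply: lerD; rewrite mulrC.
apply: (@le_trans _ _ ((c3 + 1) * cmod F)); first by rewrite ler_wpM2r// lerDl.
by rewrite -[leRHS]mulrA ler_wpM2l// addr_ge0.
Qed.

End Curve.

End Lower.

(** * Necessity of the exponent *)

Section LowerBound.
Context {R : realType}.
Local Notation C := (Cx R).

Variables (f : C -> C -> C) (m : nat).
Hypothesis fA : ang f.
Variable S : setup f m.
Local Notation N := (sN S).
Local Notation z := (sz S).

(** On the curve, with tau = |t|, the gradient inequality gives kp tau^(H l + N) <= C0 tau^H. For l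
    < 1 - N/H the right side is smaller by the positive power tau^sg, impossible as tau tends to
    0. *)
Lemma exponent_lb (l C0 : R) (H : nat) (x t : C -> C) : gradient_exponents f l ->
  ang (fun _ s => x s) -> x 0 = 0 -> ang (fun _ s => t s) -> t 0 = 0 ->
  (forall s, s != 0 -> t s != 0) -> 1 <= C0 -> (0 < N <= H)%N ->
  near1 (fun s => s != 0 -> [/\ C0^-1 * cmod (t s) ^+ H <= cmod (f (x s) (t s ^+ N)) &
    norm2 (fx f (x s) (t s ^+ N)) (fy f (x s) (t s ^+ N)) * cmod (t s) ^+ N <= C0 * cmod (t s) ^+ H]) ->
  1 - N%:R / H%:R <= l.
Proof.
move=> [l0 [c [eps [c0 eps0 ge]]]] xA x0 tA t0 tn C01 /andP[N0 NH] est.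
have H0 : 0 < H%:R :> R by rewrite ltr0n (leq_trans N0).
have C00 : 0 < C0 := lt_le_trans ltr01 C01.
rewrite leNgt; apply/negP => ll.
pose sg := H%:R - H%:R * l - N%:R.
have sg0 : 0 < sg.
  move: ll; rewrite -(ltr_pM2l H0) mulrBr mulr1 mulrCA divff ?gt_eqF// mulr1 /sg; lra.
pose kp := c * (C0^-1) `^ l.
have kp0 : 0 < kp by rewrite mulr_gt0 ?powR_gt0 ?invr_gt0.
(* For tau <= th the bound C0 tau^sg is at most kp / 2, half of what is required. *)
pose th := (kp / (2 * C0)) `^ sg^-1.
have kC : 0 < kp / (2 * C0) by rewrite divr_gt0// mulr_gt0.
have th0 : 0 < th by rewrite powR_gt0.
have e4 : 0 < eps / 4 by rewrite divr_gt0.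
have TN : (0 : C) ^+ N = 0 by rewrite expr0n eqn0Ngt N0.
have tNA : ang (fun _ s => t s ^+ N) := ang_exp N tA.
have tN0 : t 0 ^+ N = 0 by rewrite t0.
have := near1_and (near1_and (near1_comp (near1_small e4) xA x0)
   (near1_comp (near1_small e4) tNA tN0)) (near1_and (near1_comp (near1_small th0) tA t0) est).
move=> [e e0 He]; have [s se s0] := exists_real_cmod e0.
have se' : cmod s <= e by rewrite se.
have [[h1 h2] [h3 /(_ s0)[h4 h5]]] := He s se'.
have nle : norm2 (x s) (t s ^+ N) < eps.
  by apply: le_lt_trans (norm2_le _ _) _; lra.
have := ge _ _ nle; rewrite /grad_norm -/(fx f _ _) -/(fy f _ _) => h6.
set tau := cmod (t s) in h3 h4 h5.
have tau0 : 0 < tau by rewrite cmod_gt0 tn.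
have h7 : kp * tau `^ (H%:R * l) <= c * cmod (f (x s) (t s ^+ N)) `^ l.
  rewrite /kp -mulrA ler_wpM2l ?(ltW c0)//.
  rewrite powRrM powR_mulrn ?(ltW tau0)// -powRM ?exprn_ge0 ?invr_ge0 ?(ltW tau0) ?(ltW C00)//.
  by apply: ge0_ler_powR => //; rewrite nnegrE ?mulr_ge0 ?exprn_ge0 ?invr_ge0 ?(ltW tau0) ?(ltW C00).
have h8 : kp * tau `^ (H%:R * l) * tau ^+ N <= C0 * tau ^+ H.
  apply: le_trans h5; rewrite ler_wpM2r ?exprn_ge0 ?(ltW tau0)//.
  exact: le_trans h7 h6.
have tn0 : tau != 0 by rewrite gt_eqF.
have h9 : kp <= C0 * tau `^ sg.
  have p0 : 0 < tau `^ (H%:R * l + N%:R) by rewrite powR_gt0.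
  have e1 : C0 * tau `^ sg * tau `^ (H%:R * l + N%:R) = C0 * tau ^+ H.
    rewrite -[LHS]mulrA -powRD ?tn0 ?implybT//.
    rewrite (_ : sg + (H%:R * l + N%:R) = H%:R); last by rewrite /sg; ring.
    by rewrite powR_mulrn// ltW.
  have e2 : tau `^ (H%:R * l + N%:R) = tau `^ (H%:R * l) * tau ^+ N.
    by rewrite powRD ?tn0 ?implybT// powR_mulrn// ltW.
  by rewrite -(ler_pM2r p0) e1 e2 mulrA.
have h10 : tau `^ sg <= kp / (2 * C0).
  apply: (@le_trans _ _ (th `^ sg)).
    by apply: ge0_ler_powR; rewrite ?nnegrE ?(ltW sg0) ?(ltW tau0) ?(ltW th0).
  by rewrite /th -powRrM mulVf ?gt_eqF// powRr1// ltW.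
have : C0 * tau `^ sg <= kp / 2.
  have -> : kp / 2 = C0 * (kp / (2 * C0)) by field; rewrite gt_eqF.
  by rewrite ler_wpM2l// ltW.
move=> h11; have := le_trans h9 h11; move: kp0; clear => ? ?; lra.
Qed.

(** When all factors agree, the curve x = z_0 + t^N stays at distance |t|^N from each of them, so H
    = m N. *)
Lemma single_lb (l : R) : gradient_exponents f l -> (0 < m)%N ->
  (forall k, (k < m)%N -> sE S 0 k) -> 1 - N%:R / (m * N)%:R <= l.
Proof.
move=> lP m0 Eall; have /andP[N0 _] := sN0 S.
pose b (k : nat) (t : C) : C := 0.
have bA k : (k < m)%N -> ang (fun _ t => b k t) by move=> _; exact: ang_const.
have bE k : (k < m)%N -> near1 (fun t => z 0 t - z k t = t ^+ N * b k t).
  move=> km; have /sEP := Eall k km; apply: near1_imp => t ->.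
  by rewrite subrr mulr0.
have gA : ang (fun _ (s : C) => 1 : C) by exact: ang_const.
have g0 k : (k < m)%N -> (1 : C) * 0 ^+ (N - N) + b k 0 != 0.
  by move=> _; rewrite subnn mulr1 addr0 oner_neq0.
have [C0 C01 est] := @curve_est R f m fA S 0 N (fun=> N) b (fun=> 1) 1 m0 (leqnn _) isT
  (fun _ _ => leqnn _) bA bE gA g0 (or_intror erefl).
have [xA x0] := @xs_ang R f m S 0 N (fun=> 1) 1 (leqnn _) isT gA.
have HN : (\sum_(k < m) N = m * N)%N by rewrite sum_nat_const card_ord.
rewrite HN in est.
apply: (exponent_lb lP xA x0 (ang_Tn 1) (expr1 0) _ C01 _ est).
  by move=> s s0; rewrite expr1.
by rewrite N0 leq_pmull.
Qed.

Section Pair.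
Variables (i j : nat).
Hypotheses (im : (i < m)%N) (jm : (j < m)%N) (nij : ~~ sE S i j).
Let rho := sd S i j.
(** The order of x - z_k along a generic x = z_i + g t^rho; equal factors count as having infinite
    contact. *)
Definition pdel k := if sE S i k then rho else minn (sd S i k) rho.
(** The cofactor of t^(pdel k) in z_i - z_k. When pdel k = rho its value at 0 is w_i - w_k, in the
    notation of the overview. *)
Definition pb k (t : C) : C := if sE S i k then 0 else
  if (rho <= sd S i k)%N then t ^+ (sd S i k - rho) * sv S i k t else sv S i k t.

Lemma pdel_rho k : (pdel k <= rho)%N.
Proof. by rewrite /pdel; case: ifP => // _; rewrite geq_minr. Qed.

Lemma pb_ang k : ang (fun _ t => pb k t).
Proof.
rewrite /pb; have [ek|ek] := boolP (sE S i k); first exact: ang_const.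
have [vA _ _] := svP ek; case: (rho <= sd S i k)%N => //.
by apply: ang_mul => //; exact: ang_Tn.
Qed.

Lemma pb_eq k : near1 (fun t => z i t - z k t = t ^+ pdel k * pb k t).
Proof.
rewrite /pb /pdel; have [/sEP|ek] := boolP (sE S i k).
  by apply: near1_imp => t ->; rewrite subrr mulr0.
have [_ _] := svP ek; apply: near1_imp => t ->.
by case: leqP => h //; rewrite mulrA -exprD subnKC.
Qed.

Lemma pb_ne0 k : (pdel k < rho)%N -> pb k 0 != 0.
Proof.
rewrite /pb /pdel; have [ek|ek] := boolP (sE S i k); first by rewrite ltnn.
have [_ v0 _] := svP ek.
by case: (leqP rho (sd S i k)) => h; rewrite ?ltnn.
Qed.

Lemma sE_refl k : sE S k k.
Proof. by apply/sEP; exists 1. Qed.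

Lemma pair_lb (l : R) : gradient_exponents f l ->
  1 - N%:R / (\sum_(k < m) pdel k)%N%:R <= l.
Proof.
move=> lP; have /andP[N0 _] := sN0 S.
have /andP[Nrho _] := sdN im jm nij.
(* The numbers w_k of the overview shifted by w_i, since the curve is measured from z_i. *)
pose rs := [seq - pb k 0 | k <- iota 0 m & pdel k == rho].
have rsP k : (k < m)%N -> pdel k = rho -> - pb k 0 \in rs.
  by move=> km kr; apply: map_f; rewrite mem_filter kr eqxx mem_iota.
have di : pdel i = rho by rewrite /pdel sE_refl.
have dj : pdel j = rho by rewrite /pdel (negPf nij) minnn.
have bi : pb i 0 = 0 by rewrite /pb sE_refl.
have bj : pb j 0 != 0.
  by have [_ v0 _] := svP nij; rewrite /pb (negPf nij) leqnn subnn mul1r.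
have [|P [g0 [P0 Pg0 g0rs Psum]]] := critical_value (rsP i im di) (rsP j jm dj).
  by rewrite bi oppr0 eq_sym oppr_eq0.
pose L k (X t : C) := (g0 + X) * t ^+ (rho - pdel k) + pb k t.
(* The critical equation with g = g0 + X. At t = 0 the terms with pdel k < rho drop out, so the
   logarithmic derivative over [rs], hence P, governs G X 0. *)
pose G X t := \sum_(k < m) t ^+ (rho - pdel k) * \prod_(l < m | l != k) L l X t.
have LA k : ang (L k).
  apply: ang_add; last exact: pb_ang.
  by apply: ang_mul; [apply: ang_add (ang_const _) ang_X|exact: ang_Tn].
have L0 k : (k < m)%N -> L k 0 0 != 0.
  move=> km; rewrite /L addr0; have := pdel_rho k; rewrite leq_eqVlt => /predU1P[kr|kr].
    rewrite kr subnn mulr1 addr_eq0; apply: contraNneq g0rs => ->.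
    exact: rsP.
  by rewrite expr0n subn_eq0 leqNgt kr mulr0 add0r pb_ne0.
have GA : ang G.
  have sumA n (h : nat -> C -> C -> C) : (forall k, ang (h k)) ->
      ang (fun X t => \sum_(k < n) h k X t).
    move=> hA; elim: n => [|n IH].
      by apply: (ang_near ltr01 _ (ang_const 0)) => X t _ _; rewrite big_ord0.
    by apply: (ang_near ltr01 _ (ang_add IH (hA n))) => X t _ _; rewrite big_ord_recr.
  have prodA n (h : nat -> C -> C -> C) (p : nat -> bool) : (forall k, ang (h k)) ->
      ang (fun X t => \prod_(k < n | p k) h k X t).
    move=> hA; elim: n => [|n IH].
      by apply: (ang_near ltr01 _ (ang_const 1)) => X t _ _; rewrite big_ord0.
    have := ang_mul IH (if p n as q return ang (fun X t => if q then h n X t else 1)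
      then hA n else ang_const 1).
    apply: (ang_near ltr01) => X t _ _.
    by rewrite [RHS]big_mkcond big_ord_recr /= -big_mkcond.
  apply: (sumA m (fun k X t => t ^+ (rho - pdel k) * \prod_(l < m | (l : nat) != k) L l X t)) => k.
  apply: ang_mul; first exact: ang_Tn.
  exact: (prodA m L (fun l => l != k)).
have nrs X : (forall k, (k < m)%N -> L k X 0 != 0) -> g0 + X \notin rs.
  move=> LX; apply/negP => /mapP[k]; rewrite mem_filter mem_iota add0n => /andP[/eqP kr /= km] gk.
  by have := LX k km; rewrite /L kr subnn mulr1 gk addNr eqxx.
have GE X : (forall k, (k < m)%N -> L k X 0 != 0) ->
    G X 0 = (\prod_(k < m) L k X 0) * (P.[g0 + X] / \prod_(w <- undup rs) (g0 + X - w)).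
  move=> LX; have gX := nrs X LX.
  have mE : iota 0 m = index_iota 0 m by rewrite /index_iota subn0.
  rewrite -Psum// big_map big_filter mE.
  rewrite /G mulr_sumr.
  transitivity (\sum_(k < m) if pdel k == rho then (\prod_(l < m) L l X 0) * (g0 + X - - pb k 0)^-1 else 0).
    apply: eq_bigr => k _; rewrite expr0n subn_eq0.
    have := pdel_rho k; rewrite leq_eqVlt; case: eqP => [kr _|_ /= kr].
      rewrite kr leqnn mul1r [in RHS](bigD1 k)//=.
      have -> : g0 + X - - pb k 0 = L k X 0 by rewrite /L kr subnn mulr1 opprK.
      by rewrite mulrAC mulfV ?LX// mul1r.
    by rewrite leqNgt kr mul0r.
  rewrite -(big_mkord xpredT (fun k => if pdel k == rho then (\prod_(l < m) L l X 0) * (g0 + X - - pb k 0)^-1 else 0)).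
  by rewrite -big_mkcond.
have [c [d [M [d0 cM cE]]]] := ang_coef GA.
have zd : cmod (0 : C) <= d by rewrite cmod0 ltW.
have c00 : c (0%N, 0%N) = 0.
  rewrite -pev00 -cE// GE// addr0.
  by move/rootP: Pg0 => ->; rewrite mul0r mulr0.
have [cz|[k [ck cmin]]] := nat_order (fun k => c (k, 0%N)).
  (* If G X 0 vanished identically in X, so would P(g0 + X) near X = 0, and P would be zero. *)
  exfalso; move: P0; apply/negP; rewrite negbK.
  have LN : ucst (fun A X (_ : C) => forall k, (k < m)%N -> L k X 0 != 0).
    apply: ucst_forall => k km; have [A A1 HA] := ucst_lb (LA k) (L0 k km).
    exists A => // B AB X t XB _.
    have zB : cmod (0 : C) * B <= 1 by rewrite cmod0 mul0r.
    rewrite -cmod_gt0; apply: lt_le_trans (HA B AB X 0 XB zB).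
    by rewrite invr_gt0 (lt_le_trans ltr01)// (le_trans A1).
  have [A A1 [e e0 He]] := ucst_near LN.
  have [MS cS] := cv1_poly (P \Po ('X + g0%:P)) (ler01 : 0 <= 1 :> R).
  have e1 : 0 < Num.min e d by rewrite lt_min e0.
  have PS := ser_eq0 ltr01 cS e1 _.
  have PS0 : P \Po ('X + g0%:P) = 0.
    apply/polyP => n; rewrite coef0; apply: PS => X _; rewrite le_min => /andP[Xe Xd].
    rewrite ser_poly horner_comp !hornerE addrC.
    have ze : cmod (0 : C) <= e by rewrite cmod0 ltW.
    have LX := He X 0 Xe ze; have := GE X LX.
    rewrite cE// (pev_x0 d0 cM Xd) /ser.
    rewrite (eq_csum (h := fun=> 0)) ?csum0; last by move=> k; rewrite cz mul0r.
    move=> /esym/eqP; rewrite mulf_eq0 => /orP[/prodf_eq0[k _]|].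
      by rewrite (negPf (LX k _)).
    rewrite mulf_eq0 invr_eq0 => /orP[/eqP//|]; rewrite prodf_seq_eq0 => /hasP[w wr /=].
    by rewrite subr_eq0 => /eqP gw; have := nrs X LX; rewrite gw -mem_undup wr.
  have : P \Po ('X + g0%:P) \Po ('X - g0%:P) = P.
    by rewrite -comp_polyA comp_polyD comp_polyX comp_polyC subrK comp_polyXr.
  by rewrite PS0 comp_poly0 => <-.
have k0 : (0 < k)%N by rewrite lt0n; apply: contraNneq ck => ->; rewrite c00.
(* The critical point g0 may be multiple, so it is lifted as a Puiseux root: N' is the ramification,
   with t = s^N' along the curve. *)
have [N' [h [N'0 hA h0 hroot]]] := one_root k0 d0 cM (conj cmin ck).
have T0 : (0 : C) ^+ N' = 0 by rewrite expr0n eqn0Ngt N'0.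
have gA : ang (fun _ s => g0 + h s) := ang_add (ang_const g0) hA.
have g00 l' : (l' < m)%N -> (g0 + h 0) * 0 ^+ (rho - pdel l') + pb l' 0 != 0.
  by move=> lm; have := L0 l' lm; rewrite /L h0.
have crit : near1 (fun s => \sum_(k < m) (s ^+ N') ^+ (rho - pdel k) *
   \prod_(l < m | l != k) Lf rho pdel pb (fun s => g0 + h s) N' l s = 0).
  have dom : near2 (fun X t => G X t = pev c X t) by exists d.
  have dom1 := near2_comp1 dom hA (ang_Tn N') h0 T0.
  by apply: near1_imp (near1_and dom1 hroot) => s [E1 E2]; rewrite -[RHS]E2 -E1.
have [C0 C01 est] := @curve_est R f m fA S i rho pdel pb (fun s => g0 + h s) N' im Nrho N'0
  (fun k _ => pdel_rho k) (fun k _ => pb_ang k) (fun k _ => pb_eq k) gA g00 (or_introl crit).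
have [xA x0] := @xs_ang R f m S i rho (fun s => g0 + h s) N' Nrho N'0 gA.
apply: (exponent_lb lP xA x0 (ang_Tn N') T0 _ C01 _ est).
  by move=> s s0; rewrite expf_neq0.
rewrite N0 (bigD1 (Ordinal im))//= di.
by apply: leq_trans Nrho (leq_addr _ _).
Qed.

End Pair.
End LowerBound.

(** * Puiseux series *)

Section GSeries.
Context {R : realType}.
Local Notation C := (Cx R).
Implicit Types (c : nat -> C) (a : nat -> nat -> C) (q : R).

(* The generalized series \sum_k c_k y^(k/N). *)
Definition gs (N : nat) c : gseries R := fun q =>
  if q == (Num.truncn (q * N%:R))%:R / N%:R then c (Num.truncn (q * N%:R)) else 0.

Section Den.
Variable N : nat.
Hypothesis N0 : (0 < N)%N.
Let NR : (N%:R : R) != 0. Proof. by rewrite pnatr_eq0 -lt0n. Qed.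

Lemma gs_frac c k : gs N c (k%:R / N%:R) = c k.
Proof. by rewrite /gs divfK// natrK eqxx. Qed.

Lemma frac_inj : injective (fun k : nat => k%:R / N%:R : R).
Proof. by move=> k l /(divIf NR)/eqP; rewrite eqr_nat => /eqP. Qed.

Lemma frac_eq k l : (k%:R / N%:R == l%:R / N%:R :> R) = (k == l).
Proof. exact: (inj_eq frac_inj). Qed.

Lemma gs_ne0 c q : gs N c q != 0 -> exists2 k, q = k%:R / N%:R & c k != 0.
Proof.
rewrite /gs; case: (q =P _) => [qE ck|_]; last by rewrite eqxx.
by exists (Num.truncn (q * N%:R)).
Qed.

Lemma fracP q : (exists k : nat, q = k%:R / N%:R) \/ (forall k : nat, q != k%:R / N%:R).
Proof.
have [[k ->]|h] := EM (exists k : nat, q = k%:R / N%:R); first by left; exists k.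
by right => k; apply/eqP => qk; apply: h; exists k.
Qed.

Lemma gs_off c q : (forall k : nat, q != k%:R / N%:R) -> gs N c q = 0.
Proof.
move=> h; apply/eqP; apply: contraT => /gs_ne0[k qk _].
by have := h k; rewrite qk eqxx.
Qed.

Lemma gs_spread (s : gseries R) : (forall q, s q != 0 -> exists k : nat, q = k%:R / N%:R) ->
  s = gs N (fun k => s (k%:R / N%:R)).
Proof.
move=> h; apply/funext => q; have [[k ->]|hq] := fracP q; first by rewrite gs_frac.
rewrite gs_off//; apply/eqP; apply: contraT => /h[k qk].
by have := hq k; rewrite qk eqxx.
Qed.

Lemma gs_inj c c' : gs N c = gs N c' -> c =1 c'.
Proof. by move=> h k; rewrite -(gs_frac c) h gs_frac. Qed.

Definition cauchy c c' n : C := \sum_(l < n.+1) c l * c' (n - l)%N.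
Definition cpow c i : nat -> C := iter i (cauchy c) (fun n => (n == 0%N)%:R).
(** The coefficients of the power series a(c(t), t^N), with [cpow c i] those of the i-th power of
    c. *)
Definition csub a c n : C :=
  csum (fun p : nat * nat => if (N * p.2 <= n)%N then a p.1 p.2 * cpow c p.1 (n - N * p.2)%N else 0).

Lemma gmul_gs c c' : gmul (gs N c) (gs N c') = gs N (cauchy c c').
Proof.
apply/funext => q; rewrite /gmul.
have key p : gs N c p * gs N c' (q - p) != 0 ->
    exists l k : nat, p = l%:R / N%:R /\ q = (l + k)%:R / N%:R.
  rewrite mulf_eq0 negb_or => /andP[/gs_ne0[l pl _] /gs_ne0[k qk _]].
  exists l, k; split=> //; rewrite natrD mulrDl -pl -qk; ring.
have [[n qn]|hq] := fracP q; last first.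
  rewrite gs_off// fsbig1// => p _; apply/eqP; apply: contraT => /key[l [k [_ qk]]].
  by have := hq (l + k)%N; rewrite qk eqxx.
rewrite qn gs_frac.
rewrite (@fsbigE _ _ _ _ _ [seq l%:R / N%:R | l : nat <- iota 0 n.+1]); first last.
- move=> p _ pr; rewrite -qn; apply/eqP; apply: contraT => /key[l [k [pl]]].
  rewrite qn => /frac_inj nlk; case/negP: pr; apply/mapP; exists l => //.
  by rewrite mem_iota /= ltnS nlk leq_addr.
- by [].
- by rewrite (map_inj_uniq frac_inj) iota_uniq.
rewrite big_map (eq_bigl xpredT); last by move=> l; rewrite in_setT.
rewrite /cauchy -(big_mkord xpredT (fun l => c l * c' (n - l)%N)) /index_iota subn0.
rewrite !big_seq; apply: eq_bigr => l; rewrite mem_iota /= ltnS => ln.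
by rewrite gs_frac -mulrBl -natrB// gs_frac.
Qed.

Lemma gexp_gs c i : gexp (gs N c) i = gs N (cpow c i).
Proof.
elim: i => [|i IH].
  apply/funext => q; rewrite /= /gone; have [[k ->]|hq] := fracP q.
    by rewrite gs_frac mulf_eq0 invr_eq0 (negPf NR) orbF pnatr_eq0.
  by rewrite gs_off//; have := hq 0%N; rewrite mul0r => /negPf ->.
by rewrite /gexp iterS -/(gexp _ _) IH gmul_gs.
Qed.

Lemma cpow_small c i l : c 0%N = 0 -> (l < i)%N -> cpow c i l = 0.
Proof.
move=> c0; elim: i l => // i IH l li.
rewrite /cpow iterS -/(cpow c i) /cauchy big1// => -[[|k] kl] _ /=; first by rewrite c0 mul0r.
by rewrite IH ?mulr0//; lia.
Qed.

Lemma gsubst_gs a c : c 0%N = 0 -> gsubst a (gs N c) = gs N (csub a c).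
Proof.
move=> c0; apply/funext => q; rewrite /gsubst.
have jE (j : nat) : j%:R = (N * j)%:R / N%:R :> R by rewrite natrM mulrC mulKf.
have key p : a p.1 p.2 * gexp (gs N c) p.1 (q - p.2%:R) != 0 ->
    exists2 k : nat, q = (k + N * p.2)%:R / N%:R & cpow c p.1 k != 0.
  rewrite gexp_gs mulf_eq0 negb_or => /andP[_ /gs_ne0[k qk ck]]; exists k => //.
  by rewrite natrD mulrDl -jE -qk subrK.
have [[n qn]|hq] := fracP q; last first.
  rewrite gs_off// fsbig1// => p _; apply/eqP; apply: contraT => /key[k qk].
  by have := hq (k + N * p.2)%N; rewrite qk eqxx.
pose F (p : nat * nat) := if (N * p.2 <= n)%N then a p.1 p.2 * cpow c p.1 (n - N * p.2)%N else 0.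
have FE p : a p.1 p.2 * gexp (gs N c) p.1 (q - p.2%:R) = F p.
  rewrite /F; case: leqP => h.
    by rewrite gexp_gs qn (jE p.2) -mulrBl -natrB// gs_frac.
  apply/eqP; apply: contraT => /key[k]; rewrite qn => /frac_inj nk; lia.
(* Without constant term the i-th power of c starts at degree i, so only i, j <= n contribute to
   coefficient n. *)
pose r := allpairs (@pair nat nat) (iota 0 n.+1) (iota 0 n.+1).
have ur : uniq r by rewrite allpairs_uniq ?iota_uniq// => -[? ?] [? ?] _ _ /= [-> ->].
have r0 p : p \notin r -> F p = 0.
  move=> pr; rewrite /F; case: leqP => // h.
  have [pn|pn] := leqP p.1 (n - N * p.2); last by rewrite cpow_small ?mulr0.
  case/negP: pr; case: p h pn => i j /= h pn.
  by apply/allpairsP; exists (i, j); rewrite !mem_iota /=; split => //; nia.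
rewrite qn gs_frac -qn /csub (csum_fin ur r0).2.
rewrite (@fsbigE _ _ _ _ _ r)//; last by move=> p _ pr; rewrite FE r0.
rewrite (eq_bigl xpredT); last by move=> p; rewrite in_setT.
by apply: eq_bigr => p _; rewrite FE.
Qed.

Lemma asum_eq (I : choiceType) (g h : I -> C) M : g =1 h -> asum g M -> asum h M.
Proof. by move=> gh; rewrite (funext gh). Qed.

Lemma cv1P d c M : 0 <= d -> asum (fun n => c n * (d%:C%C : C) ^+ n) M <-> cv1 d c M.
Proof.
move=> d0; rewrite /asum /cv1.
by rewrite (_ : (fun i => cmod _) = (fun n => cmod (c n) * d ^+ n))//; apply/funext => n;
  rewrite cmodM cmodX cmod_real ger0_norm.
Qed.

Lemma cauchy_asum c c' M M' t : asum (fun n => c n * t ^+ n) M -> asum (fun n => c' n * t ^+ n) M' ->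
  asum (fun n => cauchy c c' n * t ^+ n) (M * M') /\ ser (cauchy c c') t = ser c t * ser c' t.
Proof.
move=> h h'; have [hh E] := csum_mul h h'.
have [_ f1 f2] := csum_fiber (fun k : nat * nat => (k.1 + k.2)%N) hh.
have FE n : csum (fun i : nat * nat => if (i.1 + i.2)%N == n then
    c i.1 * t ^+ i.1 * (c' i.2 * t ^+ i.2) else 0) = cauchy c c' n * t ^+ n.
  have ur : uniq [seq (l, n - l)%N | l <- iota 0 n.+1].
    by rewrite map_inj_uniq ?iota_uniq// => k l [].
  rewrite (csum_fin ur _).2; last first.
    move=> [i j] nr /=; case: eqP => // ijn; case/negP: nr.
    by apply/mapP; exists i; rewrite ?mem_iota -?ijn ?addKn//=; lia.
  rewrite big_map /cauchy -(big_mkord xpredT (fun l => c l * c' (n - l)%N)) /index_iota subn0.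
  rewrite mulr_suml !big_seq; apply: eq_bigr => l; rewrite mem_iota /= ltnS => ln.
  by rewrite subnKC// eqxx mulrACA -exprD subnKC.
split; first by apply: asum_eq f1 => n; rewrite FE.
by rewrite /ser -E f2; apply: eq_csum => n; rewrite FE.
Qed.

Lemma cpow_asum c M t i : asum (fun n => c n * t ^+ n) M ->
  asum (fun n => cpow c i n * t ^+ n) (M ^+ i) /\ ser (cpow c i) t = ser c t ^+ i.
Proof.
move=> h; elim: i => [|i [IH1 IH2]].
  have off n : n != 0%N -> (n == 0%N)%:R * t ^+ n = 0 by move=> /negPf ->; rewrite mul0r.
  split; first by have := asum1 off; rewrite /= mulr1 cmod1.
  by rewrite /ser (csum1 off) /= mulr1.
by have [h1 h2] := cauchy_asum h IH1; rewrite /cpow iterS !exprS -IH2.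
Qed.

(** Formal substitution agrees with evaluation: the family indexed by (i, j) and a degree l in the
    i-th power is dominated by the norm of [a] at radius [d], and is regrouped by l + N j. *)
Lemma csub_ser a c d Ma e M : 0 < d -> pn d (fun k => a k.1 k.2) Ma -> 0 < e -> cv1 e c M ->
  M <= d -> e ^+ N <= d ->
  cv1 e (csub a c) Ma /\ forall t, cmod t <= e ->
    ser (csub a c) t = pev (fun k => a k.1 k.2) (ser c t) (t ^+ N).
Proof.
move=> d0 aM e0 cM Md eN.
have M0 : 0 <= M := sumle_ge0 cM.
have key t : cmod t <= e -> asum (fun n => csub a c n * t ^+ n) Ma /\
    ser (csub a c) t = pev (fun k => a k.1 k.2) (ser c t) (t ^+ N).
  move=> te; have ct := cv1_asum cM te.
  pose h (p : nat * nat * nat) := a p.1.1 p.1.2 * (t ^+ N) ^+ p.1.2 * (cpow c p.1.1 p.2 * t ^+ p.2).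
  have hA : asum h Ma.
    apply: (sumle_pair (m := fun k => cmod (a k.1 k.2) * d ^+ (k.1 + k.2))) aM => -[i j].
    have [pA _] := cpow_asum i ct.
    apply: sumle_weak (asumZ (a i j * (t ^+ N) ^+ j) pA) _.
    rewrite /= cmodM -mulrA ler_wpM2l// mulrC exprD cmodX cmodX; apply: ler_pM.
    - by rewrite exprn_ge0.
    - by rewrite !exprn_ge0.
    - by rewrite lerXn2r ?nnegrE// ltW.
    - rewrite lerXn2r ?nnegrE ?exprn_ge0 ?(ltW d0)//.
      by apply: le_trans eN; rewrite lerXn2r ?nnegrE ?(ltW e0).
  have [f0 f1 f2] := csum_fiber (fun p : nat * nat * nat => (p.2 + N * p.1.2)%N) hA.
  have FE n : csum (fun p : nat * nat * nat => if (p.2 + N * p.1.2)%N == n then h p else 0) =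
      csub a c n * t ^+ n.
    have [_ g1 g2] := csum_pair (f0 n); rewrite g2 /csub.
    have inner p : csum (fun l => if (l + N * p.2)%N == n then h (p, l) else 0) =
        (if (N * p.2 <= n)%N then a p.1 p.2 * cpow c p.1 (n - N * p.2)%N else 0) * t ^+ n.
      case: leqP => pn.
        rewrite (csum1 (i0 := (n - N * p.2)%N)); last first.
          by move=> l ln; case: eqP => // ln'; case/negP: ln; apply/eqP; lia.
        have tn : t ^+ n = t ^+ (N * p.2) * t ^+ (n - N * p.2) by rewrite -exprD subnKC.
        by rewrite subnK// eqxx /h /= tn -exprM; ring.
      rewrite mul0r (eq_csum (h := fun=> 0)) ?csum0// => l.
      by case: eqP => // ln; exfalso; move: pn; rewrite -ln ltnNge leq_addl.
    (* Summability of the coefficients is obtained by dividing by t^n; at t = 0 only n = 0 is not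
       trivial. *)
    rewrite (eq_csum inner); have [tz|t0] := eqVneq t 0.
      clear f0 g1 g2 inner; case: n => [|n]; last first.
        by rewrite tz expr0n /= mulr0 (eq_csum (h := fun=> 0)) ?csum0// => p; rewrite mulr0.
      by rewrite mulr1; apply: eq_csum => p; rewrite mulr1.
    have tn0 : t ^+ n != 0 by rewrite expf_neq0.
    apply: (csumZr _ (asum_divr tn0 _)); apply: asum_eq g1 => p /=; exact: inner.
  split; first by apply: asum_eq f1 => n; rewrite FE.
  rewrite /ser -(eq_csum FE) -f2; have [_ _ ->] := csum_pair hA.
  apply: eq_csum => -[i j]; rewrite /h /=.
  have [pA pE] := cpow_asum i ct.
  by rewrite (csumZ _ pA) -/(ser _ _) pE /mon /=; ring.
split; last by move=> t /key[].
apply/(cv1P _ _ (ltW e0)); apply: (key _ _).1.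
by rewrite cmod_real ger0_norm// ltW.
Qed.

End Den.
End GSeries.

(** * Convergent Puiseux series as germs *)

Section SeriesGerms.
Context {R : realType}.
Local Notation C := (Cx R).
Implicit Types (c b : nat -> C) (a : nat -> nat -> C) (e M : R) (s : gseries R).

Lemma near1_ne0 (w : C -> C) : ang (fun _ t => w t) -> w 0 != 0 -> near1 (fun t => w t != 0).
Proof.
move=> wA w0; have [A A1 [e e0 He]] := ucst_near (ucst_lb wA w0).
exists e => // t te; rewrite -cmod_gt0; have e' : cmod (0 : C) <= e by rewrite cmod0 ltW.
by apply: lt_le_trans (He _ _ e' te); rewrite invr_gt0; apply: lt_le_trans A1.
Qed.

Lemma ang1_eq0 (g : C -> C) : ang (fun _ t => g t) -> near1 (fun t => t != 0 -> g t = 0) -> g 0 = 0.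
Proof.
move=> /ang1_coef[c [d [M [d0 cM gE]]]] [e e0 He].
have z d' : 0 < d' -> cmod (0 : C) <= d' by move=> /ltW; rewrite cmod0.
rewrite gE ?z// ser0; have ed : 0 < Num.min e d by rewrite lt_min e0.
apply: (ser_eq0 d0 cM ed) => t t0; rewrite le_min => /andP[te td].
by rewrite -gE// He.
Qed.

(** Used to present the product of cofactors along an approximation as an analytic germ. *)
Lemma ang_prod n (h : nat -> C -> C -> C) : (forall k, ang (h k)) ->
  ang (fun X t => \prod_(k < n) h k X t).
Proof.
move=> hA; elim: n => [|n IH].
  by apply: (ang_near ltr01 _ (ang_const 1)) => X t _ _; rewrite big_ord0.
by apply: (ang_near ltr01 _ (ang_mul IH (hA n))) => X t _ _; rewrite big_ord_recr.
Qed.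

(** Germs in one variable form a domain: a nonzero factor is a power of t times a unit and cancels
    off t = 0. *)
Lemma prod_near0 n (h : nat -> C -> C) : (forall k, ang (fun _ t => h k t)) ->
  near1 (fun t => t != 0 -> \prod_(k < n) h k t = 0) ->
  exists2 k, (k < n)%N & near1 (fun t => t != 0 -> h k t = 0).
Proof.
move=> hA; elim: n => [|n IH] H.
  case: H => e e0 He; have [t te t0] := exists_real_cmod e0.
  have te' : cmod t <= e by rewrite te.
  by have := He t te' t0; rewrite big_ord0 => /eqP; rewrite oner_eq0.
have [[d d0 Hd]|[k [v [vA v0 [d d0 Hd]]]]] := ang1_order (hA n).
  by exists n => //; exists d => // t td _; exact: Hd.
have [|l ln Hl] := IH; last by exists l => //; exact: leqW.
have Hd' : near1 (fun t => h n t = t ^+ k * v t) by exists d.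
apply: near1_imp (near1_and H (near1_and (near1_ne0 vA v0) Hd')) => t [h1 [h2 h3]] t0.
move/eqP: (h1 t0); rewrite big_ord_recr /= mulf_eq0 => /orP[/eqP//|].
by rewrite h3 mulf_eq0 expf_eq0 (negPf t0) andbF (negPf h2).
Qed.

Definition conv0 c := c 0%N = 0 /\ exists e M, 0 < e /\ cv1 e c M.

Lemma conv0_ang c : conv0 c -> ang (fun _ t => ser c t) /\ ser c 0 = 0.
Proof. by move=> [c0 [e [M [e0 cM]]]]; split; [exact: ang_ser cM|rewrite ser0]. Qed.

Lemma cv1_small c e e' M : c 0%N = 0 -> 0 < e' <= e -> cv1 e c M -> cv1 e' c (e' / e * M).
Proof.
move=> c0 /andP[e'0 ee] cM; have e0 : 0 < e := lt_le_trans e'0 ee.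
have r0 : 0 <= e' / e by rewrite divr_ge0 ?ltW.
apply: sumle_dom (sumleZ r0 cM) _ => -[|n].
  by rewrite c0 cmod0 mul0r lexx mulr_ge0// mulr_ge0.
rewrite mulr_ge0 ?exprn_ge0 ?(ltW e'0)//= mulrCA ler_wpM2l// !exprS mulrA divfK ?gt_eqF//.
by rewrite ler_wpM2l ?(ltW e'0)// lerXn2r ?nnegrE ?(ltW e0) ?(ltW e'0).
Qed.

Lemma puiseux_series s : is_puiseux s -> exists N c, [/\ (0 < N)%N, conv0 c & s = gs N c].
Proof.
move=> [N [N0 supp [d d0 /= cv]]]; exists N, (fun k => s (k%:R / N%:R)); split=> //; last first.
  by apply: gs_spread => // q /supp[k _ ->]; exists k.
split.
  apply/eqP; apply: contraT => /supp[k k0 /(frac_inj N0) kE].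
  by rewrite -kE in k0.
exists d; set u := series _ in cv; exists (limn u); split=> //.
have u0 n : 0 <= cmod (s (n%:R / N%:R)) * d ^+ n.
  by apply: mulr_ge0 => //; apply: exprn_ge0; exact: ltW.
apply: sumle_nat => // n; rewrite -(big_mkord xpredT (fun n => cmod (s (n%:R / N%:R)) * d ^+ n)).
by apply: (nondecreasing_cvgn_le _ cv) => i j; exact: nondecreasing_series.
Qed.

Lemma puiseux_gs N c : (0 < N)%N -> conv0 c -> is_puiseux (gs N c).
Proof.
move=> N0 [c0 [e [M [e0 cM]]]]; exists N; split=> //.
  move=> q /gs_ne0[k -> ck]; exists k => //; rewrite lt0n; apply: contraNneq ck => ->.
  by rewrite c0.
exists e => //; rewrite (_ : (fun k => _) = (fun k => cmod (c k) * e ^+ k)); last first.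
  by apply/funext => k; rewrite gs_frac.
apply: nondecreasing_is_cvgn.
  move=> i j; apply: nondecreasing_series => n _ _.
  by apply: mulr_ge0 => //; apply: exprn_ge0; exact: ltW.
exists M => _ [n _ <-]; rewrite /series /= /index_iota subn0.
exact: sumle_fin cM (iota_uniq _ _).
Qed.

Lemma ser_sub c b e M e' M' t : cv1 e c M -> cmod t <= e -> cv1 e' b M' -> cmod t <= e' ->
  ser (fun n => c n - b n) t = ser c t - ser b t.
Proof.
move=> cM te bM te'; rewrite /ser -(csumB (cv1_asum cM te) (cv1_asum bM te')).
by apply: eq_csum => n; rewrite mulrBl.
Qed.

Lemma conv0_sub c b : conv0 c -> conv0 b -> conv0 (fun n => c n - b n).
Proof.
move=> [c0 [e [M [e0 cM]]]] [b0 [e' [M' [e'0 bM]]]]; split; first by rewrite c0 b0 subrr.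
exists (Num.min e e'), (M + M'); have m0 : 0 < Num.min e e' by rewrite lt_min e0.
split=> //; apply/(cv1P _ _ (ltW m0)).
have mE : cmod (((Num.min e e')%:C%C) : C) = Num.min e e' by rewrite cmod_real ger0_norm// ltW.
apply: asum_eq (asumD (cv1_asum cM _) (asumN (cv1_asum bM _))).
- by move=> n; rewrite mulrBl.
- by rewrite mE ge_min lexx.
- by rewrite mE ge_min lexx orbT.
Qed.

Lemma near_ser_sub c b : conv0 c -> conv0 b ->
  near1 (fun t => ser (fun n => c n - b n) t = ser c t - ser b t).
Proof.
move=> [c0 [e [M [e0 cM]]]] [b0 [e' [M' [e'0 bM]]]].
exists (Num.min e e'); first by rewrite lt_min e0.
by move=> t; rewrite le_min => /andP[te te']; exact: ser_sub cM te bM te'.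
Qed.

Lemma ser_inj c b : conv0 c -> conv0 b -> near1 (fun t => t != 0 -> ser c t = ser b t) -> c =1 b.
Proof.
move=> [c0 [e [M [e0 cM]]]] [b0 [e' [M' [e'0 bM]]]] [r r0 H].
by apply: (ser_uniq e0 cM e'0 bM r0) => t t0 tr; exact: H.
Qed.

Lemma is_ord_uniq s p q : is_ord s p -> is_ord s q -> p = q.
Proof.
move=> [sp hp] [sq hq]; case: (ltrgtP p q) => // h.
  by move: sp; rewrite hq ?eqxx.
by move: sq; rewrite hp ?eqxx.
Qed.

Lemma ord_is_ord s q : is_ord s q -> ord s = q.
Proof. by move=> h; apply: xget_unique => // p hp; exact: is_ord_uniq hp h. Qed.

(** If the first nonzero index of [b] differed from H, dividing by the smaller of the two powers of
    t would make a nonzero constant term vanish. *)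
Lemma gs_ord N b e M H (w : C -> C) : (0 < N)%N -> 0 < e -> cv1 e b M ->
  ang (fun _ t => w t) -> w 0 != 0 -> near1 (fun t => ser b t = t ^+ H * w t) ->
  is_ord (gs N b) (H%:R / N%:R).
Proof.
move=> N0 e0 bM wA w0 E.
have [b0|[k [bk kmin]]] := nat_order b.
  exfalso; have [r r0 Hr] := near1_and (near1_ne0 wA w0) E.
  have [t tr t0] := exists_real_cmod r0.
  have tr' : cmod t <= r by rewrite tr.
  have [w1] := Hr t tr'; rewrite /ser (eq_csum (h := fun=> 0)) ?csum0; last by move=> n; rewrite b0 mul0r.
  by move/esym/eqP; rewrite mulf_eq0 expf_eq0 (negPf t0) andbF (negPf w1).
have sA := ang_ser e0 (cv1_shift k e0 bM).
have E1 : near1 (fun t => t ^+ k * ser (fun n => b (n + k)%N) t = t ^+ H * w t).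
  have E2 : near1 (fun t => ser b t = t ^+ k * ser (fun n => b (n + k)%N) t).
    by exists e => // t te; exact: ser_shift e0 bM te kmin.
  by apply: near1_imp (near1_and E E2) => t [<- <-].
have kH : k = H.
  case: (ltngtP k H) => // h.
    have : near1 (fun t => t != 0 -> ser (fun n => b (n + k)%N) t - t ^+ (H - k) * w t = 0).
      apply: near1_imp E1 => t E1 t0; apply/eqP; rewrite subr_eq0; apply/eqP.
      by apply: (mulfI (expf_neq0 k t0)); rewrite E1 mulrA -exprD subnKC// ltnW.
    move/(ang1_eq0 (ang_sub sA (ang_mul (ang_Tn _) wA)))/eqP.
    by rewrite ser0 add0n expr0n subn_eq0 leqNgt h mul0r subr0 (negPf bk).
  have : near1 (fun t => t != 0 -> w t - t ^+ (k - H) * ser (fun n => b (n + k)%N) t = 0).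
    apply: near1_imp E1 => t E1 t0; apply/eqP; rewrite subr_eq0; apply/eqP.
    by apply: (mulfI (expf_neq0 H t0)); rewrite -E1 mulrA -exprD subnKC// ltnW.
  move/(ang1_eq0 (ang_sub wA (ang_mul (ang_Tn _) sA)))/eqP.
  by rewrite expr0n subn_eq0 leqNgt h mul0r subr0 (negPf w0).
rewrite -kH; split; first by rewrite gs_frac.
move=> p pk; apply/eqP; apply: contraT => /gs_ne0[l pl].
by rewrite kmin ?eqxx//; move: pk; rewrite pl ltr_pM2r ?invr_gt0 ?ltr0n// ltr_nat.
Qed.

(** The series agree below the order of their difference. This reconciles the condition i < j of the
    theorem with pairs found in either order. *)
Lemma approx2C s s' q : is_ord (fun p => s p - s' p) q -> approx2 s s' = approx2 s' s.
Proof.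
move=> h; apply/funext => g; apply/funext => p; rewrite /approx2 /Defs.approx.
have h' : is_ord (fun p => s' p - s p) q.
  case: h => h1 h2; split; first by rewrite -opprB oppr_eq0.
  by move=> p' /h2/eqP; rewrite subr_eq0 => /eqP ->; rewrite subrr.
rewrite (ord_is_ord h) (ord_is_ord h').
case: ifP => // pq; apply/eqP; rewrite -subr_eq0; apply/eqP; exact: h.2.
Qed.

End SeriesGerms.

(** * Newton-Puiseux roots and orders along their approximations *)

Section Roots.
Context {R : realType}.
Local Notation C := (Cx R).
Variables (f : C -> C -> C) (a : nat -> nat -> C) (d0 Ma : R).
Hypotheses (d00 : 0 < d0) (aM : pn d0 (fun k => a k.1 k.2) Ma).
Hypothesis fE : forall x t, cmod x <= d0 -> cmod t <= d0 -> f x t = pev (fun k => a k.1 k.2) x t.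

Let Tn (n : nat) : (0 < n)%N -> (0 : C) ^+ n = 0.
Proof. by move=> n0; rewrite expr0n eqn0Ngt n0. Qed.

Lemma csub_near N c : (0 < N)%N -> conv0 c -> exists e, 0 < e /\ cv1 e (csub N a c) Ma /\
  near1 (fun t => ser (csub N a c) t = f (ser c t) (t ^+ N)).
Proof.
move=> N0 [c0 [e [M [e0 cM]]]]; have M0 := sumle_ge0 cM.
pose e' := Num.min (Num.min 1 e) (Num.min d0 (d0 * e / (M + 1))).
have M10 : 0 < M + 1 by rewrite ltr_wpDl.
have e'0 : 0 < e' by rewrite !lt_min ltr01 e0 d00 divr_gt0 ?mulr_gt0.
have := lexx e'; rewrite {2}/e' !le_min -!andbA => /and4P[h1 h2 h3 h4].
have cM' : cv1 e' c (e' / e * M) by apply: cv1_small cM; rewrite ?e'0.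
have Md : e' / e * M <= d0.
  rewrite ler_pdivlMr// in h4; rewrite mulrAC ler_pdivrMr//.
  by apply: le_trans h4; rewrite ler_wpM2l ?lerDl// ltW.
have Nd : e' ^+ N <= d0.
  by apply: le_trans h3; rewrite -(prednK N0) exprS ler_piMr ?(ltW e'0)// exprn_ile1// ltW.
have [sM sE] := csub_ser N0 d00 aM e'0 cM' Md Nd.
exists e'; split=> //; split=> //; exists e' => // t te; have xd := le_trans (ser_bound cM' te) Md.
have td : cmod (t ^+ N) <= d0.
  by rewrite cmodX; apply: le_trans Nd; rewrite lerXn2r ?nnegrE ?(ltW e'0).
by rewrite (sE t te) (fE xd td).
Qed.

Lemma csub_eq0 N c : (0 < N)%N -> conv0 c ->
  near1 (fun t => f (ser c t) (t ^+ N) = 0) -> gsubst a (gs N c) = fun=> 0.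
Proof.
move=> N0 cc [r r0 H]; have [e [e0 [cM [e' e'0 E]]]] := csub_near N0 cc.
rewrite gsubst_gs//; last by case: cc.
have re : 0 < Num.min r e' by rewrite lt_min r0.
have b0 := ser_eq0 e0 cM re _; apply/funext => q.
have [[k ->]|hq] := fracP N q; last by rewrite gs_off.
rewrite gs_frac// b0// => t _; rewrite le_min => /andP[tr te].
by rewrite E// H.
Qed.

Lemma gsubst_near0 N c : (0 < N)%N -> conv0 c -> (forall q, gsubst a (gs N c) q = 0) ->
  near1 (fun t => f (ser c t) (t ^+ N) = 0).
Proof.
move=> N0 cc H; have [e [e0 [cM E]]] := csub_near N0 cc.
apply: near1_imp E => t <-; rewrite /ser (eq_csum (h := fun=> 0)) ?csum0// => n.
by rewrite -(gs_frac N0 (csub N a c)) -gsubst_gs ?H ?mul0r//; case: cc.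
Qed.

Lemma gsubst_ord N c H (w : C -> C) : (0 < N)%N -> conv0 c -> ang (fun _ t => w t) -> w 0 != 0 ->
  near1 (fun t => f (ser c t) (t ^+ N) = t ^+ H * w t) ->
  is_ord (gsubst a (gs N c)) (H%:R / N%:R).
Proof.
move=> N0 cc wA w0 Hw; have [e [e0 [cM E]]] := csub_near N0 cc.
rewrite gsubst_gs//; last by case: cc.
by apply: (gs_ord N0 e0 cM wA w0); apply: near1_imp (near1_and E Hw) => t [-> ->].
Qed.

(** The coefficients of c(t^n), used to write two Puiseux series over a common denominator. *)
Definition spread n (c : nat -> C) k : C := if (n %| k)%N then c (k %/ n)%N else 0.

Lemma spread_conv n c : (0 < n)%N -> conv0 c -> conv0 (spread n c) /\
  near1 (fun t => ser (spread n c) t = ser c (t ^+ n)).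
Proof.
move=> n0 [c0 [e [M [e0 cM]]]].
have inj : injective (fun k => n * k)%N by move=> k l /eqP; rewrite eqn_pmul2l// => /eqP.
pose e' := Num.min 1 e; have e'0 : 0 < e' by rewrite lt_min ltr01.
have e'n t : cmod t <= e' -> cmod (t ^+ n) <= e.
  rewrite le_min cmodX => /andP[t1 te]; apply: le_trans te.
  by rewrite -(prednK n0) exprS ler_piMr// exprn_ile1.
have off t k : (forall j, (n * j)%N != k) -> spread n c k * t ^+ k = 0.
  rewrite /spread; case: dvdnP => [[j ->] /(_ j)|_ _]; last by rewrite mul0r.
  by rewrite mulnC eqxx.
have E t : (fun k => spread n c k * t ^+ k) \o (fun k => n * k)%N = fun k => c k * (t ^+ n) ^+ k.
  by apply/funext => k /=; rewrite /spread dvdn_mulr// mulKn// exprM.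
have A t : cmod t <= e' -> asum (fun k => spread n c k * t ^+ k) M.
  move=> te; apply: (asum_inj_rev inj _ (off t)); rewrite E.
  exact: cv1_asum cM (e'n t te).
split.
  split; first by rewrite /spread dvdn0 div0n.
  exists e', M; split=> //; apply/(cv1P _ _ (ltW e'0)); apply: A.
  by rewrite cmod_real ger0_norm// ltW.
exists e'; first exact: e'0.
move=> t te; have := csum_inj inj (A t te) (off t).
by rewrite E /ser => <-.
Qed.

Lemma gs_spread_mul n N c : (0 < n)%N -> (0 < N)%N -> gs N c = gs (n * N) (spread n c).
Proof.
move=> n0 N0; have nN : (0 < n * N)%N by rewrite muln_gt0 n0.
have nR : (n%:R : R) != 0 by rewrite pnatr_eq0 -lt0n.
have fE' k : k%:R / N%:R = (n * k)%:R / (n * N)%:R :> R.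
  by rewrite !natrM invfM mulrACA divff// mul1r.
rewrite [LHS](@gs_spread _ (n * N) nN); last first.
  by move=> q /gs_ne0[k -> _]; exists (n * k)%N; rewrite fE'.
apply/funext => q; have [[k ->]|hq] := fracP (n * N) q; last by rewrite !gs_off.
rewrite !gs_frac// /spread; case: dvdnP => [[j ->]|h].
  by rewrite mulnC -fE' gs_frac// mulKn.
apply/eqP; apply: contraT => /gs_ne0[l kl _]; case: h; exists l.
by move: kl; rewrite fE' => /(frac_inj nN); rewrite mulnC.
Qed.

Variables (m : nat) (S : setup f m).
Local Notation N := (sN S).
Local Notation z := (sz S).
Let N0 : (0 < N)%N. Proof. by case/andP: (sN0 S). Qed.

Variable c : nat -> nat -> C.
Hypothesis cc : forall k, conv0 (c k).
Hypothesis cz : forall k, near1 (fun t => z k t = ser (c k) t).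

Lemma root_np k : (k < m)%N -> is_NP_root a (gs N (c k)).
Proof.
move=> km; split; first exact: puiseux_gs.
suff -> : gsubst a (gs N (c k)) = fun=> 0 by [].
apply: csub_eq0 => //.
have F := near2_comp1 (sF S) (szA S k) (ang_Tn 1) (sz0 S k) (expr1 0).
apply: near1_imp (near1_and F (cz k)) => t []; rewrite expr1 => FE <-.
by rewrite FE (bigD1 (Ordinal km))//= subrr mul0r mulr0.
Qed.

(** For a root b(y^(1/n)), put y = t^(n N) and evaluate the factorization at x = b(t^N), with
    ramified variable t^n. The unit cancels, so some factor b(t^N) - z_k(t^n) vanishes
    identically. *)
Lemma np_root (s : gseries R) : is_NP_root a s -> exists2 k, (k < m)%N & s = gs N (c k).
Proof.
move=> [/puiseux_series[n [b [n0 bc ->]]] sub0].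
have [bA b0] := conv0_ang bc.
have xA := ang_comp1 bA (ang_Tn N) (Tn N0).
have x0 : ser b (0 ^+ N) = 0 by rewrite Tn.
have F := near2_comp1 (sF S) xA (ang_Tn n) x0 (Tn n0).
have Z := near1_comp (gsubst_near0 n0 bc sub0) (ang_Tn N) (Tn N0).
have uA := ang_comp (suA S) xA (ang_Tn n) x0 (Tn n0).
have u0 : su S (ser b (0 ^+ N)) (0 ^+ n) != 0 by rewrite x0 Tn// su0.
have hA k : ang (fun _ t => ser b (t ^+ N) - z k (t ^+ n)).
  exact: ang_sub xA (ang_comp1 (szA S k) (ang_Tn n) (Tn n0)).
have [|k km H] := @prod_near0 R m _ hA.
  apply: near1_imp (near1_and (near1_and F Z) (near1_ne0 uA u0)) => t [[FE ZE] ut] _.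
  move: FE; rewrite exprAC ZE => /esym/eqP.
  by rewrite mulf_eq0 (negPf ut) => /eqP.
exists k => //.
have [bs bsE] := spread_conv N0 bc; have [cs csE] := spread_conv n0 (cc k).
rewrite (gs_spread_mul b N0 n0) (gs_spread_mul (c k) n0 N0) mulnC; congr gs.
apply/funext; apply: ser_inj => //.
apply: near1_imp (near1_and (near1_and bsE csE) (near1_and H (near1_comp (cz k) (ang_Tn n) (Tn n0)))).
by move=> t [[-> ->] [h <-]] t0; apply/eqP; rewrite -subr_eq0 h.
Qed.

Lemma gs_sE k l : gs N (c k) = gs N (c l) <-> sE S k l.
Proof.
have E := near1_and (cz k) (cz l); split=> [/(gs_inj N0) h|/sEP h].
  by apply/sEP; apply: near1_imp E => t [-> ->]; rewrite (funext h).
congr gs; apply/funext; apply: ser_inj => //.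
by apply: near1_imp (near1_and E h) => t [[-> ->]].
Qed.

Section Pair.
Variables i j : nat.
Hypotheses (im : (i < m)%N) (jm : (j < m)%N) (nij : ~~ sE S i j).
Local Notation rho := (sd S i j).
Local Notation H := (\sum_(k < m) pdel S i j k)%N.

Lemma pair_ord : is_ord (fun q => gs N (c i) q - gs N (c j) q) (rho%:R / N%:R).
Proof.
have -> : (fun q => gs N (c i) q - gs N (c j) q) = gs N (fun n => c i n - c j n).
  apply/funext => q; have [[k ->]|hq] := fracP N q; first by rewrite !gs_frac.
  by rewrite !gs_off// subrr.
have [_ [e [M [e0 cM]]]] := conv0_sub (cc i) (cc j).
have [vA v0 vE] := svP nij.
apply: (gs_ord N0 e0 cM vA v0).
apply: near1_imp (near1_and (near1_and (cz i) (cz j)) (near1_and vE (near_ser_sub (cc i) (cc j)))).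
by move=> t [[<- <-] [<- <-]].
Qed.

Definition trunc g n : C := if (n < rho)%N then c i n else if n == rho then g else 0.

Lemma approx2_gs g : approx2 (gs N (c i)) (gs N (c j)) g = gs N (trunc g).
Proof.
apply/funext => q; rewrite /approx2 (ord_is_ord pair_ord) /Defs.approx.
have NR : 0 < (N%:R : R)^-1 by rewrite invr_gt0 ltr0n.
have [[k ->]|hq] := fracP N q.
  by rewrite !gs_frac// /trunc ltr_pM2r// ltr_nat frac_eq.
by rewrite !gs_off//; case: ifP => // _; rewrite (negPf (hq _)).
Qed.

Lemma trunc_conv g : conv0 (trunc g) /\
  exists gt : C -> C, [/\ ang (fun _ t => gt t), gt 0 = g - c i rho &
    near1 (fun t => ser (trunc g) t = z i t + t ^+ rho * gt t)].
Proof.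
have /andP[Nrho _] := sdN im jm nij.
have rho0 : (0 < rho)%N := leq_trans N0 Nrho.
pose P := \poly_(n < rho.+1) trunc g n.
have PE n : P`_n = trunc g n.
  rewrite coef_poly ltnS /trunc; by case: (ltngtP n rho).
have tE : trunc g = fun n => P`_n by apply/funext => n; rewrite PE.
have sP t : ser (trunc g) t = P.[t] by rewrite tE ser_poly.
have [ci0 [e [M [e0 cM]]]] := cc i.
have sA := ang_ser e0 (cv1_shift rho e0 cM).
split.
  split; first by rewrite /trunc rho0.
  have [M' PM] := cv1_poly P (ler01 : 0 <= 1 :> R); exists 1, M'; split=> //.
  by rewrite tE.
exists (fun t => g - ser (fun n => c i (n + rho)%N) t); split.
- exact: ang_sub (ang_const g) sA.
- by rewrite ser0.
- have E1 : near1 (fun t => ser (c i) t = \sum_(n < rho) c i n * t ^+ n +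
      t ^+ rho * ser (fun n => c i (n + rho)%N) t).
    exists e => // t te; rewrite {1}/ser (csum_split rho (cv1_asum cM te)); congr (_ + _).
    rewrite -(csumZ _ (cv1_asum (cv1_shift rho e0 cM) te)).
    by apply: eq_csum => n; rewrite exprD; ring.
  apply: near1_imp (near1_and E1 (cz i)) => t [E ->].
  rewrite sP horner_poly big_ord_recr /= {2}/trunc ltnn eqxx E.
  rewrite (eq_bigr (fun n : 'I_rho => c i n * t ^+ n)); first ring.
  by move=> n _; rewrite /trunc ltn_ord.
Qed.

(** Along the approximation, x - z_k is t^(pdel k) times an analytic cofactor. When pdel k = rho the
    excluded g is the coefficient of t^rho in z_k, for which this cofactor would vanish at 0; when
    pdel k < rho, its value at 0 does not involve g. *)
Lemma approx2_order g : (forall k, (k < m)%N -> g != c i rho - pb S i j k 0) ->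
  is_ord (gsubst a (approx2 (gs N (c i)) (gs N (c j)) g)) (H%:R / N%:R).
Proof.
move=> gk; rewrite approx2_gs.
have /andP[Nrho _] := sdN im jm nij.
have rho0 : (0 < rho)%N := leq_trans N0 Nrho.
have [tc [gt [gA g0 gE]]] := trunc_conv g.
have [xA x0] := conv0_ang tc.
have F := near2_comp1 (sF S) xA (ang_Tn 1) x0 (expr1 0).
have bA k : ang (fun (_ : C) t => pb S i j k t + t ^+ (rho - pdel S i j k) * gt t).
  exact: ang_add (pb_ang S i j k) (ang_mul (ang_Tn _) gA).
have uA := ang_comp (suA S) xA (ang_Tn 1) x0 (expr1 0).
apply: (gsubst_ord N0 tc (ang_mul uA (ang_prod m bA))).
  rewrite x0 expr1 mulf_neq0 ?su0//; apply/prodf_neq0 => -[k km] _ /=.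
  rewrite expr0n subn_eq0 g0; have := pdel_rho S i j k; rewrite leq_eqVlt => /predU1P[kr|kr].
    rewrite kr leqnn mul1r; apply: contraNneq (gk k km) => h; apply/eqP.
    rewrite (_ : g = pb S i j k 0 + (g - c i rho) + (c i rho - pb S i j k 0)); last by ring.
    by rewrite h add0r.
  by rewrite leqNgt kr mul0r addr0 pb_ne0.
have B : near1 (fun t => forall k, (k < m)%N -> z i t - z k t = t ^+ pdel S i j k * pb S i j k t).
  have Hb : ucst (fun (_ : R) (_ t : C) => forall k, (k < m)%N ->
      z i t - z k t = t ^+ pdel S i j k * pb S i j k t).
    by apply: ucst_forall => k km; exact: ucst_near1 (pb_eq S i j k).
  have [A _ [e e0 He]] := ucst_near Hb.
  by exists e => // t te; apply: (He 0) => //; rewrite cmod0 ltW.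
apply: near1_imp (near1_and (near1_and F B) gE) => t [[FE BE] gtE].
rewrite expr1 in FE *; rewrite FE mulrCA; congr (_ * _).
rewrite expr_sum -big_split /=; apply: eq_bigr => -[k km] _ /=.
by rewrite gtE addrAC BE// mulrDr mulrA -exprD subnKC ?pdel_rho.
Qed.

Lemma approx2_ordE : approx2_ord a (gs N (c i)) (gs N (c j)) = H%:R / N%:R.
Proof.
pose rs := [seq c i rho - pb S i j k 0 | k <- iota 0 m].
have ord_rs g : g \notin rs -> is_ord (gsubst a (approx2 (gs N (c i)) (gs N (c j)) g)) (H%:R / N%:R).
  move=> gr; apply: approx2_order => k km; apply: contraNneq gr => ->.
  by apply/mapP; exists k => //; rewrite mem_iota.
apply: xget_unique.
  by exists [set` rs]; [exact: finite_seq|move=> g /negP; exact: ord_rs].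
move=> o [E /finite_seqP[s ->] Ho].
(* Two candidate orders are compared at one g outside both exceptional sets: a number of modulus
   above the sum of all their moduli. *)
pose b := 1 + \sum_(w <- rs ++ s) cmod w.
have b0 : 0 < b by rewrite ltr_pwDl// sumr_ge0.
have [g gb _] := exists_real_cmod b0.
have gn : g \notin rs ++ s.
  apply/negP => gin; have : cmod g <= \sum_(w <- rs ++ s) cmod w.
    by rewrite (big_rem g gin)/= lerDl sumr_ge0.
  by rewrite gb /b -subr_le0 addrK ler10.
move: gn; rewrite mem_cat negb_or => /andP[g1 /negP g2].
exact: is_ord_uniq (Ho g g2) (ord_rs g g1).
Qed.

End Pair.
End Roots.

Section Data.
Context {R : realType}.
Local Notation C := (Cx R).
Variables (f : C -> C -> C) (m : nat) (S : setup f m).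
Local Notation N := (sN S).

Lemma pdel_ge i j : (i < m)%N -> (j < m)%N -> ~~ sE S i j -> (m * N <= \sum_(k < m) pdel S i j k)%N.
Proof.
move=> im jm nij; have /andP[h _] := sdN im jm nij.
rewrite -[X in (X * N)%N]card_ord -sum_nat_const; apply: leq_sum => k _.
rewrite /pdel; case: ifPn => // nik; have /andP[h' _] := sdN im (ltn_ord k) nik.
by rewrite leq_min h' h.
Qed.

Lemma root_coef : exists c : nat -> nat -> C,
  forall k, conv0 (c k) /\ near1 (fun t => sz S k t = ser (c k) t).
Proof.
have [k|c cP] := @choice nat (nat -> C)
  (fun k c => conv0 c /\ near1 (fun t => sz S k t = ser c t)); last by exists c.
have [c [d [M [d0 cM E]]]] := ang1_coef (szA S k).
exists c; split; last by exists d.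
split; last by exists d, M.
by rewrite -ser0 -E ?sz0// cmod0 ltW.
Qed.

End Data.

Theorem corollary4p3 (R : realType)
  (f : Cx R -> Cx R -> Cx R) (a : nat -> nat -> Cx R)
  (f_analytic : taylor_at0 f a) (f0 : f 0 0 = 0)
  (m : nat) (f_regular : mini_regular a m)
  (r : nat) (xi : 'I_r -> gseries R)
  (xi_distinct : injective xi)
  (xi_roots : forall s : gseries R, is_NP_root a s <-> exists i, xi i = s) :
  exists L : R, is_minimum (gradient_exponents f) L /\
    if r == 1%N then L = (m%:R - 1) / m%:R
    else is_maximum
      [set v | exists i j : 'I_r,
         (i < j)%N /\ v = 1 - 1 / approx2_ord a (xi i) (xi j)] L.
Proof.
have [d [Ma [d0 aM fE]]] := taylor_pev f_analytic.
have fA : ang f.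
  by apply: (ang_near d0 _ (ang_pev d0 aM)) => x t xd td; rewrite fE.
have reg := regular_order f_regular.
have m0 : (0 < m)%N.
  case: (posnP m) => // m0; have z0 : cmod (0 : Cx R) <= d by rewrite cmod0 ltW.
  by have := reg.2; rewrite m0 -(pev00 (fun k => a k.1 k.2)) -fE// f0 eqxx.
have [K _ coneK] := cone f_analytic f_regular.
have fE2 : near2 (fun x t => f x t = pev (fun k => a k.1 k.2) x t) by exists d.
have [S _] := setup_exists d0 aM reg fE2 coneK.
have /andP[N0 _] := sN0 S.
have [c cP] := root_coef S.
have cc k : conv0 (c k) by case: (cP k).
have cz k : near1 (fun t => sz S k t = ser (c k) t) by case: (cP k).
pose z k := gs (sN S) (c k).
have xiz i : exists2 k, (k < m)%N & xi i = z k.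
  by apply: (np_root d0 aM fE cc cz); apply/xi_roots; exists i.
have zxi k : (k < m)%N -> exists i, xi i = z k.
  by move=> km; apply/xi_roots; exact: (root_np d0 aM fE cc cz).
have zE k l : z k = z l <-> sE S k l := gs_sE cc cz k l.
have NR : 0 < (sN S)%:R :> R by rewrite ltr0n.
(* A single distinct root means that all m factors agree; then H = m N and 1 - N/H = (m - 1)/m. *)
case: eqP => r1.
  have allE k : (k < m)%N -> sE S 0 k.
    move=> km; apply/zE; have [i <-] := zxi 0%N m0; have [j <-] := zxi k km.
    by congr xi; apply/val_inj; case: i j => [i ir] [j jr] /=; lia.
  exists (1 - (sN S)%:R / (m * sN S)%N%:R); split.
    split; first apply: upper => // k s km sm; last by move=> l lP; exact: (single_lb fA lP m0 allE).
    case/negP; apply/zE; rewrite -(iffRL (zE 0%N k) (allE k km)).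
    exact/zE/allE.
  have mR : 0 < m%:R :> R by rewrite ltr0n.
  by rewrite natrM; field; rewrite !gt_eqF.
pose nE (p : 'I_m * 'I_m) := ~~ sE S p.1 p.2.
pose H (p : 'I_m * 'I_m) := (\sum_(k < m) pdel S p.1 p.2 k)%N.
have [p0 p0E|allE] := pickP nE; last first.
  exfalso; apply: r1; have [i0 i0E] := zxi 0%N m0.
  have all0 i : i = i0.
    apply: xi_distinct; have [k km ->] := xiz i; rewrite i0E; apply/zE.
    by have := allE (Ordinal km, Ordinal m0); rewrite /nE /= => /negbT; rewrite negbK.
  by rewrite -(card_ord r); apply/eqP/fintype1P; exists i0.
(* The pair of largest H serves twice: it dominates every sum required by [upper], and its own curve
   gives the lower bound. *)
case: (@arg_maxnP _ p0 nE H p0E) => p pE pmax.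
have mH q : nE q -> (m * sN S <= H q)%N by move=> qE; exact: pdel_ge.
have H0 q : nE q -> 0 < (H q)%:R :> R.
  by move=> qE; rewrite ltr0n (leq_trans _ (mH q qE))// muln_gt0 m0.
have ordE q : nE q -> approx2_ord a (z q.1) (z q.2) = (H q)%:R / (sN S)%:R.
  by move=> qE; exact: (approx2_ordE d0 aM fE cc cz).
exists (1 - (sN S)%:R / (H p)%:R); split.
  split; last by move=> l lP; exact: (pair_lb fA _ _ pE lP).
  apply: upper => // [|k s km sm ks]; first exact: mH.
  exact: (pmax (Ordinal km, Ordinal sm)).
split.
  have [i iE] := zxi p.1 (ltn_ord _); have [j jE] := zxi p.2 (ltn_ord _).
  have oE : 1 - 1 / ((H p)%:R / (sN S)%:R) = 1 - (sN S)%:R / (H p)%:R :> R.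
    by rewrite div1r invf_div.
  have := pair_ord cc cz pE; rewrite -/(z _) -/(z _) => dE.
  case: (ltngtP i j) => ij.
  - by exists i, j; split=> //; rewrite iE jE ordE.
  (* The maximal pair is met in the order opposite to i < j, so the approximation is swapped. *)
  - exists j, i; split=> //; rewrite iE jE.
    by rewrite /approx2_ord -(approx2C dE) -/(approx2_ord a (z p.1) (z p.2)) ordE.
  - by case/negP: pE; apply/zE; rewrite -iE -jE; congr xi; apply/val_inj.
move=> _ [i [j [ij ->]]]; have [k km iE] := xiz i; have [l lm jE] := xiz j.
pose q := (Ordinal km, Ordinal lm).
have qE : nE q.
  apply/negP => /zE/=; rewrite -iE -jE => /xi_distinct ijE.
  by rewrite ijE ltnn in ij.
rewrite iE jE (ordE q qE) div1r invf_div lerB// ler_wpM2l ?(ltW NR)//.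
by rewrite lef_pV2 ?posrE ?H0// ler_nat; exact: (pmax q qE).
Qed.
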